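(* Let $n,p,q$ be positive integers with $q\le n$ and let $SNR>0$. Consider the sparse-sensing channel $\mathbf{y}=\mathbf{A}\mathbf{x}+\mathbf{z}$ described in the context, where the support $b$ is unknown to both the transmitter and the receiver, and $\mathbf{A}$ is known to the receiver only. If the transmitted signal $c$ has i.i.d. circularly symmetric complex Gaussian elements of zero mean and unit variance and is independent of $b$, then $$I(c;\mathbf{y}\mid\mathbf{A})\;\ge\; I(c;\mathbf{y}\mid\mathbf{A},b)-H(b)\;=\;I_{MIMO}-\log\binom{n}{q},$$ where $$I_{MIMO}=E\left[\log\det\left(\mathbf{I}_p+\frac{SNR}{q}\,\mathbf{H}\mathbf{H}^H\right)\right]$$ and $\mathbf{H}$ is a $p\times q$ random matrix with i.i.d. circularly symmetric complex Gaussian entries of zero mean and unit variance. Consequently the signal information rate $R_c=I_{MIMO}-H(b)$ (whenever it is nonnegative) can always be achieved with the support unknown to the transmitter.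
   Context: All logarithms are base 2. Channel model. In one channel use the receiver observes $\mathbf{y}=\mathbf{A}\mathbf{x}+\mathbf{z}\in\mathbb{C}^p$. The sensing matrix $\mathbf{A}$ is $p\times n$ with i.i.d. circularly symmetric complex Gaussian entries of zero mean and unit variance; the noise $\mathbf{z}$ has i.i.d. circularly symmetric complex Gaussian entries of zero mean and variance $q/SNR$. The support $b$ is a uniformly distributed random subset of $\{1,\dots,n\}$ of size $q$, so that $H(b)=\log\binom{n}{q}$. The quantities $\mathbf{A},\mathbf{z},b,c$ are mutually independent; they are drawn afresh and independently for each channel use, except that $c$ may be coded across channel uses. Construction of $\mathbf{x}$ from $b$ and the signal $c$. The vector $\mathbf{x}\in\mathbb{C}^n$ has support $b$ and is formed by the channel in either of two ways (the claim holds for both): (C1) $c\in\mathbb{C}^q$, and the elements of $c$ are placed in increasing order of index at the $q$ positions in $b$, the other elements of $\mathbf{x}$ being zero; or (C2) $c\in\mathbb{C}^n$, and $\mathbf{x}$ is the element-wise product of $c$ with the 0/1 indicator vector of $b$. A rate $R_c$ is achieved if it is a limit of rates of block codes over the signal sequence $(c_1,\dots,c_N)$, with encoder depending only on the message, the elements of $c_t$ having mean square value 1 on average, and the message being decoded from $(\mathbf{y}_t,\mathbf{A}_t)_{t=1}^N$ with error probability tending to 0 as $N\to\infty$. *)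

(* Defs.v *)
From HB Require Import structures.
From mathcomp Require Import all_boot all_order all_algebra.
From mathcomp Require Import spectral complex.
From mathcomp Require Import all_classical all_reals all_analysis.
From mathcomp Require Import measurable_realfun.

Set Implicit Arguments.
Unset Strict Implicit.
Unset Printing Implicit Defensive.

Import Order.TTheory GRing.Theory Num.Theory.
Import numFieldNormedType.Exports.

Local Open Scope classical_set_scope.
Local Open Scope ring_scope.
Local Open Scope complex_scope.
Local Open Scope sesquilinear_scope.

(* R[i] and matrices carry the product Borel sigma-algebra, generated by the
   real and imaginary parts, resp. by the entries. *)

HB.instance Definition _ (R : realType) := isPointed.Build R[i] 0.

Section measurable_complex.
Variable R : realType.

Definition measurable_complex : set (set R[i]) :=
  <<s preimage_set_system setT (@complex.Re R) measurable `|`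
      preimage_set_system setT (@complex.Im R) measurable >>.

HB.instance Definition _ := @isMeasurable.Build default_measure_display R[i]
  measurable_complex (@sigma_algebra0 _ _ _) (@sigma_algebraC _ _)
  (@sigma_algebra_bigcup _ _ _).

End measurable_complex.

Definition measure_matrix_display : measure_display -> measure_display.
Proof. exact. Qed.

Section measurable_matrix.
Context {d : measure_display} (T : measurableType d) (m n : nat).

Definition measurable_matrix : set (set 'M[T]_(m, n)) :=
  <<s \bigcup_(ij in [set: 'I_m * 'I_n])
        preimage_set_system setT (fun M : 'M[T]_(m, n) => M ij.1 ij.2)
          measurable >>.

HB.instance Definition _ := @isMeasurable.Build (measure_matrix_display d)
  'M[T]_(m, n) measurable_matrix (@sigma_algebra0 _ _ _) (@sigma_algebraC _ _)
  (@sigma_algebra_bigcup _ _ _).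

End measurable_matrix.

HB.instance Definition _ (T : finType) := isPointed.Build {set T} (@finset.set0 T).

HB.instance Definition _ (T : finType) :=
  @isMeasurable.Build default_measure_display {set T} discrete_measurable
    discrete_measurable0 discrete_measurableC discrete_measurableU.

HB.instance Definition _ d1 d2 (T1 : measurableType d1) (T2 : measurableType d2) :=
  isMeasurableFun.Build _ _ _ _ (@fst T1 T2) measurable_fst.

HB.instance Definition _ d1 d2 (T1 : measurableType d1) (T2 : measurableType d2) :=
  isMeasurableFun.Build _ _ _ _ (@snd T1 T2) measurable_snd.

(* Information is measured in bits. *)
Definition log2 {R : realType} (x : R) : R := ln x / ln 2.

(* F is a family of sigma-algebras, typically those generated by random
   variables (g_sigma_algebra_preimage). *)
Definition mutually_independent {d} {T : measurableType d} {R : realType}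
    (P : probability T R) (I : eqType) (F : I -> set (set T)) : Prop :=
  forall (s : seq I) (E : I -> set T), uniq s ->
    (forall i, i \in s -> F i (E i)) ->
    P (\big[setI/setT]_(i <- s) E i) = (\prod_(i <- s) P (E i))%E.

(* Law of a circularly symmetric complex Gaussian of mean 0 and variance v:
   independent real and imaginary parts, each N(0, v / 2).  The second argument
   of [normal_prob] is the standard deviation. *)
Definition complex_normal {R : realType} (v : R) : set R[i] -> \bar R :=
  pushforward
    (normal_prob 0 (Num.sqrt (v / 2)) \x normal_prob 0 (Num.sqrt (v / 2)))%E
    (fun xy => xy.1 +i* xy.2).

Definition iid_complex_normal {d} {T : measurableType d} {R : realType}
    (P : probability T R) (v : R) (m n : nat) (X : T -> 'M[R[i]]_(m, n)) : Prop :=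
  mutually_independent P
    (fun ij : 'I_m * 'I_n => g_sigma_algebra_preimage (fun w => X w ij.1 ij.2)) /\
  forall i j (B : set R[i]), measurable B ->
    P [set w | B (X w i j)] = complex_normal v B.

Definition uniform_support {d} {T : measurableType d} {R : realType}
    (P : probability T R) (n q : nat) (b : T -> {set 'I_n}) : Prop :=
  forall s : {set 'I_n},
    P [set w | b w = s] = (if #|s| == q then ('C(n, q)%:R)^-1 else 0)%:E.

(* The two ways of forming x: [Packed] puts the q elements of the signal, in
   increasing order of index, on the support; [Masked] multiplies a signal of
   length n by the indicator of the support. *)
Inductive construction := Packed | Masked.

Definition signal_dim (cs : construction) (n q : nat) : nat :=
  match cs with Packed => q | Masked => n end.

(* [enum b] lists b in increasing order, so for #|b| = q the k-th element of c
   lands on the k-th smallest index of b. *)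
Definition sparse_vector {K : nzRingType} (cs : construction) (n q : nat) :
    {set 'I_n} -> 'cV[K]_(signal_dim cs n q) -> 'cV[K]_n :=
  match cs with
  | Packed => fun b (c : 'cV[K]_q) =>
      \col_i \sum_(k < q | (i \in b) && (index i (enum b) == k)) c k 0
  | Masked => fun b (c : 'cV[K]_n) => \col_i (c i 0 * (i \in b)%:R)
  end.
Arguments sparse_vector {K} cs {n q}.

Definition channel_output {K : nzRingType} (cs : construction) (n p q : nat)
    (A : 'M[K]_(p, n)) (z : 'cV[K]_p) (b : {set 'I_n})
    (c : 'cV[K]_(signal_dim cs n q)) : 'cV[K]_p :=
  A *m sparse_vector cs b c + z.
Arguments channel_output {K} cs {n p q}.

Record channel_law {d} {T : measurableType d} {R : realType}
    (P : probability T R) (n p q : nat) (snr : R)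
    (A : T -> 'M[R[i]]_(p, n)) (z : T -> 'cV[R[i]]_p) (b : T -> {set 'I_n}) :
    Prop := ChannelLaw {
  sensing_law : iid_complex_normal P 1 A;
  noise_law : iid_complex_normal P (q%:R / snr) z;
  support_law : uniform_support P q b }.

Section information.
Context {R : realType}.

Definition entropy {d} {T : measurableType d} (P : probability T R)
    (F : finType) (X : T -> F) : R :=
  - \sum_(x : F)
      fine (P [set w | X w = x]) * log2 (fine (P [set w | X w = x])).

Definition relative_entropy {d} {T : measurableType d} (mu nu : probability T R) :
    \bar R :=
  if `[< mu `<< nu >] then
    (\int[mu]_x (log2 (fine (Radon_Nikodym (charge_of_finite_measure mu) nu x)))%:E)%E
  else +oo%E.

Definition divergence_from_product {d1 d2} {T1 : measurableType d1}
    {T2 : measurableType d2} (mu : probability (T1 * T2)%type R) : \bar R :=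
  relative_entropy mu
    (distribution mu (@fst T1 T2) \x distribution mu (@snd T1 T2))%E.

Context {d} {T : measurableType d} (P : probability T R).

Definition regular_conditional_law {dw dz} {TW : measurableType dw}
    {TZ : measurableType dz} (W : T -> TW) (Z : T -> TZ) (k : TZ -> probability TW R) :
    Prop :=
  (forall E : set TW, measurable E -> measurable_fun [set: TZ] (k ^~ E)) /\
  forall (E : set TW) (G : set TZ), measurable E -> measurable G ->
    P (W @^-1` E `&` Z @^-1` G) = (\int[P]_(w in Z @^-1` G) k (Z w) E)%E.

(* I(X; Y | Z), the mean over Z of the divergence of the conditional law of
   (X, Y) from the product of its marginals.  On standard Borel spaces the
   conditional law exists and is unique up to a null set, so that the value
   chosen by [get] is the only one. *)
Definition cond_mutual_information {dx dy dz} {TX : measurableType dx}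
    {TY : measurableType dy} {TZ : measurableType dz}
    (X : T -> TX) (Y : T -> TY) (Z : T -> TZ) : \bar R :=
  get [set v : \bar R | exists k : TZ -> probability (TX * TY)%type R,
    regular_conditional_law (fun w => (X w, Y w)) Z k /\
    v = (\int[P]_w divergence_from_product (k (Z w)))%E].

(* The determinant is a positive real number. *)
Definition mimo_information (p q : nat) (snr : R) (H : T -> 'M[R[i]]_(p, q)) :
    \bar R :=
  ('E_P[fun w => log2 (complex.Re
     (\det (1%:M + (snr / q%:R)%:C *: (H w *m (H w) ^t* ))))])%E.

End information.

(* The decoder sees the pairs (y_t, A_t). *)
Record block_code (R : realType) (k p n N : nat) := BlockCode {
  messages : nat;
  messages_gt0 : (0 < messages)%N;
  encoder : 'I_messages -> 'I_N -> 'cV[R[i]]_k;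
  decoder : N.-tuple ('cV[R[i]]_p * 'M[R[i]]_(p, n)) -> 'I_messages;
  measurable_decoder : forall m, measurable (decoder @^-1` [set m]) }.
Arguments encoder {R k p n N} _.

(* The elements of the codewords, averaged over equiprobable messages, time and
   position. *)
Definition mean_square (R : realType) (k p n N : nat)
    (C : block_code R k p n N) : R :=
  (\sum_(m < messages C) \sum_(t < N) \sum_(j < k)
     (complex.Re (encoder C m t j 0) ^+ 2 + complex.Im (encoder C m t j 0) ^+ 2))
  / (messages C * N * k)%N%:R.

Definition code_rate (R : realType) (k p n N : nat)
    (C : block_code R k p n N) : R := log2 (messages C)%:R / N%:R.

Section achieved.
Context {d} {T : measurableType d} {R : realType} (P : probability T R).
Variables (cs : construction) (n p q : nat).
Variables (A : nat -> T -> 'M[R[i]]_(p, n)) (z : nat -> T -> 'cV[R[i]]_p)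
          (b : nat -> T -> {set 'I_n}).

Definition received (N : nat) (C : block_code R (signal_dim cs n q) p n N)
    (m : 'I_(messages C)) (w : T) : N.-tuple ('cV[R[i]]_p * 'M[R[i]]_(p, n)) :=
  [tuple (channel_output cs (A t w) (z t w) (b t w) (encoder C m t), A t w) | t < N].

Arguments received {N} C m.

(* Error probability for equiprobable messages. *)
Definition error_probability (N : nat)
    (C : block_code R (signal_dim cs n q) p n N) : \bar R :=
  (((messages C)%:R^-1)%:E *
   \sum_(m < messages C) P [set w | decoder C (received C m w) <> m])%E.

Definition achieved (rate : R) : Prop :=
  exists C : forall N, block_code R (signal_dim cs n q) p n N.+1,
    [/\ forall N, mean_square (C N) = 1,
        (fun N => error_probability (C N)) @ \oo --> (0 : \bar R)%E &
        (fun N => code_rate (C N)) @ \oo --> rate].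

End achieved.

(* Main.v *)
Require Import Defs.
From HB Require Import structures.
From mathcomp Require Import all_boot all_order all_algebra.
From mathcomp Require Import spectral complex.
From mathcomp Require Import all_classical all_reals all_analysis.
From mathcomp Require Import measurable_realfun.
From mathcomp Require Import ring lra.

(** Given [A] and the support, [y = G c + z] with [G = A S] is a Gaussian vector
    channel.  The joint law of [(c, y)] has an explicit density, the score, with
    respect to the product of its marginals, and the mean of [ln score] is
    [ln det (1 + G G^H / v)].  When the support is unknown, the mean of the scores
    over all supports integrates to 1 against the product of the marginals and is at
    least [score / C(n, q)], so that Gibbs' inequality loses at most [log C(n, q)].

    For achievability, a random Gaussian codebook is decoded by comparing the products
    of these mixture scores with a threshold.  A wrong codeword has a score of mean 1;
    since [E exp (- rho ln score) = 1 - rho J + o(rho)], Markov's inequality makes a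
    low score of the true codeword exponentially unlikely.  As the total energy of
    [N] symbols exceeds [(N + 1) / N] times its mean with probability at most
    [N / (N + 1)], some codebook has both a small error and enough power left for one
    filler symbol that makes the power exactly 1. *)

Set Implicit Arguments.
Unset Strict Implicit.
Unset Printing Implicit Defensive.

Import Order.TTheory GRing.Theory Num.Theory.
Import numFieldNormedType.Exports.

Local Open Scope classical_set_scope.
Local Open Scope ring_scope.
Local Open Scope complex_scope.

(** * Laws of images, products and i.i.d. tuples *)

(** The reference measure for outputs is the law of the noise, not Lebesgue measure on C^p. By the
    translation formula the output of [G c + z] then has the density [dens], with no normalising
    constant, and all integrals reduce to one-dimensional Gaussian ones taken coordinate by
    coordinate. The inverse T of [gram v G] comes from no formula: it is built together with the
    determinant, adding the columns of G one at a time. The mean of [ln score] is exactly [logdet]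
    because the output energy y^H T y / v and the noise energy |z|^2 / v have the same mean p.

    Averaging the scores over the supports, instead of forming the likelihood ratio of the mixed
    channel, keeps the mean over c equal to 1 at every fixed output. This one property serves both
    Gibbs' inequality and the wrong codewords, so that the output law for an unknown support is
    never made explicit. The average is a function of (c, y, A), hence available to the decoder.

    Conditional information is a value picked by [get], so it must be shown not to depend on the
    kernel: countably generated sigma-algebras make conditional laws unique off one null set. *)

Section image_law.
Context d d' (T : measurableType d) (U : measurableType d') (R : realType).
Variables (P : probability T R) (f : T -> U) (mf : measurable_fun setT f).

Let f_mfun : {mfun T >-> U} := HB.pack f (isMeasurableFun.Build _ _ _ _ f mf).

Definition image_law : probability U R := distribution P f_mfun.

Lemma image_lawE (B : set U) : image_law B = P (f @^-1` B).
Proof. by []. Qed.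

Lemma ge0_integral_image_law (F : U -> \bar R) :
  measurable_fun setT F -> (forall y, (0 <= F y)%E) ->
  (\int[image_law]_y F y = \int[P]_x F (f x))%E.
Proof. by move=> mF F0; rewrite ge0_integral_distribution. Qed.

End image_law.

Lemma ge0_integral_prod d1 d2 (T1 : measurableType d1) (T2 : measurableType d2)
    (R : realType) (P : probability T1 R) (Q : probability T2 R)
    (F : T1 * T2 -> \bar R) :
  measurable_fun setT F -> (forall x, (0 <= F x)%E) ->
  (\int[P \x Q]_z F z = \int[P]_x \int[Q]_y F (x, y))%E.
Proof. by move=> mF F0; rewrite fubini_tonelli1. Qed.

Lemma bigsetI_finE (T : Type) (I : finType) (E : I -> set T) :
  \big[setI/setT]_i E i = [set x | forall i, E i x].
Proof.
rewrite -bigcap_seq; apply/seteqP; split => [x Ex i|x Ex i _]; last exact: Ex.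
by apply: Ex; rewrite /= mem_index_enum.
Qed.

(** * Probabilities determined by rectangles *)

Section eq_probability.
Context d (T : measurableType d) (R : realType) (I : finType).
Variable C : I -> set (set T).
Hypothesis CT : forall i, C i setT.
Hypothesis CI : forall i, setI_closed (C i).
Hypothesis mC : forall i, C i `<=` measurable.
Hypothesis genC : @measurable _ T `<=` <<s \bigcup_i C i >>.

(** Rectangles form a pi-system because each [C i] is one, and they generate the sigma-algebra;
    agreement on a generating pi-system is agreement everywhere. *)
Lemma eq_probability_rectangle (P Q : probability T R) :
  (forall E : I -> set T, (forall i, C i (E i)) ->
     P [set x | forall i, E i x] = Q [set x | forall i, E i x]) ->
  forall A, measurable A -> P A = Q A.
Proof.
move=> PQ A mA.
pose G := [set \big[setI/setT]_i E i | E in [set E : I -> set T | forall i, C i (E i)]].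
have mG B : G B -> measurable B.
  move=> [E CE <-]; elim/big_ind : _ => //; first exact: measurableI.
  by move=> i _; exact/mC/CE.
apply: (measure_unique G (fun=> setT)) => //.
- apply/seteqP; split; last first.
    by apply: smallest_sub => //; exact: sigma_algebra_measurable.
  apply: (subset_trans genC); apply: smallest_sub.
    exact: smallest_sigma_algebra.
  move=> B [i _ CB]; apply: sub_sigma_algebra.
  (* An event of a single [C i] is the rectangle whose other sides are the whole space. *)
  exists (fun j => if j == i then B else setT).
    by move=> j; case: eqVneq => [->|].
  rewrite (bigD1 i)//= eqxx big1 ?setIT// => j /negbTE ->//.
- move=> _ _ [E CE <-] [F CF <-]; exists (fun i => E i `&` F i).
    by move=> i; apply: CI.
  by rewrite big_split.
- by move=> _; exists (fun=> setT) => //; rewrite big1.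
- by rewrite bigcup_const//; exists 0%N.
- by move=> B [E CE <-]; rewrite bigsetI_finE; exact: PQ.
- by move=> _; rewrite (le_lt_trans (probability_le1 _ _))// ltry.
Qed.

End eq_probability.

Lemma integral_probability_cst d (T : measurableType d) (R : realType)
    (P : probability T R) (r : R) : (\int[P]_x r%:E = r%:E)%E.
Proof. by rewrite integral_cst//= probability_setT mule1. Qed.

Section iid_law.
Context d (T : measurableType d) (R : realType) (P : probability T R).

Lemma measurable_cons_tuple n :
  measurable_fun setT (fun xu : T * n.-tuple T => [tuple of xu.1 :: xu.2]).
Proof. exact: measurable_cons. Qed.

(** The recursion on the head of the tuple lets Tonelli's theorem peel off one coordinate at a time,
    which is how every Gaussian integral below is computed. *)
Fixpoint iid_law n : probability (n.-tuple T) R :=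
  if n is m.+1 then image_law (P \x iid_law m)%E (@measurable_cons_tuple m)
  else \d_[tuple].

Lemma integral_iid_law0 (F : 0.-tuple T -> \bar R) :
  measurable_fun setT F -> (\int[iid_law 0]_u F u = F [tuple])%E.
Proof. by move=> mF; rewrite integral_dirac// diracT mul1e. Qed.

Lemma integral_iid_lawS n (F : n.+1.-tuple T -> \bar R) :
  measurable_fun setT F -> (forall u, (0 <= F u)%E) ->
  (\int[iid_law n.+1]_u F u = \int[P]_x \int[iid_law n]_u F [tuple of x :: u])%E.
Proof.
move=> mF F0; rewrite ge0_integral_image_law// ge0_integral_prod//.
exact: (measurableT_comp mF (@measurable_cons_tuple n)).
Qed.

End iid_law.

(** * Measurability for complex matrices *)

Section measurable_complex_fun.
Context d (T : measurableType d) (R : realType).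
Implicit Types f g : T -> R[i].

Lemma measurable_Re : measurable_fun setT (@complex.Re R).
Proof.
move=> _ B mB; rewrite setTI; apply: sub_sigma_algebra; left.
by exists B => //; rewrite setTI.
Qed.

Lemma measurable_Im : measurable_fun setT (@complex.Im R).
Proof.
move=> _ B mB; rewrite setTI; apply: sub_sigma_algebra; right.
by exists B => //; rewrite setTI.
Qed.

Lemma measurable_fun_Re f : measurable_fun setT f ->
  measurable_fun setT (fun x => complex.Re (f x)).
Proof. exact: measurableT_comp measurable_Re. Qed.

Lemma measurable_fun_Im f : measurable_fun setT f ->
  measurable_fun setT (fun x => complex.Im (f x)).
Proof. exact: measurableT_comp measurable_Im. Qed.

Lemma measurable_fun_complex f :
  measurable_fun setT (fun x => complex.Re (f x)) ->
  measurable_fun setT (fun x => complex.Im (f x)) -> measurable_fun setT f.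
Proof.
move=> mr mi; apply: (@measurability _ _ _ _ setT f
  (preimage_set_system setT (@complex.Re R) measurable `|`
      preimage_set_system setT (@complex.Im R) measurable)) => //.
move=> _ [B [] [C mC <-] <-]; rewrite !setTI.
  by have := mr measurableT C mC; rewrite setTI.
by have := mi measurableT C mC; rewrite setTI.
Qed.

Lemma measurable_complexD f g : measurable_fun setT f -> measurable_fun setT g ->
  measurable_fun setT (fun x => f x + g x).
Proof.
move=> mf mg; apply: measurable_fun_complex.
  under eq_fun do rewrite raddfD/=.
  by apply: measurable_funD; exact: measurable_fun_Re.
under eq_fun do rewrite raddfD/=.
by apply: measurable_funD; exact: measurable_fun_Im.
Qed.

Lemma complexReM (a b : R[i]) : complex.Re (a * b) =
  complex.Re a * complex.Re b - complex.Im a * complex.Im b.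
Proof. by case: a b => [? ?] [? ?]. Qed.

Lemma complexImM (a b : R[i]) : complex.Im (a * b) =
  complex.Re a * complex.Im b + complex.Im a * complex.Re b.
Proof. by case: a b => [? ?] [? ?]. Qed.

Lemma measurable_complexM f g : measurable_fun setT f -> measurable_fun setT g ->
  measurable_fun setT (fun x => f x * g x).
Proof.
move=> mf mg; apply: measurable_fun_complex.
  under eq_fun do rewrite complexReM.
  by apply: measurable_funB; apply: measurable_funM;
    do ?[exact: measurable_fun_Re|exact: measurable_fun_Im].
under eq_fun do rewrite complexImM.
by apply: measurable_funD; apply: measurable_funM;
  do ?[exact: measurable_fun_Re|exact: measurable_fun_Im].
Qed.

Lemma measurable_complex_sum I (r : seq I) (f : I -> T -> R[i]) :
  (forall i, measurable_fun setT (f i)) ->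
  measurable_fun setT (fun x => \sum_(i <- r) f i x).
Proof.
move=> mf; elim: r => [|i r ih].
  by under eq_fun do rewrite big_nil; exact: measurable_cst.
by under eq_fun do rewrite big_cons; exact: measurable_complexD.
Qed.

End measurable_complex_fun.

Section measurable_matrix_fun.
Context d d' (T : measurableType d) (U : measurableType d') (m n : nat).

Lemma measurable_entry (i : 'I_m) (j : 'I_n) :
  measurable_fun setT (fun M : 'M[U]_(m, n) => M i j).
Proof.
move=> _ B mB; rewrite setTI; apply: sub_sigma_algebra; exists (i, j) => //.
by exists B => //; rewrite setTI.
Qed.

Lemma measurable_fun_matrix (f : T -> 'M[U]_(m, n)) :
  (forall i j, measurable_fun setT (fun x => f x i j)) -> measurable_fun setT f.
Proof.
move=> mf; apply: (@measurability _ _ _ _ setT f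
  (\bigcup_(ij in [set: 'I_m * 'I_n])
        preimage_set_system setT (fun M : 'M[U]_(m, n) => M ij.1 ij.2)
          measurable)) => //.
move=> _ [B [[i j] _ [C mC <-]] <-]; rewrite !setTI.
by have := mf i j measurableT C mC; rewrite setTI.
Qed.

Lemma measurable_fun_entry (f : T -> 'M[U]_(m, n)) i j :
  measurable_fun setT f -> measurable_fun setT (fun x => f x i j).
Proof. exact: measurableT_comp (measurable_entry i j). Qed.

End measurable_matrix_fun.

Section measurable_matrix_ring.
Context d (T : measurableType d) (R : realType).

Lemma measurable_mulmx m n p (f : T -> 'M[R[i]]_(m, n)) (g : T -> 'M[R[i]]_(n, p)) :
  measurable_fun setT f -> measurable_fun setT g ->
  measurable_fun setT (fun x => f x *m g x).
Proof.
move=> mf mg; apply: measurable_fun_matrix => i j.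
under eq_fun do rewrite mxE.
apply: measurable_complex_sum => k.
by apply: measurable_complexM; exact: measurable_fun_entry.
Qed.

Lemma measurable_addmx m n (f g : T -> 'M[R[i]]_(m, n)) :
  measurable_fun setT f -> measurable_fun setT g ->
  measurable_fun setT (fun x => f x + g x).
Proof.
move=> mf mg; apply: measurable_fun_matrix => i j.
under eq_fun do rewrite mxE.
by apply: measurable_complexD; exact: measurable_fun_entry.
Qed.

Lemma measurable_oppmx m n (f : T -> 'M[R[i]]_(m, n)) :
  measurable_fun setT f -> measurable_fun setT (fun x => - f x).
Proof.
move=> mf; apply: measurable_fun_matrix => i j.
under eq_fun do rewrite mxE -mulN1r.
by apply: measurable_complexM; [exact: measurable_cst|exact: measurable_fun_entry].
Qed.

End measurable_matrix_ring.

Section measurable_discrete.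
Context d d' (U : measurableType d) (V : measurableType d') (I : finType).

Lemma measurable_fun_finset (F : U * {set I} -> V) :
  (forall s, measurable_fun setT (fun x => F (x, s))) -> measurable_fun setT F.
Proof.
move=> mF _ B mB; rewrite setTI.
rewrite [X in measurable X](_ : _ =
  \bigcup_(s in [set: {set I}]) ((fun x => F (x, s)) @^-1` B `*` [set s])); last first.
  apply/seteqP; split => [[x s] Fx|[x s] [t _ [/= Fx ->]]] //.
  by exists s.
apply: fin_bigcup_measurable => // s _; apply: measurableX => //.
by rewrite -[X in measurable X]setTI; exact: mF.
Qed.

End measurable_discrete.

Section complex_normal.
Context (R : realType).
Implicit Types v : R.

Lemma measurable_complex_pair :
  measurable_fun setT (fun xy : R * R => xy.1 +i* xy.2).
Proof. exact: measurable_fun_complex. Qed.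

(** [complex_normal] is a bare set function; this is the same pushforward carrying its structure of
    probability, so that it can be integrated against. *)
Definition cnormal v : probability R[i] R :=
  image_law (normal_prob 0 (Num.sqrt (v / 2)) \x normal_prob 0 (Num.sqrt (v / 2)))%E
    measurable_complex_pair.

Lemma ge0_integral_cnormal v (F : R[i] -> \bar R) :
  measurable_fun setT F -> (forall x, (0 <= F x)%E) ->
  (\int[cnormal v]_x F x = \int[normal_prob 0 (Num.sqrt (v / 2))]_x
     \int[normal_prob 0 (Num.sqrt (v / 2))]_y F (x +i* y))%E.
Proof.
move=> mF F0; rewrite ge0_integral_image_law// ge0_integral_prod//.
exact: (measurableT_comp mF measurable_complex_pair).
Qed.

End complex_normal.

Section iid_rectangle.
Local Open Scope ereal_scope.
Context d (T : measurableType d) (R : realType) (P : probability T R).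

Lemma iid_law_rectangle n (E : 'I_n -> set T) : (forall i, measurable (E i)) ->
  iid_law P n [set u : n.-tuple T | forall i, E i (tnth u i)] = \prod_i P (E i).
Proof.
elim: n E => [|n ih] E mE.
  rewrite big_ord0 (_ : [set _ | _] = setT) ?probability_setT//.
  by apply/seteqP; split => // u _ [].
have mS : measurable [set u : n.-tuple T | forall i, E (lift ord0 i) (tnth u i)].
  rewrite -bigsetI_finE; apply: bigsetI_measurable => i _.
  by rewrite -[X in measurable X]setTI; exact: measurable_tnth.
rewrite big_ord_recl -ih// -product_measure1E//.
rewrite [LHS](_ : _ = image_law (P \x iid_law P n) (@measurable_cons_tuple _ T n)
  [set u | forall i, E i (tnth u i)])//.
rewrite image_lawE; congr (_ _); apply/seteqP; split => [[x u] /= Eu|[x u] [/= Ex Eu] i].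
  split => [|i]; first by have := Eu ord0; rewrite tnth0.
  by have := Eu (lift ord0 i); rewrite tnthS.
by have [j ->|->] := unliftP ord0 i; rewrite ?tnth0 ?tnthS.
Qed.

End iid_rectangle.

Section gaussian_matrix.
Local Open Scope ereal_scope.
Context (R : realType).

Lemma measurable_matrix_of_tuple (m n N : nat) (g : 'I_m * 'I_n -> 'I_N) :
  measurable_fun setT (fun u : N.-tuple R[i] => \matrix_(i, j) tnth u (g (i, j))).
Proof.
apply: measurable_fun_matrix => i j; under eq_fun do rewrite mxE.
exact: measurable_tnth.
Qed.

(** The common test that identifies a Gaussian matrix law, whether the matrix is a random variable
    with i.i.d. entries or is assembled from a tuple. *)
Definition gaussian_rectangles v m n (Q : set 'M[R[i]]_(m, n) -> \bar R) :=
  forall E : 'I_m * 'I_n -> set R[i], (forall ij, measurable (E ij)) ->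
  Q [set M | forall ij, E ij (M ij.1 ij.2)] = \prod_ij complex_normal v (E ij).

(** The enumeration of the entries is left free: [enum_rank] defines [gaussian_matrix], while the
    natural order of a column is the one suited to integration coordinate by coordinate. *)
Lemma gaussian_rectangles_tuple v m n N (g : 'I_m * 'I_n -> 'I_N) : bijective g ->
  gaussian_rectangles v
    (image_law (iid_law (cnormal v) N) (@measurable_matrix_of_tuple m n N g)).
Proof.
move=> [h gK hK] E mE; rewrite image_lawE.
rewrite (reindex h) /=; last by exists g => ij _; rewrite ?gK ?hK.
rewrite -(@iid_law_rectangle _ _ _ (cnormal v) N (fun k => E (h k)))//.
congr (_ _); apply/seteqP; split => u /= Eu.
  by move=> k; have := Eu (h k); rewrite mxE -surjective_pairing hK.
by move=> [i j]; have := Eu (g (i, j)); rewrite gK mxE.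
Qed.

Lemma eq_gaussian_rectangles v m n (P Q : probability 'M[R[i]]_(m, n) R) :
  gaussian_rectangles v P -> gaussian_rectangles v Q ->
  forall B, measurable B -> P B = Q B.
Proof.
move=> gP gQ; apply: (@eq_probability_rectangle _ _ R ('I_m * 'I_n)%type
  (fun ij => preimage_set_system setT (fun M : 'M[R[i]]_(m, n) => M ij.1 ij.2)
          measurable)) => //.
- by move=> ij; exists setT => //; rewrite setTI preimage_setT.
- move=> ij _ _ [A mA <-] [B mB <-]; exists (A `&` B); first exact: measurableI.
  by rewrite !setTI preimage_setI.
- by move=> ij _ [A mA <-]; exact: measurable_entry.
- move=> E CE.
  have /choice[F FE] : forall ij, exists B : set R[i],
      measurable B /\ E ij = (fun M : 'M[R[i]]_(m, n) => M ij.1 ij.2) @^-1` B.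
    by move=> ij; have [B mB <-] := CE ij; exists B; rewrite setTI.
  have mF ij : measurable (F ij) by case: (FE ij).
  have -> : [set M | forall ij, E ij M] = [set M | forall ij, F ij (M ij.1 ij.2)].
    by apply/seteqP; split => M /= + ij => /(_ ij); case: (FE ij) => _ ->.
  by rewrite gP// gQ.
Qed.

Definition gaussian_matrix v m n : probability 'M[R[i]]_(m, n) R :=
  image_law (iid_law (cnormal v) #|{: 'I_m * 'I_n}|)
    (@measurable_matrix_of_tuple m n _ enum_rank).

Lemma gaussian_matrix_rectangles v m n : gaussian_rectangles v (gaussian_matrix v m n).
Proof. by apply: gaussian_rectangles_tuple; exact: enum_rank_bij. Qed.

Lemma gaussian_rectangles_iid v m n d (T : measurableType d) (P : probability T R)
    (X : T -> 'M[R[i]]_(m, n)) (mX : measurable_fun setT X) :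
  iid_complex_normal P v X -> gaussian_rectangles v (image_law P mX).
Proof.
move=> [iX lX] E mE; rewrite image_lawE.
have := iX (index_enum _) (fun ij => (fun w => X w ij.1 ij.2) @^-1` E ij).
rewrite bigsetI_finE => /(_ (index_enum_uniq _)) ->.
  by apply: eq_bigr => -[i j] _; rewrite -(lX i j).
by move=> ij _; exists (E ij) => //; rewrite setTI.
Qed.

Lemma iid_complex_normal_law v m n d (T : measurableType d) (P : probability T R)
    (X : T -> 'M[R[i]]_(m, n)) (mX : measurable_fun setT X) :
  iid_complex_normal P v X ->
  forall B, measurable B -> P (X @^-1` B) = gaussian_matrix v m n B.
Proof.
move=> iX B mB; rewrite -(image_lawE P mX).
by apply: (@eq_gaussian_rectangles v) => //;
  [exact: gaussian_rectangles_iid|exact: gaussian_matrix_rectangles].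
Qed.

Lemma eq_ge0_integral d (T : measurableType d) (mu nu : {measure set T -> \bar R})
    (F : T -> \bar R) :
  (forall B, measurable B -> mu B = nu B) ->
  \int[mu]_x F x = \int[nu]_x F x.
Proof. by move=> mn; apply: eq_measure_integral => B mB _; exact: mn. Qed.

Lemma ge0_integral_iid_complex_normal v m n d (T : measurableType d)
    (P : probability T R) (X : T -> 'M[R[i]]_(m, n)) (mX : measurable_fun setT X)
    (F : 'M[R[i]]_(m, n) -> \bar R) :
  iid_complex_normal P v X -> measurable_fun setT F -> (forall M, 0 <= F M) ->
  \int[P]_w F (X w) = \int[gaussian_matrix v m n]_M F M.
Proof.
move=> iX mF F0; rewrite -(ge0_integral_image_law P mX)//.
by apply: eq_ge0_integral => B mB; exact: (iid_complex_normal_law mX).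
Qed.

Lemma measurable_col_of_tuple k :
  measurable_fun setT (fun u : k.-tuple R[i] => \col_i tnth u i).
Proof.
apply: measurable_fun_matrix => i j; under eq_fun do rewrite mxE.
exact: measurable_tnth.
Qed.

Lemma ge0_integral_gaussian_col v k (F : 'cV[R[i]]_k -> \bar R) :
  measurable_fun setT F -> (forall M, 0 <= F M) ->
  \int[gaussian_matrix v k 1]_c F c =
  \int[iid_law (cnormal v) k]_u F (\col_i tnth u i).
Proof.
move=> mF F0; rewrite -(ge0_integral_image_law _ (@measurable_col_of_tuple k))//.
apply: eq_ge0_integral => B mB; apply: (@eq_gaussian_rectangles v) => //.
  exact: gaussian_matrix_rectangles.
have bg : bijective (fst : 'I_k * 'I_1 -> 'I_k).
  by exists (fun i => (i, ord0)) => // -[i j] /=; rewrite (ord1 j).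
move=> E mE; rewrite -(gaussian_rectangles_tuple v bg)//.
Qed.

(** Selecting the columns of the sensing matrix that a support hits must give a matrix with the law
    of [H]. Injectivity of [f] and [g] keeps the selected entries distinct, hence independent. *)
Lemma iid_complex_normal_mxsub v m n m' n' d (T : measurableType d)
    (P : probability T R) (X : T -> 'M[R[i]]_(m, n)) (f : 'I_m' -> 'I_m)
    (g : 'I_n' -> 'I_n) : injective f -> injective g ->
  iid_complex_normal P v X -> iid_complex_normal P v (fun w => mxsub f g (X w)).
Proof.
move=> fI gI [iX lX]; split; last first.
  by move=> i j B mB; rewrite -(lX (f i) (g j))//; under eq_set do rewrite mxE.
pose h (ij : 'I_m' * 'I_n') := (f ij.1, g ij.2).
have hI : injective h by move=> [i j] [i' j'] [] /fI -> /gI ->.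
move=> s E us mE.
(* Transports the events to entries of the large matrix; on the list [map h s] the injectivity of
   [h] recovers the original event. *)
pose E' kl := if [pick ij | h ij == kl] is Some ij then E ij else setT.
have E'h ij : E' (h ij) = E ij.
  rewrite /E'; case: pickP => [ij' /eqP /hI -> //|/(_ ij)].
  by rewrite eqxx.
have -> : \big[setI/setT]_(ij <- s) E ij = \big[setI/setT]_(kl <- map h s) E' kl.
  by rewrite big_map; apply: eq_bigr => ij _; rewrite E'h.
rewrite iX ?map_inj_uniq//.
  by rewrite big_map; apply: eq_bigr => ij _; rewrite E'h.
move=> _ /mapP[ij sij ->]; rewrite E'h.
have [B mB <-] := mE _ sij; exists B => //.
by congr (_ `&` _); apply/seteqP; split => w /=; rewrite mxE.
Qed.

End gaussian_matrix.

(** * Gaussian integrals *)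

Section density.
Local Open Scope ereal_scope.
Context d (T : measurableType d) (R : realType).
Variables (mu nu : {measure set T -> \bar R}) (h : T -> R).
Hypothesis mh : measurable_fun setT h.
Hypothesis h0 : forall x, (0 <= h x)%R.
Hypothesis nuE : forall A, measurable A -> nu A = \int[mu]_(x in A) (h x)%:E.

Import HBNNSimple.

Let integral_nnsfun (f : {nnsfun T >-> R}) :
  \int[nu]_x (f x)%:E = \int[mu]_x (f x * h x)%:E.
Proof.
transitivity (\sum_(y \in range f) \int[mu]_x (y * \1_(f @^-1` [set y]) x * h x)%:E).
  transitivity (\int[nu]_x (\sum_(y \in range f) (y * \1_(f @^-1` [set y]) x)%:E)).
    by apply: eq_integral => t tE; rewrite /= fimfunE -fsumEFin.
  rewrite ge0_integral_fsum//; last 2 first.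
  - by move=> r; exact/measurable_EFinP/measurable_funM.
  - by move=> m y _; exact: nnfun_muleindic_ge0.
  apply: eq_fsbigr => r /[!inE] -[x _ <-].
  rewrite integralZl_indic_nnsfun// integral_indic// setIT nuE//.
  rewrite integral_mkcond -ge0_integralZl//; last 3 first.
  - apply/(measurable_restrictT _ _).1 => //.
    exact/measurable_funTS/measurable_EFinP.
  - by move=> y _; rewrite erestrict_ge0// => z _; rewrite lee_fin.
  - by rewrite lee_fin.
  apply: eq_integral => y _; rewrite patchE indicE; case: ifPn => yA.
    by rewrite mulr1 EFinM.
  by rewrite mulr0 mul0r mule0.
rewrite -ge0_integral_fsum//; last 2 first.
- by move=> r; apply/measurable_EFinP/measurable_funM => //; exact: measurable_funM.
- by move=> m y _; rewrite EFinM mule_ge0 ?lee_fin//; exact: nnfun_muleindic_ge0.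
apply: eq_integral => t _; rewrite fsumEFin//.
by rewrite -mulr_fsuml// -fimfunE.
Qed.

(** Simple functions, then monotone convergence. The base measure is arbitrary, since this serves
    for Lebesgue measure and the normal density as well as for products of marginals and the
    score. *)
Lemma ge0_integral_density (F : T -> \bar R) :
  measurable_fun setT F -> (forall x, 0 <= F x) ->
  \int[nu]_x F x = \int[mu]_x (F x * (h x)%:E).
Proof.
move=> mF F0; pose f_ := nnsfun_approx measurableT mF.
have Flim x : F x = lim ((EFin \o f_ n) x @[n --> \oo]).
  by apply/esym/cvg_lim => //; exact: cvg_nnsfun_approx.
transitivity (lim (\int[nu]_x (f_ n x)%:E @[n --> \oo])).
  under eq_integral do rewrite Flim.
  apply: monotone_convergence => //.
  - by move=> n; exact/measurable_EFinP.
  - by move=> n x _ //=; rewrite lee_fin.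
  - by move=> x _ a b ab; rewrite lee_fin; exact/lefP/nd_nnsfun_approx.
under eq_fun do rewrite integral_nnsfun.
rewrite -monotone_convergence//.
- apply: eq_integral => x _; apply/cvg_lim => //.
  under eq_fun do rewrite EFinM.
  by apply: cvgeZr => //; exact: cvg_nnsfun_approx.
- by move=> n; apply/measurable_EFinP/measurable_funM.
- by move=> n x _; rewrite lee_fin mulr_ge0.
- by move=> x _ a b ab; rewrite lee_fin ler_wpM2r//; exact/lefP/nd_nnsfun_approx.
Qed.

End density.

Section normal_integrals.
Local Open Scope ereal_scope.
Context (R : realType).
Local Notation leb := (@lebesgue_measure R).
Implicit Types F : R -> \bar R.

Lemma ge0_integral_normal_prob (m s : R) F :
  measurable_fun setT F -> (forall x, 0 <= F x) ->
  \int[normal_prob m s]_x F x = \int[leb]_x (F x * (normal_pdf m s x)%:E).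
Proof.
move=> mF F0; apply: ge0_integral_density => //.
  exact: measurable_normal_pdf.
exact: normal_pdf_ge0.
Qed.

Lemma ge0_integral_lebesgue_shift (a : R) F :
  measurable_fun setT F -> (forall x, 0 <= F x) ->
  \int[leb]_x F (x + a)%R = \int[leb]_x F x.
Proof.
move=> mF F0.
have mshift : measurable_fun setT (fun x : R => (x + a)%R : measurableTypeR R).
  exact: measurable_funD.
transitivity (\int[pushforward leb (fun x : R => (x + a)%R : measurableTypeR R)]_x F x).
  by rewrite ge0_integral_pushforward.
apply: eq_measure_integral => A mA _.
apply/esym/lebesgue_measure_unique => //= _ [[x y]] _ <-.
have yx : (y - a - (x - a) = y - x)%R by ring.
rewrite /pushforward.
have -> : (fun z : R => (z + a)%R) @^-1` `]x, y] = `](x - a)%R, (y - a)%R]%classic.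
  by apply/seteqP; split => z /=; rewrite !in_itv/= ltrBlDr lerBrDr.
by rewrite !lebesgue_measure_itv/= !lte_fin ltrD2r -!EFinB yx.
Qed.

Lemma ge0_integral_lebesgueN F :
  measurable_fun setT F -> (forall x, 0 <= F x) ->
  \int[leb]_x F (- x)%R = \int[leb]_x F x.
Proof.
move=> mF F0.
transitivity (\int[pushforward leb (-%R : _ -> measurableTypeR R)]_x F x).
  by rewrite ge0_integral_pushforward.
by apply: eq_measure_integral => A mA _; exact: lebesgue_measureN.
Qed.

Section variance.
Variables (v : R) (v0 : (0 < v)%R).
Local Notation s := (Num.sqrt (v / 2)).

Let v20 : (0 < v / 2)%R. Proof. by rewrite divr_gt0. Qed.
Let s0 : s != 0%R. Proof. by rewrite gt_eqF// sqrtr_gt0. Qed.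
Let ss : (s ^+ 2 *+ 2 = v)%R.
Proof. by rewrite sqr_sqrtr ?ltW// -mulr_natr mulfVK. Qed.

Lemma normal_pdf_sqrtE (m x : R) :
  normal_pdf m s x = ((Num.sqrt (v * pi))^-1 * expR (- (x - m) ^+ 2 / v))%R.
Proof.
rewrite normal_pdfE// /normal_peak /normal_fun ss; congr ((Num.sqrt _)^-1 * _)%R.
by rewrite -mulrnAl ss.
Qed.

(** After a translation in the Lebesgue integral, the weight is the quotient of two normal
    densities. Here [v] is the variance of the complex variable, each coordinate having [v / 2], so
    [v] stands where twice the variance would. *)
Lemma ge0_integral_normal_shift (a : R) F :
  measurable_fun setT F -> (forall x, 0 <= F x) ->
  \int[normal_prob 0 s]_x F (x + a)%R =
  \int[normal_prob 0 s]_x (F x * (expR ((2 * (x * a) - a ^+ 2) / v))%:E).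
Proof.
move=> mF F0.
have ma : measurable_fun setT (fun x : R => (x + a)%R) by exact: measurable_funD.
have me : measurable_fun setT (fun x : R => expR ((2 * (x * a) - a ^+ 2) / v)).
  apply: measurableT_comp => //; apply: measurable_funM => //.
  by apply: measurable_funB => //; apply: measurable_funM => //; apply: measurable_funM.
rewrite [LHS]ge0_integral_normal_prob//; last exact: (measurableT_comp mF ma).
rewrite [RHS]ge0_integral_normal_prob//; last 2 first.
- by apply: emeasurable_funM => //; exact/measurable_EFinP.
- by move=> x; rewrite mule_ge0// lee_fin expR_ge0.
rewrite -[RHS](ge0_integral_lebesgue_shift a); last 2 first.
- apply: emeasurable_funM; last by apply/measurable_EFinP; exact: measurable_normal_pdf.
  by apply: emeasurable_funM => //; exact/measurable_EFinP.
- by move=> x; rewrite !mule_ge0// lee_fin ?expR_ge0// normal_pdf_ge0.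
apply: eq_integral => x _; rewrite -muleA -EFinM; congr (_ * EFin _).
rewrite !normal_pdf_sqrtE mulrCA -expRD; congr (_ * expR _)%R.
by rewrite -mulrDl; congr (_ / _)%R; ring.
Qed.

Lemma ge0_integral_normalN F :
  measurable_fun setT F -> (forall x, 0 <= F x) ->
  \int[normal_prob 0 s]_x F (- x)%R = \int[normal_prob 0 s]_x F x.
Proof.
move=> mF F0; rewrite !ge0_integral_normal_prob//; last first.
  exact: (measurableT_comp mF).
rewrite -[RHS]ge0_integral_lebesgueN; last 2 first.
- by apply: emeasurable_funM => //; apply/measurable_EFinP; exact: measurable_normal_pdf.
- by move=> x; rewrite mule_ge0// lee_fin normal_pdf_ge0.
by apply: eq_integral => x _; rewrite !normal_pdf_sqrtE !subr0 sqrrN.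
Qed.

End variance.

(** Completing the square: the integrand times the density is a constant times the normal density of
    mean [v b / (1 + m v)] and variance [v / (1 + m v) / 2], which has mass 1. *)
Lemma integral_normal_expR_quadratic (v m b : R) : (0 < v)%R -> (0 <= m)%R ->
  \int[normal_prob 0 (Num.sqrt (v / 2))]_x (expR (2 * (x * b) - m * x ^+ 2))%:E =
  ((Num.sqrt (1 + m * v))^-1 * expR (v * b ^+ 2 / (1 + m * v)))%:E.
Proof.
move=> v0 m0.
have k0 : (0 < 1 + m * v)%R by rewrite ltr_pwDl// mulr_ge0// ltW.
have w0 : (0 < v / (1 + m * v))%R by rewrite divr_gt0.
rewrite ge0_integral_normal_prob//; last first.
  apply/measurable_EFinP/measurableT_comp => //; apply: measurable_funB => //.
    by apply: measurable_funM => //; apply: measurable_funM.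
  by apply: measurable_funM => //; apply: measurable_funX.
transitivity (\int[leb]_x (((Num.sqrt (1 + m * v))^-1 * expR (v * b ^+ 2 / (1 + m * v)))%:E
  * (normal_pdf (v * b / (1 + m * v)) (Num.sqrt (v / (1 + m * v) / 2)) x)%:E)).
  apply: eq_integral => x _; rewrite -!EFinM; congr EFin.
  rewrite !normal_pdf_sqrtE// mulrCA -expRD mulrACA -expRD; congr (_ * expR _)%R.
    rewrite -invfM -sqrtrM ?ltW//; congr (Num.sqrt _)^-1%R.
    by rewrite mulrA mulrCA mulfV ?gt_eqF// mulr1.
  by field; rewrite !gt_eqF.
rewrite ge0_integralZl//.
- by rewrite integral_normal_pdf mule1.
- by apply/measurable_EFinP; exact: measurable_normal_pdf.
- by move=> x _; rewrite lee_fin normal_pdf_ge0.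
Qed.

End normal_integrals.

Section complex_dot.
Context (R : realType).
Implicit Types x y : R[i].

(** The inner product of the complex plane seen as a real one, Re (x conj y); it is real-valued so
    that Gaussian weights stay in [R]. *)
Definition cdot x y : R := complex.Re x * complex.Re y + complex.Im x * complex.Im y.

Definition nsq x : R := complex.Re x ^+ 2 + complex.Im x ^+ 2.

Lemma nsq_ge0 x : 0 <= nsq x.
Proof. by rewrite addr_ge0// sqr_ge0. Qed.

Lemma nsqE x : nsq x = complex.Re (x^* * x)%C.
Proof. by case: x => [a b]; rewrite /nsq /=; ring. Qed.

Lemma nsqN x : nsq (- x) = nsq x.
Proof. by rewrite /nsq !raddfN !sqrrN. Qed.

Lemma cdotNl x y : cdot (- x) y = - cdot x y.
Proof. by rewrite /cdot !raddfN/=; ring. Qed.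

Lemma nsqD x y : nsq (x + y) = nsq x + 2 * cdot x y + nsq y.
Proof. by rewrite /nsq /cdot !raddfD/=; ring. Qed.

Lemma measurable_nsq : measurable_fun setT nsq.
Proof.
apply: measurable_funD; apply: measurable_funX; [exact: measurable_Re|exact: measurable_Im].
Qed.

Lemma measurable_cdot y : measurable_fun setT (cdot ^~ y).
Proof.
by apply: measurable_funD; apply: measurable_funM => //;
  [exact: measurable_Re|exact: measurable_Im].
Qed.

End complex_dot.

Section complex_normal_integrals.
Local Open Scope ereal_scope.
Context (R : realType).
Variables (v : R) (v0 : (0 < v)%R).
Local Notation N := (normal_prob 0 (Num.sqrt (v / 2))).
Implicit Types F : R[i] -> \bar R.

Let mpair (x : R) : measurable_fun setT (fun y : R => x +i* y).
Proof. by apply: measurable_fun_complex => /=. Qed.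

Lemma ge0_integral_cnormal_shift (a : R[i]) F :
  measurable_fun setT F -> (forall x, 0 <= F x) ->
  \int[cnormal v]_x F (x + a)%R =
  \int[cnormal v]_x (F x * (expR ((2 * cdot x a - nsq a) / v))%:E).
Proof.
move=> mF F0.
have mFa : measurable_fun setT (fun x : R[i] => F (x + a)%R).
  by apply: (measurableT_comp mF); apply: measurable_complexD.
have mg : measurable_fun setT (fun x : R[i] => (expR ((2 * cdot x a - nsq a) / v))%:E).
  apply/measurable_EFinP/measurableT_comp => //; apply: measurable_funM => //.
  by apply: measurable_funB => //; apply: measurable_funM => //; exact: measurable_cdot.
have mFg : measurable_fun setT
    (fun x : R[i] => F x * (expR ((2 * cdot x a - nsq a) / v))%:E).
  exact: emeasurable_funM.
have Fg0 x : 0 <= F x * (expR ((2 * cdot x a - nsq a) / v))%:E.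
  by rewrite mule_ge0// lee_fin expR_ge0.
rewrite (ge0_integral_cnormal _ mFa)// (ge0_integral_cnormal _ mFg Fg0).
pose G x := \int[N]_y (F (x +i* y) * (expR ((2 * (y * complex.Im a) - complex.Im a ^+ 2) / v))%:E).
have mpi : measurable_fun setT (fun y : R => (expR ((2 * (y * complex.Im a) - complex.Im a ^+ 2) / v))%:E).
  apply/measurable_EFinP/measurableT_comp => //; apply: measurable_funM => //.
  by apply: measurable_funB => //; apply: measurable_funM => //; apply: measurable_funM.
transitivity (\int[N]_x G (x + complex.Re a)%R).
  apply: eq_integral => x _; rewrite /G.
  rewrite -(ge0_integral_normal_shift v0 (complex.Im a)
    (F := fun y => F ((x + complex.Re a)%R +i* y)))//; last first.
    exact: (measurableT_comp mF (mpair _)).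
  by apply: eq_integral => y _; congr F; case: (a).
have G0 x : 0 <= G x.
  by apply: integral_ge0 => y _; rewrite mule_ge0// lee_fin expR_ge0.
have mFG : measurable_fun setT (fun xy : R * R => F (xy.1 +i* xy.2) *
    (expR ((2 * (xy.2 * complex.Im a) - complex.Im a ^+ 2) / v))%:E).
  apply: emeasurable_funM; first exact: (measurableT_comp mF (@measurable_complex_pair R)).
  exact: (measurableT_comp mpi measurable_snd).
have mG : measurable_fun setT G.
  apply: (@measurable_fun_fubini_tonelli_F _ _ _ _ _ N _ mFG).
  by move=> xy; rewrite mule_ge0// lee_fin expR_ge0.
rewrite (ge0_integral_normal_shift v0 _ mG G0).
apply: eq_integral => x _; rewrite /G -ge0_integralZr//.
- apply: eq_integral => y _; rewrite -muleA -EFinM -expRD; congr (_ * EFin (expR _)).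
  by rewrite /cdot /nsq/=; field; rewrite gt_eqF.
- apply: emeasurable_funM; last exact: mpi.
  exact: (measurableT_comp mF (mpair _)).
- by move=> y _; rewrite mule_ge0// lee_fin expR_ge0.
Qed.

Lemma ge0_integral_cnormalN F :
  measurable_fun setT F -> (forall x, 0 <= F x) ->
  \int[cnormal v]_x F (- x)%R = \int[cnormal v]_x F x.
Proof.
move=> mF F0.
have mFN : measurable_fun setT (fun x : R[i] => F (- x)%R).
  apply: (measurableT_comp mF) => //; apply: measurable_fun_complex.
    by under eq_fun do rewrite raddfN; apply: measurableT_comp => //; exact: measurable_Re.
  by under eq_fun do rewrite raddfN; apply: measurableT_comp => //; exact: measurable_Im.
rewrite (ge0_integral_cnormal _ mFN)// (ge0_integral_cnormal _ mF F0).
pose G x := \int[N]_y F (x +i* y).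
transitivity (\int[N]_x G (- x)%R).
  apply: eq_integral => x _; rewrite /G.
  by rewrite -[RHS](ge0_integral_normalN v0)//; exact: (measurableT_comp mF (mpair _)).
have mG : measurable_fun setT G.
  apply: (@measurable_fun_fubini_tonelli_F _ _ _ _ _ N (fun xy => F (xy.1 +i* xy.2))) => //.
  exact: (measurableT_comp mF (@measurable_complex_pair R)).
by rewrite (ge0_integral_normalN v0 mG)// => x; exact: integral_ge0.
Qed.

(** The integral splits into those over the real and imaginary parts, and their two square roots
    multiply to [1 + m v]. *)
Lemma integral_cnormal_expR_quadratic (m : R) (u : R[i]) : (0 <= m)%R ->
  \int[cnormal v]_x (expR (2 * cdot x u - m * nsq x))%:E =
  ((1 + m * v)^-1 * expR (v * nsq u / (1 + m * v)))%:E.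
Proof.
move=> m0.
have k0 : (0 < 1 + m * v)%R by rewrite ltr_pwDl// mulr_ge0// ltW.
rewrite ge0_integral_cnormal//; last first.
  apply/measurable_EFinP/measurableT_comp => //; apply: measurable_funB => //.
    by apply: measurable_funM => //; exact: measurable_cdot.
  by apply: measurable_funM => //; exact: measurable_nsq.
have mq (b : R) : measurable_fun setT (fun x : R => (expR (2 * (x * b) - m * x ^+ 2))%:E).
  apply/measurable_EFinP/measurableT_comp => //; apply: measurable_funB => //.
    by apply: measurable_funM => //; apply: measurable_funM.
  by apply: measurable_funM => //; apply: measurable_funX.
transitivity (\int[N]_x ((expR (2 * (x * complex.Re u) - m * x ^+ 2))%:E *
   ((Num.sqrt (1 + m * v))^-1 * expR (v * complex.Im u ^+ 2 / (1 + m * v)))%:E)).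
  apply: eq_integral => x _; rewrite -integral_normal_expR_quadratic//.
  rewrite -ge0_integralZl//; last exact: mq.
  apply: eq_integral => y _; rewrite -EFinM -expRD; congr (EFin (expR _)).
  by rewrite /cdot /nsq/=; ring.
rewrite (@ge0_integralZr _ _ _ N setT measurableT _ (mq _))//.
rewrite integral_normal_expR_quadratic// -EFinM mulrACA -expRD -invfM -expr2.
rewrite sqr_sqrtr ?ltW//; congr (EFin (_ * expR _)%R).
by rewrite /nsq; field; rewrite gt_eqF.
Qed.

Let mnsq : measurable_fun setT (fun x : R[i] => (nsq x)%:E).
Proof. by apply/measurable_EFinP; exact: measurable_nsq. Qed.

(* 1 / (1 + m v) is the mean of exp (- m |x|^2), and
   |x|^2 / (1 + m |x|^2) <= (1 - exp (- m |x|^2)) / m <= |x|^2. *)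
Lemma integral_cnormal_nsq : \int[cnormal v]_x (nsq x)%:E = v%:E.
Proof.
have Eexp (m : R) : (0 < m)%R ->
    \int[cnormal v]_x ((1 - expR (- (m * nsq x))) / m)%:E = (v / (1 + m * v))%:E.
  move=> m0; have k0 : (0 < 1 + m * v)%R by rewrite ltr_pwDl// mulr_ge0// ltW.
  have e1 x : (expR (- (m * nsq x)) <= 1)%R.
    by rewrite -expR0 ler_expR oppr_le0 mulr_ge0 ?nsq_ge0// ltW.
  have me : measurable_fun setT (fun x : R[i] => expR (- (m * nsq x))).
    apply: measurableT_comp => //; apply: measurableT_comp => //.
    by apply: measurable_funM => //; exact: measurable_nsq.
  under eq_integral do rewrite EFinM.
  rewrite ge0_integralZr//; last 3 first.
  - by apply/measurable_EFinP; apply: measurable_funB.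
  - by move=> x _; rewrite lee_fin subr_ge0.
  - by rewrite lee_fin invr_ge0 ltW.
  have : \int[cnormal v]_x (1 - expR (- (m * nsq x)))%:E +
         \int[cnormal v]_x (expR (- (m * nsq x)))%:E = 1.
    rewrite -ge0_integralD//; last 3 first.
    - by move=> x _; rewrite lee_fin subr_ge0.
    - by apply/measurable_EFinP; apply: measurable_funB.
    - exact/measurable_EFinP.
    under eq_integral do rewrite -EFinD subrK.
    exact: integral_probability_cst.
  have -> : \int[cnormal v]_x (expR (- (m * nsq x)))%:E = ((1 + m * v)^-1)%:E.
    transitivity (\int[cnormal v]_x (expR (2 * cdot x 0 - m * nsq x))%:E).
      by apply: eq_integral => x _; rewrite /cdot/= !mulr0 addr0 mulr0 sub0r.
    rewrite integral_cnormal_expR_quadratic ?ltW//.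
    by rewrite /nsq/= expr0n addr0 mulr0 mul0r expR0 mulr1.
  move=> /(congr1 (fun x => x - ((1 + m * v)^-1)%:E)); rewrite addeK// => ->.
  rewrite -EFinB -EFinM; congr EFin; field.
  by rewrite !gt_eqF.
apply/eqP; rewrite eq_le; apply/andP; split; last first.
  apply/lee_addgt0Pr => e e0.
  (* For m = e / v^2 the exact value v / (1 + m v) equals v^2 / (v + e), which is at least v - e. *)
  have m0 : (0 < e / v ^+ 2)%R by rewrite divr_gt0// exprn_gt0.
  have k0 : (0 < 1 + e / v ^+ 2 * v)%R by rewrite ltr_pwDl// mulr_ge0// ltW.
  apply: (@le_trans _ _ (\int[cnormal v]_x ((1 - expR (- (e / v ^+ 2 * nsq x))) / (e / v ^+ 2))%:E + e%:E)).
    rewrite Eexp// -EFinD lee_fin -lerBlDr ler_pdivlMr//.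
    rewrite -subr_ge0 (_ : _ - _ = e ^+ 2 / v)%R ?divr_ge0 ?sqr_ge0 ?ltW//.
    by field; rewrite gt_eqF.
  rewrite leeD2r// ge0_le_integral//.
  - move=> x _; rewrite lee_fin; apply: divr_ge0; last exact: ltW.
    by rewrite subr_ge0 -expR0 ler_expR oppr_le0 mulr_ge0 ?nsq_ge0// ltW.
  - apply/measurable_EFinP/measurable_funM => //; apply: measurable_funB => //.
    apply: measurableT_comp => //; apply: measurableT_comp => //.
    by apply: measurable_funM => //; exact: measurable_nsq.
  - move=> x _; rewrite lee_fin ler_pdivrMr// lerBlDl -lerBlDr.
    by have := expR_ge1Dx (- (e / v ^+ 2 * nsq x)); rewrite mulrC.
(* This is |x|^2 / (1 + |x|^2 / (j + 1)), nondecreasing in j with limit |x|^2. The quotient is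
   written with [expR] and [ln] so that its measurability is immediate. *)
pose h j (x : R[i]) := (nsq x * expR (- ln (1 + j.+1%:R^-1 * nsq x)))%R.
have d0 j x : (0 < 1 + j.+1%:R^-1 * nsq x :> R)%R.
  by rewrite ltr_pwDl// mulr_ge0 ?nsq_ge0// invr_ge0.
have hE j x : h j x = (nsq x / (1 + j.+1%:R^-1 * nsq x))%R.
  by rewrite /h expRN lnK ?posrE.
have mh j : measurable_fun setT (h j).
  apply: measurable_funM; first exact: measurable_nsq.
  apply: measurableT_comp => //; apply: measurableT_comp => //.
  apply: measurableT_comp => //.
  by apply: measurable_funD => //; apply: measurable_funM => //; exact: measurable_nsq.
have hv j : \int[cnormal v]_x (h j x)%:E <= v%:E.
  have j0 : (0 < j.+1%:R^-1 :> R)%R by rewrite invr_gt0.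
  have k0 : (0 < 1 + j.+1%:R^-1 * v)%R by rewrite ltr_pwDl// mulr_ge0// ltW.
  apply: (@le_trans _ _ (v / (1 + j.+1%:R^-1 * v))%:E); last first.
    by rewrite lee_fin ler_pdivrMr// ler_peMr ?ltW// ltrDl mulr_gt0.
  rewrite -Eexp//; apply: ge0_le_integral => //.
  - by move=> x _; rewrite lee_fin hE divr_ge0 ?nsq_ge0// ltW.
  - exact/measurable_EFinP.
  - apply/measurable_EFinP/measurable_funM => //; apply: measurable_funB => //.
    apply: measurableT_comp => //; apply: measurableT_comp => //.
    by apply: measurable_funM => //; exact: measurable_nsq.
  - move=> x _; rewrite lee_fin hE ler_pdivlMr// mulrAC ler_pdivrMr//.
    rewrite [leLHS]mulrC; have := expR_ge1Dx (j.+1%:R^-1 * nsq x).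
    move: (j.+1%:R^-1 * nsq x)%R => t tle.
    have : ((1 + t) * expR (- t) <= 1)%R.
      by rewrite expRN ler_pdivrMr ?expR_gt0// mul1r.
    by move: (expR (- t)) => E; nra.
have hx x : h j x @[j --> \oo] --> nsq x.
  rewrite (_ : (fun j => h j x) = (fun j => nsq x / (1 + @harmonic R j * nsq x))%R); last first.
    by apply/funext => j; rewrite hE.
  rewrite -[X in _ --> X](_ : nsq x / (1 + 0 * nsq x) = _)%R; last first.
    by rewrite mul0r addr0 divr1.
  apply: cvgM; first exact: cvg_cst.
  apply: cvgV; first by rewrite mul0r addr0 oner_neq0.
  apply: cvgD; first exact: cvg_cst.
  by apply: cvgM; [exact: cvg_harmonic|exact: cvg_cst].
have -> : \int[cnormal v]_x (nsq x)%:E = lim (\int[cnormal v]_x (h j x)%:E @[j --> \oo]).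
  rewrite -monotone_convergence//.
  - apply: eq_integral => x _; apply/esym/cvg_lim => //.
    by apply: cvg_EFin; [near=> j|exact: hx].
  - by move=> j; exact/measurable_EFinP.
  - by move=> j x _; rewrite lee_fin hE divr_ge0 ?nsq_ge0// ltW.
  - move=> x _ i j ij; rewrite lee_fin !hE ler_wpM2l ?nsq_ge0//.
    rewrite lef_pV2 ?posrE// lerD2l ler_wpM2r ?nsq_ge0//.
    by rewrite lef_pV2 ?posrE// ler_nat ltnS.
apply: lime_le; last by near=> j.
apply: ereal_nondecreasing_is_cvgn => i j ij; apply: ge0_le_integral => //.
- by move=> x _; rewrite lee_fin hE divr_ge0 ?nsq_ge0// ltW.
- exact/measurable_EFinP.
- exact/measurable_EFinP.
- move=> x _; rewrite lee_fin !hE ler_wpM2l ?nsq_ge0//.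
  rewrite lef_pV2 ?posrE// lerD2l ler_wpM2r ?nsq_ge0//.
  by rewrite lef_pV2 ?posrE// ler_nat ltnS.
Unshelve. all: end_near. Qed.

(* The linear term is cancelled by averaging over x and - x. *)
Lemma integral_cnormal_quadratic (a : R) (u : R[i]) (m : R) :
  (forall x, 0 <= a + 2 * cdot x u + m * nsq x)%R -> (0 <= m)%R ->
  \int[cnormal v]_x (a + 2 * cdot x u + m * nsq x)%:E = (a + m * v)%:E.
Proof.
move=> q0 m0.
have a0 : (0 <= a)%R by have := q0 0%R; rewrite /cdot /nsq/= expr0n !mul0r !(addr0, mulr0).
have mq : measurable_fun setT (fun x : R[i] => (a + 2 * cdot x u + m * nsq x)%:E).
  apply/measurable_EFinP; apply: measurable_funD.
    by apply: measurable_funD => //; apply: measurable_funM => //; exact: measurable_cdot.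
  by apply: measurable_funM => //; exact: measurable_nsq.
have mqN : measurable_fun setT (fun x : R[i] => (a + 2 * cdot (- x) u + m * nsq (- x))%:E).
  under eq_fun do rewrite cdotNl nsqN mulrN.
  apply/measurable_EFinP; apply: measurable_funD.
    by apply: measurable_funB => //; apply: measurable_funM => //; exact: measurable_cdot.
  by apply: measurable_funM => //; exact: measurable_nsq.
set I := LHS.
have II : I + I = (2 * (a + m * v))%:E.
  rewrite -[X in X + _](ge0_integral_cnormalN mq)//.
  rewrite -ge0_integralD//; [|by move=> x _; rewrite lee_fin..].
  transitivity (\int[cnormal v]_x ((2 * a)%:E + (2 * m)%:E * (nsq x)%:E)).
    apply: eq_integral => x _; rewrite -EFinM -!EFinD; congr EFin.
    by rewrite cdotNl nsqN; ring.
  rewrite ge0_integralD//.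
  - rewrite integral_probability_cst ge0_integralZl//.
    + by rewrite integral_cnormal_nsq -EFinM -EFinD; congr EFin; ring.
    + by move=> x _; rewrite lee_fin nsq_ge0.
    + by rewrite lee_fin mulr_ge0.
  - by move=> x _; rewrite lee_fin mulr_ge0.
  - by move=> x _; rewrite mule_ge0// lee_fin ?nsq_ge0// mulr_ge0.
  - by apply: emeasurable_funM.
have I0 : 0 <= I by apply: integral_ge0 => x _; rewrite lee_fin.
move: II I0; generalize I => -[r| |]//; rewrite -EFinD => -[rr] _; congr EFin.
by apply: (@mulfI _ 2%R); rewrite ?pnatr_eq0// -rr; ring.
Qed.

End complex_normal_integrals.

(** * Rank-one updates and hermitian forms *)

Local Open Scope sesquilinear_scope.

(** [M *m L] and [L *m M] are both block triangular and [L] has determinant 1, so the determinant of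
    [M] is read off in two ways. *)
Lemma det_rank1 (K : comNzRingType) p (u : 'cV[K]_p) (w : 'rV[K]_p) :
  \det (1%:M + u *m w) = 1 + (w *m u) 0 0.
Proof.
pose M := block_mx 1%:M u (- w) 1%:M : 'M[K]_(p + 1).
pose L := block_mx 1%:M 0 w 1%:M : 'M[K]_(p + 1).
have dL : \det L = 1 by rewrite det_lblock !det1 mulr1.
have ML : M *m L = block_mx (1%:M + u *m w) u 0 1%:M.
  by rewrite mulmx_block !mulmx1 !mul1mx !mulmx0 !add0r addNr.
have LM : L *m M = block_mx 1%:M u 0 (w *m u + 1%:M).
  by rewrite mulmx_block !mulmx1 !mul1mx !mul0mx !addr0 subrr.
have := congr1 determinant ML; rewrite det_mulmx dL mulr1 det_ublock det1 mulr1 => <-.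
have := congr1 determinant LM; rewrite det_mulmx dL mul1r det_ublock det1 mul1r => ->.
by rewrite det_mx11 !mxE eqxx addrC.
Qed.

(** A name for the conjugate transpose of the statement, convertible to it, that rewriting treats as
    one operation. *)
Definition conjmxT (R : realType) m n (A : 'M[R[i]]_(m, n)) : 'M[R[i]]_(n, m) := A ^t*.

Notation "A ^H" := (conjmxT A) (at level 8, format "A ^H").

Section hermitian_form.
Context (R : realType).
Implicit Types x a : R[i].

Lemma conjmxTE m n (A : 'M[R[i]]_(m, n)) i j : A^H i j = ((A j i)^*)%C.
Proof. by rewrite /conjmxT 2!mxE. Qed.

Lemma conjmxTK m n (A : 'M[R[i]]_(m, n)) : A^H^H = A.
Proof. exact: trmxCK. Qed.

Definition sform p (T : 'M[R[i]]_p) (h y : 'cV[R[i]]_p) : R[i] :=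
  (h^H *m T *m y) 0 0.

(** Taking the real part gives a real number without carrying a proof; for a hermitian T it loses
    nothing, by [sform_real]. *)
Definition qform p (T : 'M[R[i]]_p) (y : 'cV[R[i]]_p) : R := complex.Re (sform T y y).

Lemma conjmxT_mul m n p (A : 'M[R[i]]_(m, n)) (B : 'M[R[i]]_(n, p)) :
  (A *m B)^H = B^H *m A^H.
Proof. by rewrite /conjmxT trmx_mul map_mxM. Qed.

Lemma conjmxT_add m n (A B : 'M[R[i]]_(m, n)) : (A + B)^H = A^H + B^H.
Proof. by rewrite /conjmxT linearD map_mxD. Qed.

Lemma conjmxT_scale m n x (A : 'M[R[i]]_(m, n)) : (x *: A)^H = (x^*)%C *: A^H.
Proof. by rewrite /conjmxT linearZ map_mxZ. Qed.

Lemma conjmxT1 n : (1%:M : 'M[R[i]]_n)^H = 1%:M.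
Proof. by rewrite /conjmxT trmx1 map_mx1. Qed.

Lemma Re_mul_real (r : R) x : complex.Re (r%:C * x) = r * complex.Re x.
Proof. by case: x => a b /=; rewrite mul0r subr0. Qed.

Lemma qform1E p (y : 'cV[R[i]]_p) : qform 1%:M y = \sum_i nsq (y i 0).
Proof.
rewrite /qform /sform mulmx1 mxE raddf_sum; apply: eq_bigr => i _.
by rewrite nsqE conjmxTE.
Qed.

Lemma qform1_ge0 p (y : 'cV[R[i]]_p) : 0 <= qform 1%:M y.
Proof. by rewrite qform1E sumr_ge0// => i _; exact: nsq_ge0. Qed.

Lemma sformDl p (T : 'M[R[i]]_p) (h y z : 'cV[R[i]]_p) x :
  sform T (h + x *: y) z = sform T h z + (x^*)%C * sform T y z.
Proof. by rewrite /sform conjmxT_add conjmxT_scale !mulmxDl -!scalemxAl !mxE. Qed.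

Lemma sformDr p (T : 'M[R[i]]_p) (h y z : 'cV[R[i]]_p) x :
  sform T z (h + x *: y) = sform T z h + x * sform T z y.
Proof. by rewrite /sform mulmxDr -scalemxAr !mxE. Qed.

Section hermitian.
Variables (p : nat) (T : 'M[R[i]]_p) (TT : T^H = T).

Lemma sform_conj (y h : 'cV[R[i]]_p) : sform T y h = ((sform T h y)^*)%C.
Proof.
transitivity ((h^H *m T *m y)^H 0 0); last by rewrite conjmxTE.
by rewrite !conjmxT_mul conjmxTK TT mulmxA.
Qed.

Lemma sform_real (y : 'cV[R[i]]_p) : sform T y y = (qform T y)%:C.
Proof.
have := sform_conj y y; rewrite /qform; case: (sform T y y) => a b [] /= bb.
by congr (_ +i* _); lra.
Qed.

Lemma qformD (y h : 'cV[R[i]]_p) x :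
  qform T (y + x *: h) = qform T y + 2 * cdot x (sform T h y) + qform T h * nsq x.
Proof.
rewrite /qform sformDr !sformDl (sform_conj y h) /cdot /nsq.
case: (sform T y y) (sform T h y) (sform T h h) x => [a b] [a' b'] [a'' b''] [c d] /=.
ring.
Qed.

End hermitian.
Lemma qform_gram p k (T : 'M[R[i]]_p) (G : 'M[R[i]]_(p, k)) (y : 'cV[R[i]]_p) (r : R) :
  qform (T + r%:C *: (G *m G^H)) y = qform T y + r * qform 1%:M (G^H *m y).
Proof.
rewrite /qform /sform mulmxDr mulmxDl mxE raddfD/=; congr (_ + _).
by rewrite -scalemxAr -scalemxAl mxE Re_mul_real mulmx1 conjmxT_mul conjmxTK !mulmxA.
Qed.

(** Turns the form of an inverse matrix into the form of the matrix itself, whose positivity is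
    visible when it is [gram v G]. *)
Lemma qform_congr p (T S : 'M[R[i]]_p) (y : 'cV[R[i]]_p) :
  T^H = T -> T *m S = 1%:M -> qform T y = qform S (T *m y).
Proof.
move=> TT TS; rewrite /qform /sform conjmxT_mul TT.
by rewrite -(mulmxA _ T S) TS mulmx1 mulmxA.
Qed.

(** The terms on the left are the diagonal entries of G^H T G; the trace is then cyclic. *)
Lemma sum_qform_col p k (T : 'M[R[i]]_p) (G : 'M[R[i]]_(p, k)) :
  \sum_j qform T (col j G) = complex.Re (\tr (T *m (G *m G^H))).
Proof.
rewrite mulmxA mxtrace_mulC mulmxA /mxtrace raddf_sum; apply: eq_bigr => j _.
rewrite /qform /sform; congr complex.Re.
rewrite !mxE; apply: eq_bigr => l _; rewrite !mxE; congr (_ * _).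
by apply: eq_bigr => a _; rewrite !conjmxTE mxE.
Qed.

Lemma col0_mulmx p k (G : 'M[R[i]]_(p, k.+1)) (c : 'I_k.+1 -> R[i]) :
  G *m (\col_i c i) = c ord0 *: col ord0 G +
    (col' ord0 G : 'M[R[i]]_(p, k)) *m (\col_i c (lift ord0 i)).
Proof.
apply/matrixP => i j; rewrite !mxE big_ord_recl !mxE mulrC; congr (_ + _).
by apply: eq_bigr => l _; rewrite !mxE.
Qed.

Lemma gram_col0 p k (G : 'M[R[i]]_(p, k.+1)) :
  G *m G^H = col ord0 G *m (col ord0 G)^H +
    (col' ord0 G : 'M[R[i]]_(p, k)) *m (col' ord0 G : 'M[R[i]]_(p, k))^H.
Proof.
apply/matrixP => i j; rewrite !mxE big_ord_recl big_ord1 !conjmxTE !mxE; congr (_ + _).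
by apply: eq_bigr => l _; rewrite !conjmxTE !mxE.
Qed.

End hermitian_form.

Local Close Scope sesquilinear_scope.

(** The hypothesis on [e] is the usual coefficient c / (1 + c a) with the division cleared; it is
    exactly what cancels the coefficient c - e - e c a of the rank-one term. *)
Lemma sherman_morrison (K : comNzRingType) p (T S : 'M[K]_p) (h : 'cV[K]_p)
    (w : 'rV[K]_p) (a c e : K) :
  T *m S = 1%:M -> w *m T *m h = a%:M -> c = e * (1 + c * a) ->
  (T - e *: (T *m h *m (w *m T))) *m (S + c *: (h *m w)) = 1%:M.
Proof.
move=> TS wTh ce; rewrite mulmxDr !mulmxDl TS !mulNmx -!scalemxAl -!scalemxAr.
have -> : T *m h *m (w *m T) *m S = T *m h *m w by rewrite -!mulmxA TS mulmx1.
have -> : T *m h *m (w *m T) *m (h *m w) = a *: (T *m h *m w).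
  by rewrite mulmxA -(mulmxA (T *m h)) wTh mul_mx_scalar scalemxAl.
rewrite mulmxA !scalerA; set X := T *m h *m w.
transitivity (1%:M + (c - e - e * (c * a)) *: X).
  by rewrite !scalerBl !addrA [1%:M - _ + _]addrAC -?mulrA.
by rewrite {1}ce (_ : _ - _ - _ = 0) ?scale0r ?addr0//; ring.
Qed.

Lemma det_rank1_update (K : comNzRingType) p (T S : 'M[K]_p) (h : 'cV[K]_p)
    (w : 'rV[K]_p) (c : K) : S *m T = 1%:M ->
  \det (S + c *: (h *m w)) = \det S * (1 + c * (w *m T *m h) 0 0).
Proof.
move=> ST; have -> : S + c *: (h *m w) = S *m (1%:M + (c *: (T *m h)) *m w).
  by rewrite mulmxDr mulmx1 -scalemxAl -scalemxAr !mulmxA ST mul1mx.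
by rewrite det_mulmx det_rank1 -scalemxAr mxE mulmxA.
Qed.

(** * Gaussian integrals of exponentials and of quadratic forms in several variables *)

Section gaussian_integrals.
Context (R : realType).

Lemma cdot_real (x a : R[i]) (r : R) : cdot x (r%:C * a) = r * cdot x a.
Proof. by case: x a => [? ?] [? ?]; rewrite /cdot/=; ring. Qed.

Lemma nsq_real (a : R[i]) (r : R) : nsq (r%:C * a) = r ^+ 2 * nsq a.
Proof. by case: a => [? ?]; rewrite /nsq/=; ring. Qed.

Variables (v : R) (v0 : 0 < v).

(** For [c] with i.i.d. entries of unit variance this is the covariance of [G c + z] in units of the
    noise variance [v]. *)
Definition gram p k (G : 'M[R[i]]_(p, k)) : 'M[R[i]]_p :=
  1%:M + (v^-1)%:C *: (G *m G^H).

Lemma qform_inv_gram_ge0 p k (G : 'M[R[i]]_(p, k)) (T : 'M[R[i]]_p) y :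
  T^H = T -> T *m gram G = 1%:M -> 0 <= qform T y.
Proof.
move=> TT TS; rewrite (qform_congr _ TT TS) qform_gram addr_ge0 ?qform1_ge0//.
by rewrite mulr_ge0 ?qform1_ge0// invr_ge0 ltW.
Qed.

Lemma measurable_conjmxT d (U : measurableType d) m n (f : U -> 'M[R[i]]_(m, n)) :
  measurable_fun setT f -> measurable_fun setT (fun x => (f x)^H).
Proof.
move=> mf; apply: measurable_fun_matrix => i j.
rewrite (_ : (fun x => (f x)^H i j) =
    (fun x => complex.Re (f x j i) -i* complex.Im (f x j i))); last first.
  by apply/funext => x; rewrite conjmxTE; case: (f x j i).
apply: measurable_fun_complex => /=.
  by apply: measurable_fun_Re; exact: measurable_fun_entry.
apply: measurableT_comp => //.
by apply: measurable_fun_Im; exact: measurable_fun_entry.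
Qed.

Lemma measurable_fun_qform d (U : measurableType d) p (T : U -> 'M[R[i]]_p)
    (f : U -> 'cV[R[i]]_p) : measurable_fun setT T -> measurable_fun setT f ->
  measurable_fun setT (fun x => qform (T x) (f x)).
Proof.
move=> mT mf; apply: measurable_fun_Re; rewrite /sform.
apply: (@measurable_fun_entry _ _ _ _ _ _ (fun x => (f x)^H *m T x *m f x)).
apply: measurable_mulmx => //; apply: measurable_mulmx => //.
exact: measurable_conjmxT.
Qed.

Lemma colS_mulmx p k (G : 'M[R[i]]_(p, k.+1)) (x : R[i]) (u : k.-tuple R[i]) :
  G *m (\col_i tnth [tuple of x :: u] i) =
  x *: col ord0 G + (col' ord0 G : 'M[R[i]]_(p, k)) *m (\col_i tnth u i).
Proof.
rewrite col0_mulmx tnth0; congr (_ + _ *m _).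
by apply/matrixP => i j; rewrite !mxE tnthS.
Qed.

Lemma measurable_smoothed p k (G : 'M[R[i]]_(p, k)) (y : 'cV[R[i]]_p) :
  measurable_fun setT (fun u : k.-tuple R[i] =>
    (expR (- qform 1%:M (y - G *m (\col_i tnth u i)) / v))%:E).
Proof.
apply/measurable_EFinP; apply: measurableT_comp => //.
apply: measurable_funM => //; apply: measurableT_comp => //.
apply: measurable_fun_qform => //; apply: measurable_addmx => //.
apply: measurable_oppmx; apply: measurable_mulmx => //.
exact: measurable_col_of_tuple.
Qed.

(* Sherman-Morrison and the matrix determinant lemma, one column at a time. *)
Lemma gaussian_smoothing p k (G : 'M[R[i]]_(p, k)) : exists (T : 'M[R[i]]_p) (e : R),
  [/\ T^H = T, T *m gram G = 1%:M, 0 < e, \det (gram G) = e%:C &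
  forall y, (\int[iid_law (cnormal 1) k]_u
     (expR (- qform 1%:M (y - G *m (\col_i tnth u i)) / v))%:E =
     (e^-1 * expR (- qform T y / v))%:E)%E].
Proof.
elim: k G => [|k ih] G.
  have G0 : gram G = 1%:M.
    by rewrite /gram (_ : G *m G^H = 0) ?scaler0 ?addr0//; apply/matrixP => i j;
      rewrite !mxE big_ord0.
  exists 1%:M, 1; split => //; rewrite ?conjmxT1 ?G0 ?mulmx1 ?det1//.
  move=> y; rewrite invr1 mul1r integral_iid_law0; last exact: measurable_smoothed.
  congr (expR (- qform _ _ / v))%:E.
  by apply/matrixP => i j; rewrite !mxE big_ord0 subr0.
have [T [e [TT TS e0 dS ihy]]] := ih (col' ord0 G).
set S := gram _ in TS dS; set h := col ord0 G.
have SG : gram G = S + (v^-1)%:C *: (h *m h^H).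
  by rewrite /gram gram_col0 scalerDr addrA addrAC.
have qT0 y : 0 <= qform T y by exact: qform_inv_gram_ge0 TS.
(* [1 + m] is the factor by which adding the column [h] multiplies the determinant. *)
pose m := qform T h / v.
have m0 : 0 <= m by rewrite divr_ge0// ltW.
have m1 : 0 < 1 + m by rewrite ltr_pwDl.
have mE : (h^H *m T *m h) = (v * m)%:C%:M.
  rewrite [LHS]mx11_scalar -/(sform T h h) sform_real//; congr (_%:C%:M).
  by rewrite /m mulrCA mulfV ?mulr1// gt_eqF.
have ST : S *m T = 1%:M by exact: mulmx1C.
(* Sherman-Morrison with c = 1 / v and a = v m: the coefficient e must satisfy e (1 + m) = 1 / v. *)
pose T1 := T - ((v * (1 + m))^-1)%:C *: (T *m h *m (T *m h)^H).
have T1E : T1 = T + (- (v * (1 + m))^-1)%:C *: (T *m h *m (T *m h)^H).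
  by rewrite /T1 (rmorphN (real_complex R)) scaleNr.
have QT1 y : qform T1 y = qform T y - (v * (1 + m))^-1 * nsq (sform T h y).
  rewrite T1E qform_gram mulNr qform1E big_ord1 conjmxT_mul TT.
  by rewrite -/(sform T h y).
exists T1, (e * (1 + m)); split.
- rewrite T1E conjmxT_add conjmxT_scale conjc_real conjmxT_mul conjmxTK.
  by congr (_ + _).
- rewrite SG /T1 conjmxT_mul TT; apply: (sherman_morrison TS mE).
  rewrite -(rmorph1 (real_complex R)) -!(rmorphM (real_complex R)) -rmorphD -rmorphM.
  by congr (_%:C)%C; field; rewrite !gt_eqF.
- by rewrite mulr_gt0.
- rewrite SG (det_rank1_update _ _ _ ST) dS mE mxE eqxx mulr1n.
  rewrite -(rmorph1 (real_complex R)) -!(rmorphM (real_complex R)) -rmorphD -rmorphM.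
  by congr (_%:C)%C; field; rewrite !gt_eqF.
- move=> y; rewrite integral_iid_lawS; [|exact: measurable_smoothed|by []].
  set a := sform T h y.
  (* With the first symbol [x] fixed, the induction hypothesis integrates the others; expanding the
     form of [y - x h] leaves one complex Gaussian integral in [x]. *)
  transitivity (\int[cnormal 1]_x ((e^-1 * expR (- qform T y / v))%:E *
      (expR (2 * cdot x ((v^-1)%:C * a) - m * nsq x))%:E))%E.
    apply: eq_integral => x _.
    under eq_integral do rewrite colS_mulmx opprD addrA -scaleNr.
    rewrite ihy qformD// cdotNl nsqN -EFinM -mulrA -expRD; congr (_ * expR _)%:E.
    rewrite /m cdot_real; field.
    by rewrite gt_eqF.
  rewrite ge0_integralZl//.
  + rewrite integral_cnormal_expR_quadratic// -EFinM mulrACA -expRD -invfM !mulr1 mul1r.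
    congr (_ * expR _)%:E.
    rewrite QT1 nsq_real; field.
    by rewrite !gt_eqF.
  + apply/measurable_EFinP; apply: measurableT_comp => //; apply: measurable_funB.
      by apply: measurable_funM => //; exact: measurable_cdot.
    by apply: measurable_funM => //; exact: measurable_nsq.
  + by rewrite lee_fin mulr_ge0 ?expR_ge0// invr_ge0 ltW.
Qed.

(* The quadratic form is integrated one coordinate at a time; linear terms vanish. *)
Lemma integral_qform p k (T : 'M[R[i]]_p) (G : 'M[R[i]]_(p, k)) (y : 'cV[R[i]]_p) :
  T^H = T -> (forall z, 0 <= qform T z) ->
  (\int[iid_law (cnormal v) k]_u (qform T (y + G *m (\col_i tnth u i)))%:E =
   (qform T y + v * \sum_j qform T (col j G))%:E)%E.
Proof.
move=> TT T0.
have mq k' (G' : 'M[R[i]]_(p, k')) (z : 'cV[R[i]]_p) : measurable_fun setT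
    (fun u : k'.-tuple R[i] => (qform T (z + G' *m (\col_i tnth u i)))%:E).
  apply/measurable_EFinP; apply: measurable_fun_qform => //.
  apply: measurable_addmx => //; apply: measurable_mulmx => //.
  exact: measurable_col_of_tuple.
elim: k G y => [|k ih] G y.
  rewrite integral_iid_law0// big_ord0 mulr0 addr0; congr (qform _ _)%:E.
  by apply/matrixP => i j; rewrite !mxE big_ord0 addr0.
rewrite integral_iid_lawS//; last by move=> u; rewrite lee_fin.
set h := col ord0 G; set K := v * \sum_j qform T (col j (col' ord0 G : 'M[R[i]]_(p, k))).
have K0 : 0 <= K by rewrite mulr_ge0//; [exact: ltW|exact: sumr_ge0].
transitivity (\int[cnormal v]_x
    (qform T y + K + 2 * cdot x (sform T h y) + qform T h * nsq x)%:E)%E.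
  apply: eq_integral => x _.
  under eq_integral do rewrite colS_mulmx addrA.
  rewrite ih qformD// -/h -/K; congr (_%:E); ring.
rewrite integral_cnormal_quadratic//; last first.
  move=> x; rewrite -addrA -addrA addrCA addr_ge0// addrA.
  by rewrite -qformD.
congr (_%:E); rewrite /K [in RHS]big_ord_recl -/h mulrDr.
rewrite (eq_bigr (fun j => qform T (col (lift ord0 j) G))).
  by ring.
by move=> j _; congr (qform _ _); apply/matrixP => a b; rewrite !mxE.
Qed.

End gaussian_integrals.

(** * Translation of a Gaussian vector as a change of density *)

Section gaussian_shift.
Local Open Scope ereal_scope.
Context (R : realType).
Variables (v : R) (v0 : (0 < v)%R).

Definition shift_tuple k (a : 'I_k -> R[i]) (u : k.-tuple R[i]) : k.-tuple R[i] :=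
  [tuple (tnth u i + a i)%R | i < k].

Lemma measurable_shift_tuple k (a : 'I_k -> R[i]) : measurable_fun setT (shift_tuple a).
Proof.
apply/measurable_fun_tnthP => i.
rewrite (_ : _ \o _ = (fun u => (tnth u i + a i)%R)).
  by apply: measurable_complexD => //; exact: measurable_tnth.
by apply/funext => u /=; rewrite tnth_mktuple.
Qed.

Lemma shift_tuple_cons k (a : 'I_k.+1 -> R[i]) x (u : k.-tuple R[i]) :
  shift_tuple a [tuple of x :: u] =
  [tuple of (x + a ord0)%R :: shift_tuple (fun i => a (lift ord0 i)) u].
Proof.
apply: eq_from_tnth => i; rewrite tnth_mktuple.
by have [j ->|->] := unliftP ord0 i; rewrite ?tnthS ?tnth0 ?tnth_mktuple.
Qed.

Lemma measurable_shift_weight k (a : 'I_k -> R[i]) :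
  measurable_fun setT (fun u : k.-tuple R[i] =>
    (expR (\sum_i (2 * cdot (tnth u i) (a i) - nsq (a i)) / v))%:E).
Proof.
apply/measurable_EFinP; apply: measurableT_comp => //; apply: measurable_sum => i.
apply: measurable_funM => //; apply: measurable_funB => //.
apply: measurable_funM => //.
by apply: (measurableT_comp (measurable_cdot (a i))); exact: measurable_tnth.
Qed.

Lemma ge0_integral_iid_cnormal_shift k (a : 'I_k -> R[i]) (F : k.-tuple R[i] -> \bar R) :
  measurable_fun setT F -> (forall u, 0 <= F u) ->
  \int[iid_law (cnormal v) k]_u F (shift_tuple a u) =
  \int[iid_law (cnormal v) k]_u
    (F u * (expR (\sum_i (2 * cdot (tnth u i) (a i) - nsq (a i)) / v))%:E).
Proof.
elim: k a F => [|k ih] a F mF F0.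
  have mFs := measurableT_comp mF (measurable_shift_tuple a).
  rewrite integral_iid_law0//.
  rewrite integral_iid_law0; last by apply: emeasurable_funM => //; exact: measurable_shift_weight.
  rewrite big_ord0 expR0 mule1; congr F.
  by apply: eq_from_tnth => -[].
have mFs := measurableT_comp mF (measurable_shift_tuple a).
have mFw : measurable_fun setT (fun u => F u * (expR (\sum_i (2 * cdot (tnth u i) (a i) - nsq (a i)) / v))%:E).
  by apply: emeasurable_funM => //; exact: measurable_shift_weight.
have Fw0 u : 0 <= F u * (expR (\sum_i (2 * cdot (tnth u i) (a i) - nsq (a i)) / v))%:E.
  by rewrite mule_ge0// lee_fin expR_ge0.
rewrite integral_iid_lawS// integral_iid_lawS//.
set a' := fun i => a (lift ord0 i).
pose wt (u : k.-tuple R[i]) := (expR (\sum_i (2 * cdot (tnth u i) (a' i) - nsq (a' i)) / v))%:E.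
pose K (x : R[i]) := \int[iid_law (cnormal v) k]_u (F [tuple of x :: u] * wt u).
have mcons : measurable_fun setT (fun xu : R[i] * k.-tuple R[i] => F [tuple of xu.1 :: xu.2] * wt xu.2).
  apply: emeasurable_funM; first exact: (measurableT_comp mF (@measurable_cons_tuple _ _ k)).
  by apply: (measurableT_comp (measurable_shift_weight a')).
have mK : measurable_fun setT K.
  apply: (@measurable_fun_fubini_tonelli_F _ _ _ _ _ (iid_law (cnormal v) k) _ mcons).
  by move=> xu; rewrite mule_ge0// lee_fin expR_ge0.
have K0 x : 0 <= K x by apply: integral_ge0 => u _; rewrite mule_ge0// lee_fin expR_ge0.
transitivity (\int[cnormal v]_x K (x + a ord0)%R).
  apply: eq_integral => x _.
  under eq_integral do rewrite shift_tuple_cons.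
  rewrite -/a' (ih a' (fun u => F [tuple of (x + a ord0)%R :: u]))//.
  exact: (measurableT_comp mF (@measurable_cons _ _ _ _ (cst (x + a ord0)%R) k id _ _)).
rewrite (ge0_integral_cnormal_shift v0 (a ord0) mK K0).
apply: eq_integral => x _; rewrite /K -ge0_integralZr//.
- apply: eq_integral => u _; rewrite -muleA -EFinM -expRD big_ord_recl tnth0.
  rewrite addrC; congr (_ * (expR (_ + _))%:E).
  by apply: eq_bigr => i _; rewrite tnthS.
- apply: emeasurable_funM; last exact: measurable_shift_weight.
  exact: (measurableT_comp mF (@measurable_cons _ _ _ _ (cst x) k id _ _)).
- by move=> u _; rewrite mule_ge0// lee_fin expR_ge0.
Qed.

(** The weight is the density of the law of [a + z] with respect to the law of [z]; with [a = G c]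
    it becomes [dens G c]. *)
Lemma ge0_integral_gaussian_col_shift p (a : 'cV[R[i]]_p) (F : 'cV[R[i]]_p -> \bar R) :
  measurable_fun setT F -> (forall y, 0 <= F y) ->
  \int[gaussian_matrix v p 1]_y F (a + y)%R =
  \int[gaussian_matrix v p 1]_y
    (F y * (expR ((qform 1%:M y - qform 1%:M (y - a)) / v))%:E).
Proof.
move=> mF F0.
have ma : measurable_fun setT (fun y : 'cV[R[i]]_p => F (a + y)%R).
  by apply: (measurableT_comp mF); apply: measurable_addmx.
have mw : measurable_fun setT (fun y : 'cV[R[i]]_p =>
    F y * (expR ((qform 1%:M y - qform 1%:M (y - a)) / v))%:E).
  apply: emeasurable_funM => //; apply/measurable_EFinP; apply: measurableT_comp => //.
  apply: measurable_funM => //; apply: measurable_funB; apply: measurable_fun_qform => //.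
  exact: measurable_addmx.
rewrite ge0_integral_gaussian_col//.
rewrite ge0_integral_gaussian_col//; last first.
  by move=> y; rewrite mule_ge0// lee_fin expR_ge0.
transitivity (\int[iid_law (cnormal v) p]_u
    F (\col_i tnth (shift_tuple (fun i => a i 0%R) u) i)).
  apply: eq_integral => u _; congr F; apply/matrixP => i j.
  by rewrite !mxE tnth_mktuple (ord1 j) addrC.
have mFc := measurableT_comp mF (@measurable_col_of_tuple R p).
rewrite (ge0_integral_iid_cnormal_shift _ mFc (fun u => F0 _)).
apply: eq_integral => u _; congr (_ * (expR _)%:E).
rewrite !qform1E -sumrB mulr_suml; apply: eq_bigr => i _.
by rewrite !mxE nsqD nsqN /cdot !raddfN/=; congr (_ / _)%R; ring.
Qed.

End gaussian_shift.

(** * The score of the Gaussian vector channel *)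

Section score.
Context (R : realType).
Variables (v : R) (v0 : 0 < v).

Section definitions.
Variables (p k : nat).
Implicit Types (G : 'M[R[i]]_(p, k)) (c : 'cV[R[i]]_k) (y : 'cV[R[i]]_p).

(* Density at y of G c + z, resp. of its mean over c, with respect to the law of
   the noise z. *)
Definition dens G c y : R := expR ((qform 1%:M y - qform 1%:M (y - G *m c)) / v).

Definition mdens G y : R := fine (\int[gaussian_matrix 1 k 1]_c (dens G c y)%:E)%E.

(** The likelihood ratio of the pair (c, y); its logarithm is the information density of the channel
    with matrix G. *)
Definition score G c y : R := dens G c y / mdens G y.

Definition logdet G : R := ln (complex.Re (\det (gram v G))).

(** Defined as what is left over, which makes [ln_scoreE] pure algebra. By [energyE] it is y^H T y /
    v for the inverse T of [gram v G], hence nonnegative. *)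
Definition energy G y : R := qform 1%:M y / v - ln (mdens G y) - logdet G.

Lemma dens_gt0 G c y : 0 < dens G c y. Proof. exact: expR_gt0. Qed.

Lemma measurable_dens d (U : measurableType d) (G : U -> 'M[R[i]]_(p, k))
    (c : U -> 'cV[R[i]]_k) (y : U -> 'cV[R[i]]_p) :
  measurable_fun setT G -> measurable_fun setT c -> measurable_fun setT y ->
  measurable_fun setT (fun x => dens (G x) (c x) (y x)).
Proof.
move=> mG mc my; apply: measurableT_comp => //; apply: measurable_funM => //.
apply: measurable_funB; apply: measurable_fun_qform => //.
by apply: measurable_addmx => //; apply: measurable_oppmx; exact: measurable_mulmx.
Qed.

Lemma measurable_mdens d (U : measurableType d) (G : U -> 'M[R[i]]_(p, k))
    (y : U -> 'cV[R[i]]_p) :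
  measurable_fun setT G -> measurable_fun setT y ->
  measurable_fun setT (fun x => mdens (G x) (y x)).
Proof.
move=> mG my; apply: (measurableT_comp (fine_measurable measurableT)).
apply: (@measurable_fun_fubini_tonelli_F _ _ _ _ _ (gaussian_matrix 1 k 1)
  (fun xc => (dens (G xc.1) xc.2 (y xc.1))%:E)).
  by apply/measurable_EFinP; apply: measurable_dens => //; exact: measurableT_comp.
by move=> xc; rewrite lee_fin ltW// dens_gt0.
Qed.

(** The factor exp (|y|^2 / v) does not depend on c, and the rest is [gaussian_smoothing]. One pair
    (T, e) serves every output y. *)
Lemma mdensP G : exists (T : 'M[R[i]]_p) (e : R),
  [/\ T^H = T, T *m gram v G = 1%:M, 0 < e, \det (gram v G) = e%:C &
  forall y, (\int[gaussian_matrix 1 k 1]_c (dens G c y)%:E = (mdens G y)%:E)%E /\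
    mdens G y = e^-1 * expR ((qform 1%:M y - qform T y) / v)].
Proof.
have [T [e [TT TS e0 dS I]]] := gaussian_smoothing v0 G.
have H y : (\int[gaussian_matrix 1 k 1]_c (dens G c y)%:E =
    (e^-1 * expR ((qform 1%:M y - qform T y) / v))%:E)%E.
  rewrite ge0_integral_gaussian_col//; first last.
  - by move=> c; rewrite lee_fin ltW// dens_gt0.
  - by apply/measurable_EFinP; apply: measurable_dens.
  transitivity (\int[iid_law (cnormal 1) k]_u ((expR (qform 1%:M y / v))%:E *
     (expR (- qform 1%:M (y - G *m (\col_i tnth u i)) / v))%:E))%E.
    apply: eq_integral => u _; rewrite -EFinM -expRD; congr (expR _)%:E.
    by rewrite -mulrDl.
  rewrite ge0_integralZl//; last exact: measurable_smoothed.
  by rewrite I -EFinM mulrCA -expRD -mulrDl.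
by exists T, e; split => // y; rewrite /mdens H.
Qed.

Lemma integral_dens G y :
  (\int[gaussian_matrix 1 k 1]_c (dens G c y)%:E = (mdens G y)%:E)%E.
Proof. by have [T [e [_ _ _ _ /(_ y)[]]]] := mdensP G. Qed.

Lemma mdens_gt0 G y : 0 < mdens G y.
Proof.
have [T [e [_ _ e0 _ /(_ y)[_ ->]]]] := mdensP G.
by rewrite mulr_gt0 ?expR_gt0// invr_gt0.
Qed.

Lemma score_gt0 G c y : 0 < score G c y.
Proof. by rewrite divr_gt0 ?dens_gt0// mdens_gt0. Qed.

Lemma measurable_score d (U : measurableType d) (G : U -> 'M[R[i]]_(p, k))
    (c : U -> 'cV[R[i]]_k) (y : U -> 'cV[R[i]]_p) :
  measurable_fun setT G -> measurable_fun setT c -> measurable_fun setT y ->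
  measurable_fun setT (fun x => score (G x) (c x) (y x)).
Proof.
move=> mG mc my.
(* The division becomes a product with [expR (- ln _)], whose measurability follows by
   composition. *)
rewrite (_ : (fun x => _) = (fun x => dens (G x) (c x) (y x) * expR (- ln (mdens (G x) (y x))))).
  apply: measurable_funM; first exact: measurable_dens.
  apply: measurableT_comp => //; apply: measurableT_comp => //.
  by apply: measurableT_comp => //; exact: measurable_mdens.
by apply/funext => x; rewrite expRN lnK// posrE mdens_gt0.
Qed.

Lemma integral_score G y : (\int[gaussian_matrix 1 k 1]_c (score G c y)%:E = 1)%E.
Proof.
under eq_integral do rewrite EFinM.
rewrite ge0_integralZr//.
- by rewrite integral_dens -EFinM mulfV// gt_eqF// mdens_gt0.
- by apply/measurable_EFinP; apply: measurable_dens.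
- by move=> c _; rewrite lee_fin ltW// dens_gt0.
- by rewrite lee_fin invr_ge0 ltW// mdens_gt0.
Qed.

(** At the output 0 the exponential factors disappear and the marginal density is the inverse of the
    determinant. Measurability and sign of [logdet] are thereby read off an integral instead of a
    determinant. *)
Lemma logdetE G : logdet G = - ln (mdens G 0).
Proof.
have [T [e [_ _ e0 de /(_ 0)[_ ->]]]] := mdensP G; rewrite /logdet de /=.
have q0 (S : 'M[R[i]]_p) : qform S 0 = 0 by rewrite /qform /sform mulmx0 mxE.
by rewrite !q0 subrr mul0r expR0 mulr1 lnV ?opprK// posrE.
Qed.

Lemma measurable_logdet : measurable_fun setT logdet.
Proof.
rewrite (_ : logdet = (fun G => - ln (mdens G 0))).
  apply: measurableT_comp => //; apply: measurableT_comp => //.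
  exact: measurable_mdens.
by apply/funext => G; exact: logdetE.
Qed.

(** At the output 0 the density of every signal is at most 1, hence so is its mean. *)
Lemma logdet_ge0 G : 0 <= logdet G.
Proof.
rewrite logdetE oppr_ge0; apply: ln_le0.
rewrite -lee_fin -integral_dens -(integral_probability_cst (gaussian_matrix 1 k 1) 1).
apply: ge0_le_integral => //.
- by move=> c _; rewrite lee_fin ltW// dens_gt0.
- by apply/measurable_EFinP; apply: measurable_dens.
move=> c _; rewrite lee_fin -expR0 ler_expR sub0r ler_pdivrMr// mul0r subr_le0.
by rewrite [leLHS](_ : _ = 0) ?qform1_ge0// /qform /sform mulmx0 mxE.
Qed.

Lemma energyE G : exists T : 'M[R[i]]_p, [/\ T^H = T, T *m gram v G = 1%:M &
  forall y, energy G y = qform T y / v].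
Proof.
have [T [e [TT TS e0 de mE]]] := mdensP G; exists T; split => // y.
rewrite /energy /logdet de (mE y).2 lnM ?posrE ?expR_gt0 ?invr_gt0// expRK lnV ?posrE//=.
by ring.
Qed.

Lemma energy_ge0 G y : 0 <= energy G y.
Proof.
have [T [TT TS ->]] := energyE G.
by rewrite divr_ge0 ?(ltW v0)//; exact: qform_inv_gram_ge0 TS.
Qed.

Lemma measurable_energy d (U : measurableType d) (G : U -> 'M[R[i]]_(p, k))
    (y : U -> 'cV[R[i]]_p) :
  measurable_fun setT G -> measurable_fun setT y ->
  measurable_fun setT (fun x => energy (G x) (y x)).
Proof.
move=> mG my; apply: measurable_funB; last exact: (measurableT_comp measurable_logdet).
apply: measurable_funB.
  by apply: measurable_funM => //; exact: measurable_fun_qform.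
by apply: measurableT_comp => //; exact: measurable_mdens.
Qed.

Lemma ln_scoreE G c y :
  ln (score G c y) = logdet G + energy G y - qform 1%:M (y - G *m c) / v.
Proof.
rewrite /score ln_div ?posrE ?dens_gt0 ?mdens_gt0// expRK /energy mulrBl.
ring.
Qed.

End definitions.

Local Open Scope ereal_scope.

Lemma integral_noise_energy p :
  \int[gaussian_matrix v p 1]_z (qform 1%:M z / v)%:E = p%:R%:E.
Proof.
under eq_integral do rewrite EFinM.
rewrite ge0_integralZr//; first last.
- by rewrite lee_fin invr_ge0 ltW.
- by move=> z _; rewrite lee_fin qform1_ge0.
- by apply/measurable_EFinP; apply: measurable_fun_qform.
rewrite ge0_integral_gaussian_col//; first last.
- by move=> z; rewrite lee_fin qform1_ge0.
- by apply/measurable_EFinP; apply: measurable_fun_qform.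
have := integral_qform v0 1%:M 0 (conjmxT1 R p) (@qform1_ge0 _ p).
under eq_integral do rewrite mul1mx add0r.
move=> ->; rewrite -EFinM sum_qform_col conjmxT1 !mulmx1 mxtrace1.
rewrite (_ : qform 1%:M 0 = 0)%R ?/qform /sform ?mulmx0 ?mxE//= add0r.
rewrite mulrAC mulfV ?gt_eqF// mul1r; congr (_%:E).
by rewrite -(rmorph_nat (real_complex R)).
Qed.

(** With T the inverse of [gram v G], the signal contributes tr (T G G^H) / v and the noise tr T;
    they sum to the trace of T times [gram v G], which is p. *)
Lemma integral_output_energy p k (G : 'M[R[i]]_(p, k)) :
  \int[gaussian_matrix 1 k 1]_c \int[gaussian_matrix v p 1]_z
    (energy G (G *m c + z))%:E = p%:R%:E.
Proof.
have [T [TT TS TE]] := energyE G.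
have T0 y : (0 <= qform T y)%R by exact: qform_inv_gram_ge0 TS.
have mq d (U : measurableType d) (f : U -> 'cV[R[i]]_p) : measurable_fun setT f ->
    measurable_fun setT (fun x => (qform T (f x))%:E).
  by move=> mf; apply/measurable_EFinP; exact: measurable_fun_qform.
transitivity (\int[gaussian_matrix 1 k 1]_c
    ((qform T (G *m c))%:E * (v^-1)%:E + (complex.Re (\tr T))%:E)).
  apply: eq_integral => c _.
  under eq_integral do rewrite TE EFinM.
  rewrite ge0_integralZr//; first last.
  - by rewrite lee_fin invr_ge0 ltW.
  - by move=> z _; rewrite lee_fin.
  - by apply: mq; exact: measurable_addmx.
  rewrite ge0_integral_gaussian_col//; first last.
  - by move=> z; rewrite lee_fin.
  - by apply: mq; exact: measurable_addmx.
  have := integral_qform v0 1%:M (G *m c) TT T0.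
  under eq_integral do rewrite mul1mx.
  move=> ->; rewrite sum_qform_col conjmxT1 !mulmx1 -!EFinM -EFinD; congr (_%:E).
  by rewrite mulrDl; congr (_ + _)%R; rewrite mulrAC mulfV ?gt_eqF// mul1r.
have trT0 : (0 <= complex.Re (\tr T))%R.
  have := sum_qform_col T 1%:M; rewrite conjmxT1 !mulmx1 => <-.
  by apply: sumr_ge0 => j _; exact: T0.
have mTG : measurable_fun setT (fun c => (qform T (G *m c))%:E).
  by apply: mq; exact: measurable_mulmx.
rewrite ge0_integralD//; first last.
- by apply: emeasurable_funM.
- by move=> c _; rewrite mule_ge0// lee_fin ?T0// invr_ge0 ltW.
rewrite integral_probability_cst ge0_integralZr//; first last.
- by rewrite lee_fin invr_ge0 ltW.
- by move=> z _; rewrite lee_fin.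
rewrite ge0_integral_gaussian_col//; last by move=> z; rewrite lee_fin.
have := integral_qform (@ltr01 R) G 0 TT T0.
under eq_integral do rewrite add0r.
move=> ->; rewrite (_ : qform T 0 = 0)%R ?/qform /sform ?mulmx0 ?mxE//= add0r mul1r.
rewrite sum_qform_col -EFinM -EFinD; congr (_%:E).
have := congr1 (fun M : 'M[R[i]]_p => complex.Re (\tr M)) TS.
rewrite mulmxDr mulmx1 -scalemxAr linearD linearZ /= mxtrace1 raddfD/= Re_mul_real.
by rewrite addrC mulrC -(rmorph_nat (real_complex R)).
Qed.

(** Changes the variable of integration from the noise to the output while keeping the noise law as
    reference, so that different [G c] can be compared. *)
Lemma ge0_integral_output p k (G : 'M[R[i]]_(p, k))
    (F : 'cV[R[i]]_k * 'cV[R[i]]_p -> \bar R) :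
  measurable_fun setT F -> (forall x, 0 <= F x) ->
  \int[gaussian_matrix 1 k 1]_c \int[gaussian_matrix v p 1]_z F (c, (G *m c + z)%R) =
  \int[gaussian_matrix 1 k 1]_c \int[gaussian_matrix v p 1]_y (F (c, y) * (dens G c y)%:E).
Proof.
move=> mF F0; apply: eq_integral => c _.
rewrite (@ge0_integral_gaussian_col_shift _ _ v0 p (G *m c) (fun y => F (c, y)))//.
exact: (measurableT_comp mF).
Qed.

End score.

(** * Relative entropy and conditional laws *)

Section integral_inequalities.
Local Open Scope ereal_scope.
Context d (T : measurableType d) (R : realType) (mu : {measure set T -> \bar R}).
Implicit Types f g : T -> \bar R.

Import HBNNSimple.

(* No measurability is assumed of f and g: divergences of conditional laws are not
   known to be measurable functions of the condition. *)
Lemma ge0_ae_le_integral_nonmeasurable f g (N : set T) :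
  measurable N -> mu N = 0 -> (forall x, 0 <= f x) -> (forall x, 0 <= g x) ->
  (forall x, ~ N x -> f x <= g x) -> \int[mu]_x f x <= \int[mu]_x g x.
Proof.
move=> mN N0 f0 g0 fg; rewrite !ge0_integralE// !patch_setT.
apply: ub_ereal_sup => _ [h hf <-].
(* A simple minorant of [f], set to 0 on [N], is a simple minorant of [g] with the same integral;
   the integral is a supremum over such functions even without measurability. *)
pose h' := proj_nnsfun h (measurableC mN).
suff <- : sintegral mu h' = sintegral mu h.
  apply: ereal_sup_ubound; exists h' => // x /=; rewrite mindicE.
  case: (boolP (x \in ~` N)) => [|_]; last by rewrite mulr0.
  by rewrite inE => /= Nx; rewrite mulr1 (le_trans (hf x))// fg.
rewrite -!integralT_nnsfun; apply: ae_eq_integral => //.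
- exact/measurable_EFinP.
- exact/measurable_EFinP.
exists N; split => // x /= /not_implyP[_]; apply: contra_notP => Nx.
by rewrite mindicE mem_set// mulr1.
Qed.

Lemma ge0_ae_eq_integral_nonmeasurable f g (N : set T) :
  measurable N -> mu N = 0 -> (forall x, 0 <= f x) -> (forall x, 0 <= g x) ->
  (forall x, ~ N x -> f x = g x) -> \int[mu]_x f x = \int[mu]_x g x.
Proof.
move=> mN N0 f0 g0 fg; apply/eqP; rewrite eq_le; apply/andP; split;
  by apply: (ge0_ae_le_integral_nonmeasurable mN N0) => // x /fg ->.
Qed.

(** Only [f] is integrable: the negative part of [g] is below that of [f], while its positive part
    may have an infinite integral. *)
Lemma le_integral_of_integrable f g : mu.-integrable setT f -> measurable_fun setT g ->
  (forall x, f x <= g x) -> \int[mu]_x f x <= \int[mu]_x g x.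
Proof.
move=> /integrableP[mf fi] mg fg; rewrite integralE [leRHS]integralE; apply: leeB.
  apply: ge0_le_integral => //; [exact: measurable_funepos|exact: measurable_funepos|].
  by move=> x _; rewrite !funeposE; apply: le_max2 => //; exact: fg.
apply: ge0_le_integral => //; [exact: measurable_funeneg|exact: measurable_funeneg|].
by move=> x _; rewrite !funenegE; apply: le_max2 => //; rewrite leeN2.
Qed.

End integral_inequalities.

Section relative_entropy.
Local Open Scope ereal_scope.
Context d (T : measurableType d) (R : realType).
Implicit Types mu nu : probability T R.

Lemma log2E (x : R) : log2 x = ((ln 2)^-1 * ln x)%R.
Proof. by rewrite /log2 mulrC. Qed.

Lemma ln2_gt0 : (0 < ln 2 :> R)%R.
Proof. by rewrite ln_gt0// ltr1n. Qed.

Lemma measurable_log2 d' (U : measurableType d') (f : U -> R) :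
  measurable_fun setT f -> measurable_fun setT (fun x => log2 (f x)).
Proof.
by move=> mf; apply: measurable_funM => //; exact: (measurableT_comp (@measurable_ln R)).
Qed.

(** Two densities agree [nu]-almost everywhere, hence [mu]-almost everywhere by domination, so an
    explicit density can replace the chosen Radon-Nikodym derivative. *)
Lemma relative_entropyE mu nu (h : T -> R) :
  measurable_fun setT h -> (forall x, (0 <= h x)%R) ->
  (forall A, measurable A -> mu A = \int[nu]_(x in A) (h x)%:E) ->
  relative_entropy mu nu = \int[mu]_x (log2 (h x))%:E.
Proof.
move=> mh h0 muE.
have dom : mu `<< nu.
  by apply/null_content_dominatesP => A mA nuA; rewrite muE// null_set_integral//;
    apply/measurable_EFinP; exact: measurable_funTS.
have domc : charge_of_finite_measure mu `<< nu by exact: dom.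
rewrite /relative_entropy asboolT//.
set r := Radon_Nikodym _ _.
have ri : nu.-integrable setT r by exact: Radon_Nikodym_integrable.
have rh : ae_eq nu setT r (EFin \o h).
  apply: integral_ae_eq => //; first exact/measurable_EFinP.
  by move=> E _ mE; rewrite -Radon_Nikodym_integral//= -muE.
have mr : measurable_fun setT r by exact: measurable_int ri.
apply: ae_eq_integral => //.
- apply/measurable_EFinP; apply: measurable_log2.
  exact: (measurableT_comp (fine_measurable measurableT)).
- by apply/measurable_EFinP; exact: measurable_log2.
apply: (null_dominates_ae_eq _ dom) => //.
have [N [mN N0 sN]] := rh; exists N; split => // x /= /not_implyP[_ xE].
by apply: sN => /= /(_ I) rE; apply: xE; rewrite rE.
Qed.

Section image_integral.
Context d' (O : measurableType d') (rho : probability O R) (X : O -> T).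
Hypothesis mX : measurable_fun setT X.
Variable mu : probability T R.
Hypothesis muE : forall A, measurable A -> mu A = rho (X @^-1` A).

Lemma ge0_integral_image (F : T -> \bar R) :
  measurable_fun setT F -> (forall x, 0 <= F x) ->
  \int[mu]_x F x = \int[rho]_w F (X w).
Proof.
move=> mF F0; rewrite -(ge0_integral_image_law rho mX mF F0).
by apply: eq_measure_integral => A mA _; exact: muE.
Qed.

Lemma integral_image (F : T -> \bar R) :
  measurable_fun setT F -> \int[mu]_x F x = \int[rho]_w F (X w).
Proof.
move=> mF; rewrite integralE [RHS]integralE; congr (_ - _).
  rewrite ge0_integral_image//; last exact: measurable_funepos.
  by apply: eq_integral => w _; rewrite !funeposE.
rewrite ge0_integral_image//; last exact: measurable_funeneg.
by apply: eq_integral => w _; rewrite !funenegE.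
Qed.

End image_integral.

(* Gibbs' inequality, from [ln (s / h) <= s / h - 1] with [h] the density of [mu].
   The lower bound [g] may use variables that [X] forgets. *)
Lemma relative_entropy_ge d' (O : measurableType d') (rho : probability O R)
    (X : O -> T) mu nu (s : T -> R) (g : O -> R) : measurable_fun setT X ->
  (forall A, measurable A -> mu A = rho (X @^-1` A)) ->
  measurable_fun setT s -> (forall x, (0 < s x)%R) ->
  \int[nu]_x (s x)%:E <= 1 -> rho.-integrable setT (EFin \o g) ->
  (forall w, (g w <= log2 (s (X w)))%R) ->
  \int[rho]_w (g w)%:E <= relative_entropy mu nu.
Proof.
move=> mX muX ms s0 s1 gi gs.
have [dom|ndom] := pselect (mu `<< nu); last first.
  by rewrite /relative_entropy asboolF// leey.
pose f := Radon_Nikodym_SigmaFinite.f mu nu.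
have f0 x : 0 <= f x by exact: Radon_Nikodym_SigmaFinite.f_ge0.
have ff x : f x \is a fin_num by exact: Radon_Nikodym_SigmaFinite.f_fin_num.
have mf : measurable_fun setT f.
  exact: measurable_int (Radon_Nikodym_SigmaFinite.f_integrable dom).
pose h x := fine (f x).
have mh : measurable_fun setT h by exact: (measurableT_comp (fine_measurable measurableT)).
have h0 x : (0 <= h x)%R by exact: fine_ge0.
have muE A : measurable A -> mu A = \int[nu]_(x in A) (h x)%:E.
  move=> mA; rewrite (Radon_Nikodym_SigmaFinite.f_integral dom)//.
  by apply: eq_integral => x _; rewrite /h fineK.
have ml : measurable_fun setT (fun x => (log2 (h x))%:E).
  by apply/measurable_EFinP; exact: measurable_log2.
rewrite (relative_entropyE mh h0 muE) (integral_image mX muX ml).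
(* This is s / h where h is positive. Where h = 0 the convention [ln 0 = 0] gives t = s, and the
   product t h is still at most s, which is all that the bound on the mean of t requires. *)
pose t x := (s x * expR (- ln (h x)))%R.
have t0 x : (0 <= t x)%R by rewrite mulr_ge0 ?expR_ge0// ltW.
have mt : measurable_fun setT t.
  apply: measurable_funM => //; apply: measurableT_comp => //.
  by apply: measurableT_comp => //; exact: (measurableT_comp (@measurable_ln R)).
have t1 : \int[rho]_w (t (X w))%:E <= 1.
  rewrite -(ge0_integral_image mX muX (F := EFin \o t))//; last exact/measurable_EFinP.
  rewrite (ge0_integral_density mh h0 muE)//; last exact/measurable_EFinP.
  apply: le_trans s1; apply: ge0_le_integral => //.
  - by move=> x _; rewrite mule_ge0// lee_fin.
  - by apply: emeasurable_funM; exact/measurable_EFinP.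
  - exact/measurable_EFinP.
  - move=> x _; rewrite /= -EFinM lee_fin /t.
    have [hx0|hx0] := ltP 0%R (h x).
      by rewrite expRN lnK ?posrE// mulfVK// gt_eqF.
    by rewrite (@le_anti _ _ (h x) 0%R) ?hx0 ?h0// mulr0 ltW.
have mtX : measurable_fun setT (t \o X) by exact: measurableT_comp.
have ti : rho.-integrable setT (EFin \o (t \o X)).
  apply/integrableP; split; first exact/measurable_EFinP.
  under eq_integral do rewrite /= ger0_norm//.
  by rewrite (le_lt_trans t1)// ltry.
have oi : rho.-integrable setT (EFin \o cst 1%R) by exact: finite_measure_integrable_cst.
have ki : rho.-integrable setT (fun w => ((ln 2)^-1 * (t (X w) - 1))%:E).
  have -> : (fun w => ((ln 2)^-1 * (t (X w) - 1))%:E) =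
      (fun w => ((ln 2)^-1)%:E * ((EFin \o (t \o X)) w - (EFin \o cst 1%R) w)).
    by apply/funext => w; rewrite /= -EFinB -EFinM.
  by apply: integrableZl => //; exact: integrableB.
have k0 : \int[rho]_w ((ln 2)^-1 * (t (X w) - 1))%:E <= 0.
  under eq_integral do rewrite EFinM.
  rewrite integralZl//; last exact: (integrableB measurableT ti oi).
  rewrite pmule_rle0 ?lte_fin ?invr_gt0 ?ln2_gt0//.
  under eq_integral do rewrite EFinB.
  by rewrite (integralB measurableT ti oi) integral_probability_cst sube_le0.
(* The subtracted function majorizes log2 s - log2 h and has nonpositive mean: subtracting it raises
   the integral, and brings [g] below log2 h pointwise. *)
apply: (@le_trans _ _ (\int[rho]_w ((g w)%:E - ((ln 2)^-1 * (t (X w) - 1))%:E))).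
  by rewrite (integralB measurableT gi ki) -[leLHS]sube0; apply: leeB.
apply: le_integral_of_integrable.
- exact: (integrableB measurableT gi ki).
- exact: (measurableT_comp ml mX).
- move=> w; rewrite -EFinB lee_fin; apply: (@le_trans _ _ (log2 (s (X w)) - (ln 2)^-1 * (t (X w) - 1))%R).
    by rewrite lerD2r.
  rewrite !log2E -mulrBr ler_wpM2l ?invr_ge0 ?(ltW ln2_gt0)//.
  have := expR_ge1Dx (ln (s (X w)) - ln (h (X w))).
  by rewrite expRD lnK ?posrE// -/(t (X w)); lra.
Qed.

(** Gibbs' bound with the constant test function 1 and the lower bound 0. *)
Lemma relative_entropy_ge0 mu nu : 0 <= relative_entropy mu nu.
Proof.
have -> : 0 = \int[mu]_x (cst 0%R x : R)%:E by rewrite integral0.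
apply: (@relative_entropy_ge _ _ mu id _ _ (cst 1%R)) => //.
- by have -> : \int[nu]_x (cst 1%R x)%:E = 1 := integral_probability_cst nu 1.
- exact: integrable0.
- by move=> w; rewrite /= /log2 ln1 mul0r.
Qed.

End relative_entropy.

(** Phrased for any family S, not only for a sigma-algebra, so that it can be checked on the
    generating preimages of R[i], of matrices and of products, then passed to the generated
    sigma-algebra. *)
Definition countably_generated T (S : set (set T)) : Prop :=
  exists G : (set T)^nat, (forall n, <<s S >> (G n)) /\ S `<=` <<s range G >>.

Lemma countably_generated_preimage T d (U : measurableType d) (f : T -> U) :
  countably_generated (@measurable _ U) ->
  countably_generated (preimage_set_system setT f (@measurable _ U)).
Proof.
move=> [G [GS SG]]; exists (fun n => f @^-1` G n); split.
  move=> n; apply: sub_sigma_algebra; exists (G n); rewrite ?setTI//.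
  by have := GS n; rewrite sigma_algebra_id//; exact: sigma_algebra_measurable.
have -> : range (fun n => f @^-1` G n) = preimage_set_system setT f (range G).
  apply/seteqP; split => [_ [n _ <-]|_ [_ [n _ <-] <-]].
    by exists (G n); [exists n|rewrite setTI].
  by exists n => //; rewrite setTI.
by rewrite g_sigma_preimageE => _ [B SB <-]; exists B => //; exact: SG.
Qed.

Lemma countably_generated_bigcup T (I : countType) (S : I -> set (set T)) :
  (forall i, countably_generated (S i)) -> countably_generated (\bigcup_i S i).
Proof.
move=> /choice[G GP].
exists (fun n => if unpickle n is Some (i, m) then G i m else set0); split.
  move=> n; case: unpickle => [[i m]|]; last exact: sigma_algebra0.
  by apply: (@sub_sigma_algebra2 _ _ _ (S i)); [move=> A SA; exists i|exact: (GP i).1].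
move=> A [i _ /(GP i).2]; apply: smallest_sub; first exact: smallest_sigma_algebra.
move=> _ [m _ <-]; apply: sub_sigma_algebra; exists (pickle (i, m)) => //.
by rewrite pickleK.
Qed.

Lemma countably_generatedU T (S1 S2 : set (set T)) :
  countably_generated S1 -> countably_generated S2 -> countably_generated (S1 `|` S2).
Proof.
move=> c1 c2; have -> : S1 `|` S2 = \bigcup_(b : bool) (if b then S1 else S2).
  apply/seteqP; split => [A []|A [[] _]]; [exists true|exists false|left|right] => //.
by apply: countably_generated_bigcup => -[].
Qed.

Lemma countably_generated_sigma T (S : set (set T)) :
  countably_generated S -> countably_generated <<s S >>.
Proof.
move=> [G [GS SG]]; exists G; split => [n|].
  by rewrite sigma_algebra_id; [exact: GS|exact: smallest_sigma_algebra].
by apply: smallest_sub; first exact: smallest_sigma_algebra.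
Qed.

(** An open ray is the union of the rays with rational end points inside it. *)
Lemma countably_generated_real (R : realType) :
  countably_generated (@measurable _ R).
Proof.
pose G n : set R := if unpickle n is Some r then `]ratr r, +oo[%classic else set0.
exists G; split.
  move=> n; apply: sub_sigma_algebra; rewrite /G.
  by case: unpickle => [r|]; [exact: measurable_itv|exact: measurable0].
have -> : @measurable _ R = <<s @RGenOInfty.G R >> by exact: RGenOInfty.measurableE.
apply: smallest_sub; first exact: smallest_sigma_algebra.
move=> _ [x ->].
rewrite (_ : `]x, +oo[%classic = \bigcup_n (if unpickle n is Some r then
   if (x < ratr r :> R) then G n else set0 else set0)).
  apply: sigma_algebra_bigcup => n; rewrite /G; case E : unpickle => [r|]; last exact: sigma_algebra0.
  case: ifP => _; last exact: sigma_algebra0.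
  by apply: sub_sigma_algebra; exists n => //; rewrite /G E.
apply/seteqP; split => [y /=|y [n _]]; rewrite ?in_itv/= ?andbT.
  move=> /rat_in_itvoo[r]; rewrite in_itv/= => /andP[xr ry].
  move: (pickle r) (pickleK r) => n En; exists n; first by [].
  by rewrite /G En xr /= in_itv/= andbT.
rewrite /G; case: unpickle => [r|]//; case: ifP => // xr /=.
by rewrite !in_itv/= !andbT => ry; exact: lt_trans xr ry.
Qed.

Lemma countably_generated_complex (R : realType) :
  countably_generated (@measurable _ R[i]).
Proof.
by apply: countably_generated_sigma; apply: countably_generatedU;
  apply: countably_generated_preimage; exact: countably_generated_real.
Qed.

Lemma countably_generated_matrix d (U : measurableType d) m n :
  countably_generated (@measurable _ U) ->
  countably_generated (@measurable _ 'M[U]_(m, n)).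
Proof.
move=> cU; apply: countably_generated_sigma.
rewrite -[X in countably_generated X]/(\bigcup_(ij in [set: ('I_m * 'I_n)%type]) _).
by apply: countably_generated_bigcup => ij; exact: countably_generated_preimage.
Qed.

Lemma countably_generated_prod d1 d2 (U1 : measurableType d1) (U2 : measurableType d2) :
  countably_generated (@measurable _ U1) -> countably_generated (@measurable _ U2) ->
  countably_generated (@measurable _ (U1 * U2)%type).
Proof.
by move=> c1 c2; apply: countably_generated_sigma; apply: countably_generatedU;
  exact: countably_generated_preimage.
Qed.

(** * Uniqueness of regular conditional laws and its effect on divergences *)

Section regular_conditional_law_unique.
Local Open Scope ereal_scope.
Context {R : realType} {d} {T : measurableType d} (P : probability T R).
Context {dw dz} {TW : measurableType dw} {TZ : measurableType dz}.
Variables (W : T -> TW) (Z : T -> TZ) (mZ : measurable_fun setT Z).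
Hypothesis cW : countably_generated (@measurable _ TW).

(** For each event of a countable generating pi-system the two kernels agree almost everywhere;
    countably many null sets merge into one, off which the two probabilities coincide. *)
Lemma regular_conditional_law_unique (k k' : TZ -> probability TW R) :
  regular_conditional_law P W Z k -> regular_conditional_law P W Z k' ->
  exists N, [/\ measurable N, P N = 0 &
    forall w, ~ N w -> forall E, measurable E -> k (Z w) E = k' (Z w) E].
Proof.
move=> [mk kE] [mk' k'E]; have [G [GS SG]] := cW.
have mG n : measurable (G n).
  by have := GS n; rewrite sigma_algebra_id//; exact: sigma_algebra_measurable.
(* Finite intersections of the generators, indexed by codes of lists of integers, form a countable
   pi-system; integers that code no list give the whole space. *)
pose E_ n := if unpickle n is Some s then \bigcap_(i in [set` (s : seq nat)]) G i else setT.
have mE n : measurable (E_ n).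
  rewrite /E_; case: unpickle => [s|//]; rewrite bigcap_seq.
  by apply: bigsetI_measurable => i _; exact: mG.
pose mu := image_law P mZ.
have ki (l : TZ -> probability TW R) n : (forall E, measurable E -> measurable_fun setT (l ^~ E)) ->
    mu.-integrable setT (fun z => l z (E_ n)).
  move=> ml; apply/integrableP; split; first exact: ml.
  apply: (@le_lt_trans _ _ (\int[mu]_z 1)); last by rewrite integral_probability_cst ltry.
  apply: ge0_le_integral => //.
  - by apply: measurableT_comp => //; exact: ml.
  - by move=> z _; rewrite gee0_abs//; exact: probability_le1.
have kk' n : ae_eq mu setT (fun z => k z (E_ n)) (fun z => k' z (E_ n)).
  apply: integral_ae_eq => //; [exact: ki|exact: mk'|move=> D _ mD].
  rewrite ge0_integral_pushforward//; last exact: measurable_funTS (mk _ _).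
  rewrite ge0_integral_pushforward//; last exact: measurable_funTS (mk' _ _).
  by rewrite -(kE _ _ (mE n) mD) -(k'E _ _ (mE n) mD).
have [N [mN N0 sN]] : mu.-negligible (\bigcup_n [set z | k z (E_ n) <> k' z (E_ n)]).
  apply: negligible_bigcup => n; have [N [mN N0 sN]] := kk' n; exists N; split => //.
  by move=> z zn; apply: sN => /= /(_ I).
exists (Z @^-1` N); split => //.
  by rewrite -[X in measurable X]setTI; exact: mZ.
move=> w Nw E mE'.
apply: (measure_unique (range E_) (fun=> setT)) => //.
- apply/seteqP; split; last first.
    by apply: smallest_sub; [exact: sigma_algebra_measurable|move=> _ [n _ <-]].
  apply: (subset_trans SG); apply: smallest_sub; first exact: smallest_sigma_algebra.
  move=> _ [n _ <-]; apply: sub_sigma_algebra; exists (pickle [:: n]) => //.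
  rewrite /E_ pickleK; apply/seteqP; split => [x|x Gx i]; last by rewrite /= inE => /eqP ->.
  by apply; rewrite /= inE.
- move=> _ _ [n _ <-] [m _ <-]; rewrite /E_.
  case: unpickle => [s|]; last by rewrite setTI; exists m.
  case: unpickle => [t|]; last first.
    by rewrite setIT; exists (pickle s) => //; rewrite pickleK.
  exists (pickle (s ++ t)) => //; rewrite pickleK -bigcap_setU; congr bigcap => //.
  by apply/seteqP; split => i /=; rewrite mem_cat => /orP.
- move=> _; exists (pickle ([::] : seq nat)); first by [].
  by rewrite /E_ pickleK; apply/seteqP; split => // x _ i.
- by rewrite bigcup_const//; exists 0%N.
- move=> _ [n _ <-]; apply: contrapT => kn; apply: Nw; apply: sN.
  by exists n.
- by move=> _; rewrite (le_lt_trans (probability_le1 _ _))// ltry.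
Qed.

End regular_conditional_law_unique.

Section divergence_congr.
Local Open Scope ereal_scope.
Context (R : realType).

(** Agreement on measurable sets does not make the measures equal as objects, and the Radon-Nikodym
    derivative is chosen from these objects; a density for one pair is therefore shown to be a
    density for the other. *)
Lemma relative_entropy_congr d (T : measurableType d) (mu nu mu' nu' : probability T R) :
  (forall A, measurable A -> mu A = mu' A) -> (forall A, measurable A -> nu A = nu' A) ->
  relative_entropy mu nu = relative_entropy mu' nu'.
Proof.
move=> mm nn.
have domE : mu `<< nu -> mu' `<< nu'.
  move=> dom A A0 B mB BA; rewrite -mm//; apply: (dom A) => // C mC CA.
  by rewrite nn//; exact: A0.
have [dom|ndom] := pselect (mu `<< nu); last first.
  rewrite /relative_entropy asboolF// asboolF// => dom'; apply: ndom.
  move=> A A0 B mB BA; rewrite mm//; apply: (dom' A) => // C mC CA.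
  by rewrite -nn//; exact: A0.
pose f := Radon_Nikodym_SigmaFinite.f mu nu.
have f0 x : 0 <= f x by exact: Radon_Nikodym_SigmaFinite.f_ge0.
have ff x : f x \is a fin_num by exact: Radon_Nikodym_SigmaFinite.f_fin_num.
have mf : measurable_fun setT f.
  exact: measurable_int (Radon_Nikodym_SigmaFinite.f_integrable dom).
have mh : measurable_fun setT (fine \o f).
  exact: (measurableT_comp (fine_measurable measurableT)).
have h0 x : (0 <= (fine \o f) x)%R by exact: fine_ge0.
have muE A : measurable A -> mu A = \int[nu]_(x in A) ((fine \o f) x)%:E.
  move=> mA; rewrite (Radon_Nikodym_SigmaFinite.f_integral dom)//.
  by apply: eq_integral => x _; rewrite /= fineK.
rewrite (relative_entropyE mh h0 muE) (@relative_entropyE _ _ _ mu' nu' _ mh h0).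
  by apply: eq_measure_integral => A mA _; exact: mm.
move=> A mA; rewrite -mm// muE//.
by apply: eq_measure_integral => B mB _; exact: nn.
Qed.

Lemma divergence_from_product_congr d1 d2 (T1 : measurableType d1) (T2 : measurableType d2)
    (mu mu' : probability (T1 * T2)%type R) :
  (forall A, measurable A -> mu A = mu' A) ->
  divergence_from_product mu = divergence_from_product mu'.
Proof.
move=> mm; apply: relative_entropy_congr => // A mA.
apply: product_measure_unique => // B C mB mC.
etransitivity; first exact: product_measure1E.
congr (_ * _); rewrite /distribution /pushforward.
  by apply/esym/mm; rewrite -[X in measurable X]setTI; exact: measurable_fst.
by apply/esym/mm; rewrite -[X in measurable X]setTI; exact: measurable_snd.
Qed.

End divergence_congr.

(** * Generating pi-systems for products and tuples, and conditioning on an independent variable *)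

Section pi_generator.

(** Families on which the equality of two probabilities may be tested. Their stability under
    products and tuples reduces laws of nested tuples to products of events. *)
Definition pi_generator d (T : measurableType d) (C : set (set T)) : Prop :=
  [/\ C setT, setI_closed C, C `<=` measurable & measurable `<=` <<s C >>].

Lemma pi_generator_measurable d (T : measurableType d) :
  pi_generator (@measurable _ T).
Proof.
split; [by []|exact: measurableI|by []|exact: sub_sigma_algebra].
Qed.

Lemma eq_probability_pi d (T : measurableType d) (R : realType)
    (P Q : probability T R) (C : set (set T)) : pi_generator C ->
  (forall A, C A -> P A = Q A) -> forall A, measurable A -> P A = Q A.
Proof.
move=> [CT CI Cm mC] PQ A mA; apply: (measure_unique C (fun=> setT)) => //.
- apply/seteqP; split => //.
  by apply: smallest_sub => //; exact: sigma_algebra_measurable.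
- by rewrite bigcup_const//; exists 0%N.
- by move=> _; rewrite (le_lt_trans (probability_le1 _ _))// ltry.
Qed.

Lemma pi_generator_prod d1 d2 (T1 : measurableType d1) (T2 : measurableType d2)
    (C1 : set (set T1)) (C2 : set (set T2)) : pi_generator C1 -> pi_generator C2 ->
  pi_generator [set A `*` B | A in C1 & B in C2].
Proof.
move=> [C1T C1I C1m mC1] [C2T C2I C2m mC2]; split.
- by exists setT => //; exists setT => //; rewrite setXTT.
- move=> _ _ [A CA [B CB <-]] [A' CA' [B' CB' <-]].
  exists (A `&` A'); first exact: C1I.
  by exists (B `&` B'); [exact: C2I|rewrite setXI].
- by move=> _ [A CA [B CB <-]]; apply: measurableX; [exact: C1m|exact: C2m].
apply: smallest_sub; first exact: smallest_sigma_algebra.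
have sub d (U : measurableType d) (f : T1 * T2 -> U) (C : set (set U)) :
    measurable `<=` <<s C >> ->
    (forall A, C A -> <<s [set A `*` B | A in C1 & B in C2] >> (f @^-1` A)) ->
    preimage_set_system setT f measurable `<=` <<s [set A `*` B | A in C1 & B in C2] >>.
  move=> mC CA _ [A mA <-].
  have : preimage_set_system setT f <<s C >> (setT `&` f @^-1` A).
    by exists A => //; exact: mC.
  rewrite -(g_sigma_preimageE setT f C); apply: smallest_sub; first exact: smallest_sigma_algebra.
  by move=> _ [D CD <-]; rewrite setTI; exact: CA.
move=> D [].
  apply: (sub _ _ _ C1) => // A CA; apply: sub_sigma_algebra.
  by exists A => //; exists setT => //; rewrite setXT.
apply: (sub _ _ _ C2) => // B CB; apply: sub_sigma_algebra.
by exists setT => //; exists B => //; rewrite setTX.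
Qed.

Lemma pi_generator_tuple d (T : measurableType d) N (C : set (set T)) :
  pi_generator C ->
  pi_generator [set [set u : N.-tuple T | forall i, E i (tnth u i)] |
    E in [set E : 'I_N -> set T | forall i, C (E i)]].
Proof.
move=> [CT CI Cm mC]; split.
- by exists (fun=> setT) => //; apply/seteqP; split.
- move=> _ _ [E CE <-] [F CF <-]; exists (fun i => E i `&` F i).
    by move=> i; apply: CI.
  by apply/seteqP; split => [u EF|u [Eu Fu] i]; [split => i; have [] := EF i|split].
- move=> _ [E CE <-]; rewrite -bigsetI_finE; apply: bigsetI_measurable => i _.
  rewrite -[X in measurable X]setTI; apply: (measurable_tnth i) => //.
  exact: Cm.
apply: smallest_sub; first exact: smallest_sigma_algebra.
move=> D; rewrite -bigcup_seq => -[i _ [A mA <-]].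
have : preimage_set_system setT (fun u : N.-tuple T => tnth u i) <<s C >>
    (setT `&` (fun u => tnth u i) @^-1` A) by exists A => //; exact: mC.
rewrite -(g_sigma_preimageE setT (fun u : N.-tuple T => tnth u i) C).
apply: smallest_sub; first exact: smallest_sigma_algebra.
move=> _ [B CB <-]; rewrite setTI; apply: sub_sigma_algebra.
exists (fun j => if j == i then B else setT); first by move=> j /=; case: ifP.
apply/seteqP; split => [u /(_ i)|u Bu j]; first by rewrite eqxx.
by case: eqP => // ->.
Qed.

End pi_generator.

Section conditional_law_indep.
Local Open Scope ereal_scope.
Context (R : realType) d du dv dw (T : measurableType d) (U : measurableType du)
  (V : measurableType dv) (W : measurableType dw).
Variables (P : probability T R) (X : T -> U) (r : T -> V).
Hypotheses (mX : measurable_fun setT X) (mr : measurable_fun setT r).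
Variables (rho : probability V R) (Phi : U * V -> W).
Hypothesis mPhi : measurable_fun setT Phi.
Hypothesis indep : forall B, measurable B ->
  P ((fun w => (X w, r w)) @^-1` B) = (image_law P mX \x rho) B.

Lemma measurable_section (x : U) : measurable_fun setT (fun v => Phi (x, v)).
Proof. exact: measurableT_comp mPhi _. Qed.

(** Freezing: when [r] is independent of [X], a conditional law of [Phi (X, r)] is obtained by
    fixing X and leaving [r] its own law [rho]. *)
Lemma regular_conditional_law_indep :
  regular_conditional_law P (fun w => Phi (X w, r w)) X
    (fun x => image_law rho (measurable_section x)).
Proof.
have kE x E : image_law rho (measurable_section x) E = rho (xsection (Phi @^-1` E) x).
  rewrite image_lawE; congr (_ _); apply/seteqP; split => v /=; rewrite /xsection/=.
    by rewrite inE.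
  by rewrite inE.
have mE E : measurable E -> measurable (Phi @^-1` E).
  by move=> mE; rewrite -[X in measurable X]setTI; exact: mPhi.
split.
  move=> E /mE mE'; under eq_fun do rewrite kE.
  exact: measurable_fun_xsection.
move=> E G /mE mE' mG.
have mXG : measurable (X @^-1` G) by rewrite -[X in measurable X]setTI; exact: mX.
under eq_integral do rewrite kE.
rewrite -(@ge0_integral_pushforward _ _ _ _ _ _ mX P G (fun x => rho (xsection (Phi @^-1` E) x)))//; last first.
  by apply: measurable_funTS; exact: measurable_fun_xsection.
transitivity (P ((fun w => (X w, r w)) @^-1` ((G `*` setT) `&` (Phi @^-1` E)))).
  congr (_ _); apply/seteqP; split => w /=; tauto.
rewrite indep; last by apply: measurableI => //; exact: measurableX.
rewrite [RHS]integral_mkcond /product_measure1/=.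
apply: eq_integral => x _; rewrite patchE xsectionI.
case: ifPn => xG; first by rewrite in_xsectionX// setTI.
by rewrite notin_xsectionX// set0I measure0.
Qed.

End conditional_law_indep.

(** * Mutual information of the sparse channel *)

Local Open Scope sesquilinear_scope.

Section selection.
Context (R : realType).

(* 0/1 matrix turning the signal into the sparse vector, so that A x = (A S) c. *)
Definition sel (cs : construction) (n q : nat) (b : {set 'I_n}) :
    'M[R[i]]_(n, signal_dim cs n q) :=
  match cs with
  | Packed => \matrix_(i < n, k < q) ((i \in b) && (index i (enum b) == k))%:R
  | Masked => \matrix_(i < n, k < n) ((i == k) && (i \in b))%:R
  end.

Lemma sparse_vectorE cs n q (b : {set 'I_n}) c :
  sparse_vector cs b c = sel cs q b *m c.
Proof.
case: cs c => c; apply/matrixP => i j; rewrite !mxE (ord1 j).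
  rewrite big_mkcond; apply: eq_bigr => k _; rewrite mxE.
  by case: (_ && _); rewrite ?mul1r ?mul0r.
rewrite (bigD1 i)//= big1 ?addr0.
  by rewrite mxE eqxx/= mulrC.
by move=> k ki; rewrite mxE eq_sym (negbTE ki) mul0r.
Qed.

Lemma channel_outputE cs n p q (A : 'M[R[i]]_(p, n)) z (b : {set 'I_n}) c :
  channel_output cs A z b c = (A *m sel cs q b) *m c + z.
Proof. by rewrite /channel_output sparse_vectorE mulmxA. Qed.

(** Both constructions yield the diagonal indicator matrix of the support. As [logdet] sees G only
    through G G^H, they carry the same information. *)
Lemma sel_gram cs n q (b : {set 'I_n}) : #|b| = q ->
  sel cs q b *m (sel cs q b)^H =
  \matrix_(i < n, j < n) ((i == j) && (i \in b))%:R.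
Proof.
move=> bq; case: cs; apply/matrixP => i j; rewrite !mxE.
  have [ib|ib] := boolP (i \in b); last first.
    by rewrite andbF big1// => k _; rewrite !mxE (negbTE ib) mul0r.
  have iq : (index i (enum b) < q)%N by rewrite -bq cardE index_mem mem_enum.
  rewrite (bigD1 (Ordinal iq))//= big1 ?addr0; last first.
    move=> k ki; rewrite !mxE ib/= (_ : _ == _ = false) ?mul0r//.
    by apply: contraNF ki => /eqP e; apply/eqP/val_inj.
  rewrite !mxE ib eqxx/= mul1r rmorph_nat andbT.
  have [jb|jb] := boolP (j \in b) => /=.
    congr (_%:R); congr nat_of_bool.
    apply/eqP/eqP => [e|->//].
    by apply/esym; apply: (@index_inj _ i (enum b)); rewrite ?mem_enum//.
  by have -> : (i == j) = false by apply: contraNF jb => /eqP <-.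
rewrite (bigD1 i)//= big1 ?addr0; last first.
  by move=> k ki; rewrite !mxE eq_sym (negbTE ki) mul0r.
rewrite !mxE eqxx/= rmorph_nat -natrM mulnb; congr (_%:R); congr nat_of_bool.
by rewrite (eq_sym j); case: eqP => [->|_]; rewrite ?andbF// andbb.
Qed.

(** [f k] is the k-th element of the support. It serves as its own default in [nth], there being no
    canonical element of ['I_n]. *)
Lemma sel_packed n q (b : {set 'I_n}) p (A : 'M[R[i]]_(p, n)) (f : 'I_q -> 'I_n) :
  #|b| = q -> (forall k, f k = nth (f k) (enum b) k) ->
  A *m sel Packed q b = mxsub id f A.
Proof.
move=> bq fE; apply/matrixP => i k; rewrite !mxE.
have kb : (k < size (enum b))%N by rewrite -cardE bq.
have fb : f k \in b by rewrite -mem_enum fE mem_nth.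
have fi : index (f k) (enum b) = k by rewrite fE index_uniq ?enum_uniq.
rewrite (bigD1 (f k))//= big1 ?addr0.
  by rewrite mxE fb fi eqxx mulr1.
move=> j jk; rewrite mxE (_ : _ && _ = false) ?mulr0//.
apply: contraNF jk => /andP[jb /eqP e]; rewrite fE -e nth_index// mem_enum//.
Qed.

Lemma logdet_sel v cs n q p (b : {set 'I_n}) (A : 'M[R[i]]_(p, n)) : #|b| = q ->
  logdet v (A *m sel cs q b) = logdet v (A *m sel Packed q b).
Proof.
move=> bq; rewrite /logdet /gram; congr (ln (complex.Re (\det (_ + _ *: _)))).
by rewrite !conjmxT_mul !mulmxA -!(mulmxA A) !sel_gram.
Qed.

Lemma measurable_channel_output cs n p q d (U : measurableType d)
    (A : U -> 'M[R[i]]_(p, n)) (z : U -> 'cV[R[i]]_p) (b : U -> {set 'I_n})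
    (c : U -> 'cV[R[i]]_(signal_dim cs n q)) :
  measurable_fun setT A -> measurable_fun setT z -> measurable_fun setT b ->
  measurable_fun setT c ->
  measurable_fun setT (fun x => channel_output cs (A x) (z x) (b x) (c x)).
Proof.
move=> mA mz mb mc.
pose F (x : (U * {set 'I_n})%type) := (A x.1 *m sel cs q x.2) *m c x.1 + z x.1.
have mF : measurable_fun setT F.
  apply: measurable_fun_finset => s; rewrite /F/=.
  by apply: measurable_addmx => //; do 2 apply: measurable_mulmx => //.
rewrite (_ : (fun x => _) = F \o (fun x => (x, b x))); last first.
  by apply/funext => x; rewrite channel_outputE.
by apply: (measurableT_comp mF); exact: measurable_fun_pair.
Qed.

End selection.

Section mimo.
Context (R : realType).

Lemma mimo_informationE p q (snr : R) d (T : measurableType d) (P : probability T R)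
    (H : T -> 'M[R[i]]_(p, q)) :
  mimo_information P snr H =
  (\int[P]_w ((ln 2)^-1 * logdet (q%:R / snr) (H w))%:E)%E.
Proof.
rewrite /mimo_information unlock; apply: eq_integral => w _.
by rewrite log2E /logdet /gram invf_div.
Qed.

(** By [logdet_sel] only the packed construction matters; there A S is a selection of q columns of
    A, a Gaussian matrix of the same law as H. *)
Lemma integral_logdet_sel p n q cs (v : R) d (T : measurableType d) (P : probability T R)
    (A : T -> 'M[R[i]]_(p, n)) dH (TH : measurableType dH) (PH : probability TH R)
    (H : TH -> 'M[R[i]]_(p, q)) (b : {set 'I_n}) : 0 < v ->
  measurable_fun setT A -> iid_complex_normal P 1 A ->
  measurable_fun setT H -> iid_complex_normal PH 1 H -> #|b| = q ->
  (\int[P]_w (logdet v (A w *m sel R cs q b))%:E = \int[PH]_w (logdet v (H w))%:E)%E.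
Proof.
move=> v0 mA iA mH iH bq.
have fE (k : 'I_q) : exists x, x = nth x (enum b) k.
  have kb : (k < size (enum b))%N by rewrite -cardE bq.
  case: (enum b) kb => // a s kb; exists (nth a (a :: s) k).
  exact: set_nth_default.
have [f {}fE] := choice fE.
have fI : injective f.
  move=> k l /eqP; rewrite fE [X in _ == X]fE (set_nth_default (f l)) -?cardE ?bq//.
  by rewrite nth_uniq ?enum_uniq -?cardE ?bq// => /eqP /val_inj.
under eq_integral do rewrite logdet_sel// (sel_packed _ bq fE).
have mL : measurable_fun setT (fun G : 'M[R[i]]_(p, q) => (logdet v G)%:E).
  by apply/measurable_EFinP; exact: measurable_logdet.
have L0 (G : 'M[R[i]]_(p, q)) : (0 <= (logdet v G)%:E)%E.
  by rewrite lee_fin logdet_ge0.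
have mX : measurable_fun setT (fun w => mxsub id f (A w)).
  apply: measurable_fun_matrix => i j; under eq_fun do rewrite mxE.
  exact: measurable_fun_entry.
rewrite (ge0_integral_iid_complex_normal mX (iid_complex_normal_mxsub _ fI iA) mL L0)//.
by rewrite (ge0_integral_iid_complex_normal mH iH mL L0).
Qed.

End mimo.

Local Close Scope sesquilinear_scope.

Lemma ge0_integral_probability_cst d (T : measurableType d) (R : realType)
    (P : probability T R) (k : \bar R) : (0 <= k)%E -> (\int[P]_x k = k)%E.
Proof.
move=> k0; transitivity (\int[P]_x (k * 1))%E.
  by apply: eq_integral => x _; rewrite mule1.
by rewrite ge0_integralZl// integral_probability_cst mule1.
Qed.

(** * The Gaussian vector channel with a fixed matrix: joint law, density and divergence *)

Section joint_law.
Local Open Scope ereal_scope.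
Context (R : realType).
Variables (v : R) (v0 : (0 < v)%R) (p k : nat) (G : 'M[R[i]]_(p, k)).

Definition joint_map (zc : 'cV[R[i]]_p * 'cV[R[i]]_k) : 'cV[R[i]]_k * 'cV[R[i]]_p :=
  (zc.2, (G *m zc.2 + zc.1)%R).

Lemma measurable_joint_map : measurable_fun setT joint_map.
Proof.
apply: measurable_fun_pair => //; apply: measurable_addmx => //.
exact: measurable_mulmx.
Qed.

Variable mu : probability ('cV[R[i]]_k * 'cV[R[i]]_p)%type R.
Hypothesis muE : forall A, measurable A ->
  mu A = (gaussian_matrix v p 1 \x gaussian_matrix 1 k 1) (joint_map @^-1` A).

Lemma ge0_integral_joint (F : 'cV[R[i]]_k * 'cV[R[i]]_p -> \bar R) :
  measurable_fun setT F -> (forall x, 0 <= F x) ->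
  \int[mu]_x F x =
  \int[gaussian_matrix 1 k 1]_c \int[gaussian_matrix v p 1]_z F (c, (G *m c + z)%R).
Proof.
move=> mF F0; rewrite (ge0_integral_image measurable_joint_map muE mF F0).
by rewrite fubini_tonelli2//; exact: (measurableT_comp mF measurable_joint_map).
Qed.

Lemma ge0_integral_joint_fst (F : 'cV[R[i]]_k -> \bar R) :
  measurable_fun setT F -> (forall x, 0 <= F x) ->
  \int[mu]_x F x.1 = \int[gaussian_matrix 1 k 1]_c F c.
Proof.
move=> mF F0; rewrite (ge0_integral_joint (F := fun x => F x.1))//.
  by apply: eq_integral => c _; rewrite /= ge0_integral_probability_cst.
exact: (measurableT_comp mF).
Qed.

Lemma ge0_integral_joint_product (F : 'cV[R[i]]_k * 'cV[R[i]]_p -> \bar R) :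
  measurable_fun setT F -> (forall x, 0 <= F x) ->
  \int[distribution mu fst \x distribution mu snd]_x F x =
  \int[gaussian_matrix 1 k 1]_c' \int[gaussian_matrix 1 k 1]_c
    \int[gaussian_matrix v p 1]_z F (c', (G *m c + z)%R).
Proof.
move=> mF F0; rewrite ge0_integral_prod//.
have mF1 c' : measurable_fun setT (fun y => F (c', y)) by exact: (measurableT_comp mF).
transitivity (\int[distribution mu fst]_c' \int[mu]_x F (c', x.2)).
  by apply: eq_integral => c' _; rewrite (ge0_integral_distribution _ (mF1 c')).
rewrite ge0_integral_distribution.
- rewrite (ge0_integral_joint_fst (F := fun c' => \int[mu]_x F (c', x.2))).
  + apply: eq_integral => c' _; rewrite (ge0_integral_joint (F := fun x => F (c', x.2)))//.
    exact: (measurableT_comp (mF1 c')).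
  + apply: (@measurable_fun_fubini_tonelli_F _ _ _ _ _ mu (fun cx => F (cx.1, cx.2.2))) => //.
    apply: (measurableT_comp mF); apply: measurable_fun_pair => //.
    exact: (measurableT_comp measurable_snd).
  + by move=> c'; exact: integral_ge0.
- apply: (@measurable_fun_fubini_tonelli_F _ _ _ _ _ mu (fun cx => F (cx.1, cx.2.2))) => //.
  apply: (measurableT_comp mF); apply: measurable_fun_pair => //.
  exact: (measurableT_comp measurable_snd).
- by move=> c'; exact: integral_ge0.
Qed.

Let msc : measurable_fun setT (fun x : 'cV[R[i]]_k * 'cV[R[i]]_p => score v G x.1 x.2).
Proof. exact: measurable_score. Qed.

(** With the noise law as reference, the pair has density [dens] and the output has density [mdens];
    the score is their quotient. *)
Lemma joint_density A : measurable A ->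
  mu A = \int[distribution mu fst \x distribution mu snd]_(x in A) (score v G x.1 x.2)%:E.
Proof.
move=> mA; rewrite integral_mkcond.
pose I x := ((\1_A x : R)%:E * (score v G x.1 x.2)%:E).
have mI1 : measurable_fun setT (fun x => (\1_A x : R)%:E).
  by apply/measurable_EFinP; exact: measurable_indic.
have i0 x : 0 <= (\1_A x : R)%:E by rewrite lee_fin.
have mI : measurable_fun setT I by apply: emeasurable_funM => //; exact/measurable_EFinP.
have sc0 x : (0 <= (score v G x.1 x.2)%:E) by rewrite lee_fin ltW// score_gt0.
have I0 x : 0 <= I x by rewrite mule_ge0// lee_fin.
have mIc c' : measurable_fun setT (fun y => I (c', y)) by exact: (measurableT_comp mI).
transitivity (\int[distribution mu fst \x distribution mu snd]_x I x); last first.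
  apply: eq_integral => x _; rewrite patchE /I indicE.
  by case: ifP => _; rewrite ?mul1e ?mul0e.
rewrite ge0_integral_joint_product//.
have md : measurable_fun setT (fun cy : 'cV[R[i]]_k * 'cV[R[i]]_p => (dens v G cy.1 cy.2)%:E).
  by apply/measurable_EFinP; exact: measurable_dens.
have d0 c y : 0 <= (dens v G c y)%:E by rewrite lee_fin ltW// dens_gt0.
transitivity (\int[gaussian_matrix 1 k 1]_c' \int[gaussian_matrix v p 1]_y
   ((\1_A (c', y) : R)%:E * (dens v G c' y)%:E)).
  transitivity (\int[mu]_x (\1_A x : R)%:E); first by rewrite integral_indic// setIT.
  rewrite (ge0_integral_joint mI1 i0).
  exact: (ge0_integral_output v0 G mI1 i0).
apply: eq_integral => c' _.
have mIs : measurable_fun setT (fun x : 'cV[R[i]]_k * 'cV[R[i]]_p => I (c', x.2)).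
  exact: (measurableT_comp (mIc c') measurable_snd).
etransitivity; last by apply/esym; exact: (ge0_integral_output v0 G mIs (fun x => I0 _)).
pose J (x : 'cV[R[i]]_k * 'cV[R[i]]_p) := I (c', x.2) * (dens v G x.1 x.2)%:E.
have mJ : measurable_fun setT J by exact: emeasurable_funM.
have J0 x : 0 <= J x by rewrite mule_ge0.
(* Once the output is a variable with a fixed law, [c] and [y] can be exchanged; for fixed [y] the
   mean of [dens] over [c] is the denominator of the score. *)
have swapJ := fubini_tonelli (m1 := gaussian_matrix 1 k 1) (m2 := gaussian_matrix v p 1) J mJ J0.
etransitivity; last by apply/esym; exact: swapJ.
apply: eq_integral => y _.
have mdy : measurable_fun setT (fun c => (dens v G c y)%:E).
  by apply/measurable_EFinP; exact: measurable_dens.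
have Z := @ge0_integralZl _ _ _ (gaussian_matrix 1 k 1) setT measurableT _ mdy
  (I (c', y)) (fun c _ => d0 c y) (I0 _).
etransitivity; last by apply/esym; exact: Z.
rewrite integral_dens// /I -!EFinM -mulrA; congr (_ * _)%:E.
by rewrite /score mulfVK// gt_eqF// mdens_gt0.
Qed.

Lemma integral_joint_energy : \int[mu]_x (energy v G x.2)%:E = p%:R%:E.
Proof.
rewrite (ge0_integral_joint (F := fun x => (energy v G x.2)%:E)).
- exact: integral_output_energy.
- by apply/measurable_EFinP; exact: measurable_energy.
- by move=> x; rewrite lee_fin energy_ge0.
Qed.

Lemma measurable_noise : measurable_fun setT
  (fun x : 'cV[R[i]]_k * 'cV[R[i]]_p => qform 1%:M (x.2 - G *m x.1) / v)%R.
Proof.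
apply: measurable_funM => //; apply: measurable_fun_qform => //.
apply: measurable_addmx => //; apply: measurable_oppmx; exact: measurable_mulmx.
Qed.

Lemma integral_joint_noise :
  \int[mu]_x (qform 1%:M (x.2 - G *m x.1) / v)%:E = p%:R%:E.
Proof.
rewrite (ge0_integral_joint (F := fun x => (qform 1%:M (x.2 - G *m x.1) / v)%:E)).
- transitivity (\int[gaussian_matrix 1 k 1]_c (p%:R : R)%:E).
    apply: eq_integral => c _; rewrite -(integral_noise_energy v0).
    by apply: eq_integral => z _; rewrite /= addrAC subrr add0r.
  by rewrite integral_probability_cst.
- by apply/measurable_EFinP; exact: measurable_noise.
- by move=> x; rewrite lee_fin divr_ge0 ?qform1_ge0// ltW.
Qed.

Let log_scoreE : (fun x => (log2 (score v G x.1 x.2))%:E) =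
  (fun x : 'cV[R[i]]_k * 'cV[R[i]]_p =>
    ((ln 2)^-1)%:E * (((EFin \o cst (logdet v G)) x + (energy v G x.2)%:E)
   - (qform 1%:M (x.2 - G *m x.1) / v)%:E)).
Proof. by apply/funext => x; rewrite log2E ln_scoreE//= -EFinD -EFinB -EFinM. Qed.

Let integrable_energy : mu.-integrable setT (fun x => (energy v G x.2)%:E).
Proof.
apply/integrableP; split; first by apply/measurable_EFinP; exact: measurable_energy.
under eq_integral do rewrite /= ger0_norm ?energy_ge0//.
by rewrite integral_joint_energy ltry.
Qed.

Let integrable_noise :
  mu.-integrable setT (fun x => (qform 1%:M (x.2 - G *m x.1) / v)%:E).
Proof.
apply/integrableP; split; first by apply/measurable_EFinP; exact: measurable_noise.
under eq_integral do rewrite /= ger0_norm ?divr_ge0 ?qform1_ge0 ?(ltW v0)//.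
by rewrite integral_joint_noise ltry.
Qed.

Let integrable_sum : mu.-integrable setT (fun x => ((EFin \o cst (logdet v G)) x
  + (energy v G x.2)%:E) - (qform 1%:M (x.2 - G *m x.1) / v)%:E).
Proof.
apply: integrableB => //; apply: integrableD => //.
exact: finite_measure_integrable_cst.
Qed.

Lemma integrable_joint_log_score :
  mu.-integrable setT (fun x => (log2 (score v G x.1 x.2))%:E).
Proof. by rewrite log_scoreE; exact: integrableZl. Qed.

(** The energies of the output and of the noise both have mean p and cancel, so that only [logdet]
    remains. *)
Lemma integral_joint_log_score :
  \int[mu]_x (log2 (score v G x.1 x.2))%:E = ((ln 2)^-1 * logdet v G)%:E.
Proof.
have ci : mu.-integrable setT (EFin \o cst (logdet v G)).
  exact: finite_measure_integrable_cst.
rewrite log_scoreE integralZl// integralB//; last exact: integrableD.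
rewrite integralD// integral_joint_energy integral_joint_noise integral_probability_cst.
by rewrite addeK.
Qed.

Lemma divergence_joint : divergence_from_product mu = ((ln 2)^-1 * logdet v G)%:E.
Proof.
rewrite -integral_joint_log_score; apply: (relative_entropyE msc _ joint_density).
by move=> x; rewrite ltW// score_gt0.
Qed.

End joint_law.

Section uniform_support.
Context (R : realType) d (T : measurableType d) (P : probability T R) (n q : nat).
Variable (b : T -> {set 'I_n}).
Hypotheses (mb : measurable_fun setT b) (ub : uniform_support P q b).

Lemma ge0_integral_support (F : {set 'I_n} -> \bar R) : (forall s, (0 <= F s)%E) ->
  (\int[P]_w F (b w) = \sum_(s : {set 'I_n} | #|s| == q) (('C(n, q)%:R)^-1)%:E * F s)%E.
Proof.
move=> F0.
have mbs s : measurable (b @^-1` [set s]).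
  by rewrite -[X in measurable X]setTI; exact: mb.
transitivity (\int[P]_w \sum_(s : {set 'I_n}) (F s * (\1_(b @^-1` [set s]) w)%:E))%E.
  apply: eq_integral => w _; rewrite (bigD1 (b w))//= big1 ?adde0.
    by rewrite indicE mem_set// mule1.
  by move=> s sb; rewrite indicE memNset ?mule0//= => /esym/eqP; rewrite (negbTE sb).
rewrite ge0_integral_sum//; first last.
- by move=> s w _; rewrite mule_ge0// lee_fin.
- by move=> s; apply: emeasurable_funM => //; apply/measurable_EFinP; exact: measurable_indic.
rewrite [RHS]big_mkcond; apply: eq_bigr => s _.
rewrite ge0_integralZl//; last first.
  by apply/measurable_EFinP; exact: measurable_indic.
rewrite integral_indic// setIT.
transitivity (F s * (if #|s| == q then ('C(n, q)%:R)^-1 else 0)%:E)%E.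
  by congr (_ * _)%E; exact: ub.
rewrite muleC.
by case: ifP => // _; rewrite mul0e.
Qed.

Lemma entropy_uniform_support : (q <= n)%N -> entropy P b = log2 'C(n, q)%:R.
Proof.
move=> qn; rewrite /entropy.
have C0 : (0 < 'C(n, q)%:R :> R) by rewrite ltr0n bin_gt0.
under eq_bigr do rewrite ub.
rewrite (bigID (fun s : {set 'I_n} => #|s| == q))/= [X in _ + X]big1 ?addr0; last first.
  by move=> s /negbTE ->; rewrite /= mul0r.
rewrite (eq_bigr (fun=> - ('C(n, q)%:R^-1 * log2 'C(n, q)%:R))); last first.
  move=> s ->; rewrite /= /log2 lnV ?posrE//; ring.
rewrite sumr_const -[X in _ *+ X](_ : 'C(n, q) = _); last first.
  by rewrite -[in LHS](card_ord n) -card_draws; apply: eq_card => s; rewrite !inE.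
by rewrite mulNrn opprK -[LHS]mulr_natl mulrA mulfV ?mul1r// gt_eqF.
Qed.

End uniform_support.

(** * A score for an unknown support *)

Section mixture_score.
Context (R : realType).
Variables (cs : construction) (n p q : nat) (v : R).
Hypotheses (v0 : 0 < v) (qn : (q <= n)%N).
Local Notation k := (signal_dim cs n q).
Implicit Types (a : 'M[R[i]]_(p, n)) (c : 'cV[R[i]]_k) (y : 'cV[R[i]]_p).

(** An average of quotients, not the quotient of averages that would be the likelihood ratio of the
    mixed channel. It is a test function: of mean 1 over [c], and within the factor C(n, q) of each
    of its terms. *)
Definition mixture_score a c y : R :=
  ('C(n, q)%:R)^-1 * \sum_(s : {set 'I_n} | #|s| == q) score v (a *m sel R cs q s) c y.

Let C0 : (0 < 'C(n, q)%:R :> R). Proof. by rewrite ltr0n bin_gt0. Qed.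

Lemma mixture_score_ge a c y (s : {set 'I_n}) : #|s| == q ->
  ('C(n, q)%:R)^-1 * score v (a *m sel R cs q s) c y <= mixture_score a c y.
Proof.
move=> sq; rewrite ler_wpM2l ?invr_ge0 ?ler0n// (bigD1 s)//= lerDl.
by apply: sumr_ge0 => t _; rewrite ltW// score_gt0.
Qed.

Lemma exists_support : exists s : {set 'I_n}, #|s| == q.
Proof.
have : (0 < #|[set s : {set 'I_n} | #|s| == q]%SET|)%N.
  by rewrite card_draws card_ord bin_gt0.
by move=> /card_gt0P[s]; rewrite inE; exists s.
Qed.

Lemma mixture_score_gt0 a c y : 0 < mixture_score a c y.
Proof.
have [s sq] := exists_support; apply: lt_le_trans (mixture_score_ge a c y sq).
by rewrite mulr_gt0 ?invr_gt0// score_gt0.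
Qed.

Lemma measurable_mixture_score d (U : measurableType d) (a : U -> 'M[R[i]]_(p, n))
    (c : U -> 'cV[R[i]]_k) (y : U -> 'cV[R[i]]_p) :
  measurable_fun setT a -> measurable_fun setT c -> measurable_fun setT y ->
  measurable_fun setT (fun x => mixture_score (a x) (c x) (y x)).
Proof.
move=> ma mc my; apply: measurable_funM => //.
under eq_fun do rewrite big_mkcond.
apply: measurable_sum => s; case: (#|s| == q) => //.
by apply: measurable_score => //; exact: measurable_mulmx.
Qed.

Lemma sum_support (x : R) : \sum_(s : {set 'I_n} | #|s| == q) x = 'C(n, q)%:R * x.
Proof.
rewrite sumr_const -[X in _ *+ X](_ : 'C(n, q) = _) ?mulr_natl//.
by rewrite -[in LHS](card_ord n) -card_draws; apply: eq_card => s; rewrite !inE.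
Qed.

(** Every term has mean 1 for each fixed [a] and [y]. Only the law of the signal enters, so that the
    same fact bounds the score of a wrong codeword at the decoder. *)
Lemma integral_mixture_score a y :
  (\int[gaussian_matrix 1 k 1]_c (mixture_score a c y)%:E = 1)%E.
Proof.
have sc0 s c : (0 <= (score v (a *m sel R cs q s) c y)%:E)%E.
  by rewrite lee_fin ltW// score_gt0.
under eq_integral do rewrite EFinM -sumEFin.
have ms s : measurable_fun setT (fun c => (score v (a *m sel R cs q s) c y)%:E).
  by apply/measurable_EFinP; exact: measurable_score.
rewrite ge0_integralZl//; first last.
- by move=> c _; exact: sume_ge0.
- under eq_fun do rewrite sumEFin big_mkcond.
  apply/measurable_EFinP; apply: measurable_sum => s; case: (#|s| == q) => //.
  exact: measurable_score.
under eq_integral do rewrite -big_filter.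
rewrite ge0_integral_sum// big_filter.
under eq_bigr do rewrite integral_score//.
by rewrite sumEFin sum_support mulr1 -EFinM mulVf// gt_eqF.
Qed.

End mixture_score.

Section independent_inputs.
Local Open Scope ereal_scope.
Context (R : realType) d (T : measurableType d) (P : probability T R).
Context d1 d2 d3 d4 (T1 : measurableType d1) (T2 : measurableType d2)
  (T3 : measurableType d3) (T4 : measurableType d4).
Variables (X1 : T -> T1) (X2 : T -> T2) (X3 : T -> T3) (X4 : T -> T4).
Hypotheses (m1 : measurable_fun setT X1) (m2 : measurable_fun setT X2)
  (m3 : measurable_fun setT X3) (m4 : measurable_fun setT X4).
Hypothesis ind : mutually_independent P
  (tnth [tuple g_sigma_algebra_preimage X1; g_sigma_algebra_preimage X2;
               g_sigma_algebra_preimage X3; g_sigma_algebra_preimage X4]).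

Lemma independent4 E1 E2 E3 E4 :
  measurable E1 -> measurable E2 -> measurable E3 -> measurable E4 ->
  P (X1 @^-1` E1 `&` (X2 @^-1` E2 `&` (X3 @^-1` E3 `&` X4 @^-1` E4))) =
  P (X1 @^-1` E1) * (P (X2 @^-1` E2) * (P (X3 @^-1` E3) * P (X4 @^-1` E4))).
Proof.
move=> e1 e2 e3 e4.
have := ind (s := index_enum _)
  (E := tnth [tuple X1 @^-1` E1; X2 @^-1` E2; X3 @^-1` E3; X4 @^-1` E4]) (index_enum_uniq _).
rewrite !big_ord_recl !big_ord0 !(tnth_nth set0)/= setIT mule1; apply.
by case=> -[|[|[|[|]]]]// i _; rewrite !(tnth_nth set0)/=;
  [exists E1|exists E2|exists E3|exists E4]; rewrite ?setTI.
Qed.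

End independent_inputs.

Lemma measurable_fun_finset_fst d d' (U : measurableType d) (V : measurableType d')
    (I : finType) (F : {set I} * U -> V) :
  (forall s, measurable_fun setT (fun x => F (s, x))) -> measurable_fun setT F.
Proof.
move=> mF; have mF' : measurable_fun setT (fun x : U * {set I} => F (x.2, x.1)).
  exact: measurable_fun_finset.
rewrite (_ : F = (fun x => F (x.2, x.1)) \o (fun x => (x.2, x.1))); last first.
  by apply/funext => -[].
by apply: (measurableT_comp mF'); exact: measurable_fun_pair.
Qed.

Lemma integrable_probability_cst d (T : measurableType d) (R : realType)
    (P : probability T R) (t : R) : P.-integrable setT (EFin \o cst t).
Proof. exact: finite_measure_integrable_cst. Qed.

Section random_support.
Local Open Scope ereal_scope.
Context (R : realType) (n q : nat) (beta : probability {set 'I_n} R).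
Hypothesis ubeta : uniform_support beta q id.
Context dV (V : measurableType dV) (nu : probability V R).

Lemma ge0_integral_support_prod (F : {set 'I_n} * V -> \bar R) :
  measurable_fun setT F -> (forall x, 0 <= F x) ->
  \int[beta \x nu]_x F x =
  \sum_(s : {set 'I_n} | #|s| == q) (('C(n, q)%:R)^-1)%:E * \int[nu]_u F (s, u).
Proof.
move=> mF F0; rewrite ge0_integral_prod//.
apply: (ge0_integral_support (@measurable_id _ _ setT) ubeta (F := fun s => \int[nu]_u F (s, u))).
by move=> s; exact: integral_ge0.
Qed.

Variable F : {set 'I_n} * V -> R.
Hypotheses (mF : measurable_fun setT F)
  (Fi : forall s : {set 'I_n}, #|s| == q -> nu.-integrable setT (fun u => (F (s, u))%:E)).

Lemma integrable_support_prod : (beta \x nu).-integrable setT (EFin \o F).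
Proof.
apply/integrableP; split; first exact/measurable_EFinP.
rewrite ge0_integral_support_prod//; last first.
  by apply: measurableT_comp => //; exact/measurable_EFinP.
apply: lte_sum_pinfty => s /Fi /integrableP[_ fi].
by apply: lte_mul_pinfty => //; rewrite lee_fin invr_ge0.
Qed.

Lemma integral_support_prod : \int[beta \x nu]_x (F x)%:E =
  \sum_(s : {set 'I_n} | #|s| == q) (('C(n, q)%:R)^-1)%:E * \int[nu]_u (F (s, u))%:E.
Proof.
have mF' : measurable_fun setT (fun x => (F x)%:E) by exact/measurable_EFinP.
rewrite integralE (ge0_integral_support_prod (measurable_funepos mF') (fun=> funepos_ge0 _ _)).
rewrite (ge0_integral_support_prod (measurable_funeneg mF') (fun=> funeneg_ge0 _ _)).
have posE s : \int[nu]_u (fun x => (F x)%:E)^\+ (s, u) =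
    \int[nu]_u (fun u => (F (s, u))%:E)^\+ u.
  by apply: eq_integral => u _; rewrite !funeposE.
have negE s : \int[nu]_u (fun x => (F x)%:E)^\- (s, u) =
    \int[nu]_u (fun u => (F (s, u))%:E)^\- u.
  by apply: eq_integral => u _; rewrite !funenegE.
under eq_bigr do rewrite posE.
under [X in _ - X]eq_bigr do rewrite negE.
rewrite -fin_num_sumeN; last first.
  by move=> s /Fi fi; rewrite fin_numM// (integrable_neg_fin_num measurableT fi).
rewrite -big_split/=; apply: eq_bigr => s /Fi fi.
rewrite [X in _ = _ * X]integralE [RHS]muleBr//.
by apply: fin_num_adde_defr; exact: (integrable_pos_fin_num measurableT fi).
Qed.

End random_support.

Section mixture_divergence.
Local Open Scope ereal_scope.
Context (R : realType) (cs : construction) (n p q : nat) (v : R).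
Hypotheses (v0 : (0 < v)%R) (qn : (q <= n)%N).
Local Notation k := (signal_dim cs n q).
Variable beta : probability {set 'I_n} R.
Hypothesis ubeta : uniform_support beta q id.
Variable a : 'M[R[i]]_(p, n).

Definition output_map (x : {set 'I_n} * ('cV[R[i]]_p * 'cV[R[i]]_k)) :
    'cV[R[i]]_k * 'cV[R[i]]_p := (x.2.2, channel_output cs a x.2.1 x.1 x.2.2).

Lemma measurable_output_map : measurable_fun setT output_map.
Proof.
apply: measurable_fun_pair; first exact: (measurableT_comp measurable_snd).
apply: measurable_channel_output => //; first exact: (measurableT_comp measurable_fst).
exact: (measurableT_comp measurable_snd).
Qed.

Variable mu : probability ('cV[R[i]]_k * 'cV[R[i]]_p)%type R.
Hypothesis muE : forall A, measurable A ->
  mu A = (beta \x (gaussian_matrix v p 1 \x gaussian_matrix 1 k 1)) (output_map @^-1` A).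

Lemma ge0_integral_mixture_fst (F : 'cV[R[i]]_k -> \bar R) :
  measurable_fun setT F -> (forall x, 0 <= F x) ->
  \int[distribution mu fst]_c F c = \int[gaussian_matrix 1 k 1]_c F c.
Proof.
move=> mF F0; rewrite ge0_integral_distribution//.
rewrite (ge0_integral_image measurable_output_map muE (F := F \o fst)
  (measurableT_comp mF measurable_fst) (fun x => F0 x.1)).
rewrite ge0_integral_prod//=; last first.
  by apply: (measurableT_comp mF); exact: (measurableT_comp measurable_snd).
under eq_integral => b _.
  rewrite ge0_integral_prod//=; last exact: (measurableT_comp mF).
  rewrite ge0_integral_probability_cst ?integral_ge0//.
  over.
by rewrite ge0_integral_probability_cst ?integral_ge0.
Qed.

(** The signal is integrated first and gives 1 at every output, so the output marginal may remain
    abstract. *)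
Lemma integral_mixture_score_product :
  \int[distribution mu fst \x distribution mu snd]_x (mixture_score v a x.1 x.2)%:E = 1.
Proof.
have ms : measurable_fun setT (fun x : 'cV[R[i]]_k * 'cV[R[i]]_p => (mixture_score v a x.1 x.2)%:E).
  by apply/measurable_EFinP; exact: measurable_mixture_score.
have s0 (c : 'cV[R[i]]_k) (y : 'cV[R[i]]_p) : 0 <= (mixture_score v a c y : R)%:E.
  by rewrite lee_fin; apply/ltW; exact: mixture_score_gt0.
rewrite (fubini_tonelli2 _ ms (fun x => s0 x.1 x.2)).
have ms1 (y : 'cV[R[i]]_p) : measurable_fun setT (fun c : 'cV[R[i]]_k => (mixture_score v a c y : R)%:E).
  by apply/measurable_EFinP; exact: measurable_mixture_score.
transitivity (\int[distribution mu snd]_y (1 : R)%:E).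
  apply: eq_integral => y _.
  etransitivity; first exact: (ge0_integral_mixture_fst (ms1 y) (fun c => s0 c y)).
  exact: integral_mixture_score.
exact: integral_probability_cst.
Qed.

(** Gibbs' inequality on the space that still contains the support: the lower bound uses the score
    of the true support, which the pair (c, y) forgets. *)
Lemma divergence_mixture_ge :
  (('C(n, q)%:R)^-1 * (\sum_(s : {set 'I_n} | #|s| == q)
     (ln 2)^-1 * logdet v (a *m sel R cs q s)) - log2 'C(n, q)%:R)%:E
    <= divergence_from_product mu.
Proof.
have C0 : (0 < 'C(n, q)%:R :> R)%R by rewrite ltr0n bin_gt0.
pose G s := (a *m sel R cs q s)%R.
(* Supports of a wrong size have probability 0; there [g] is the mixture score itself, so that the
   required inequality holds at every point. *)
pose g (x : {set 'I_n} * ('cV[R[i]]_p * 'cV[R[i]]_k)) : R :=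
  if #|x.1| == q then (log2 (score v (G x.1) (output_map x).1 (output_map x).2)
     - log2 'C(n, q)%:R)%R
  else log2 (mixture_score v a (output_map x).1 (output_map x).2).
have mo s : measurable_fun setT (fun u => output_map (s, u)).
  exact: (measurableT_comp measurable_output_map).
have mo1 s : measurable_fun setT (fun u => (output_map (s, u)).1).
  exact: (measurableT_comp measurable_fst (mo s)).
have mo2 s : measurable_fun setT (fun u => (output_map (s, u)).2).
  exact: (measurableT_comp measurable_snd (mo s)).
have mg : measurable_fun setT g.
  apply: measurable_fun_finset_fst => s; rewrite /g /=; case: (#|s| == q).
    apply: measurable_funB => //; apply: measurable_log2.
    exact: (measurable_score v0 (measurable_cst (G s)) (mo1 s) (mo2 s)).
  apply: measurable_log2. exact: (measurable_mixture_score v0 (measurable_cst a) (mo1 s) (mo2 s)).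
pose mus s := image_law (gaussian_matrix v p 1 \x gaussian_matrix 1 k 1) (mo s).
have imE s A : measurable A -> mus s A = (gaussian_matrix v p 1 \x gaussian_matrix 1 k 1)
    ((fun u => output_map (s, u)) @^-1` A) by [].
have musE s A : measurable A -> mus s A =
   (gaussian_matrix v p 1 \x gaussian_matrix 1 k 1) (joint_map (G s) @^-1` A).
  move=> mA; rewrite /mus image_lawE; congr (_ _); apply/seteqP.
  by split => -[z c]; rewrite /= /output_map /= channel_outputE.
have msc s : measurable_fun setT
    (fun x : 'cV[R[i]]_k * 'cV[R[i]]_p => (log2 (score v (G s) x.1 x.2))%:E).
  by apply/measurable_EFinP; apply: measurable_log2; exact: measurable_score.
have ci (t : R) : (gaussian_matrix v p 1 \x gaussian_matrix 1 k 1).-integrable setT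
    (EFin \o cst t) by exact: integrable_probability_cst.
have li s : (gaussian_matrix v p 1 \x gaussian_matrix 1 k 1).-integrable setT
    (fun u => (log2 (score v (G s) (output_map (s, u)).1 (output_map (s, u)).2))%:E).
  have /integrableP[_ fi] := integrable_joint_log_score v0 (musE s).
  apply/integrableP; split; first exact: (measurableT_comp (msc s) (mo s)).
  move: fi; rewrite (ge0_integral_image (mo s) (imE s))//.
  exact: measurableT_comp (msc s).
have gE (s : {set 'I_n}) : #|s| == q -> (fun u => (g (s, u))%:E) = (fun u =>
    (log2 (score v (G s) (output_map (s, u)).1 (output_map (s, u)).2))%:E
    - (EFin \o cst (log2 'C(n, q)%:R)) u).
  by move=> sq; apply/funext => u; rewrite /g/= sq EFinB.
have gi (s : {set 'I_n}) : #|s| == q -> (gaussian_matrix v p 1 \x gaussian_matrix 1 k 1).-integrable setT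
    (fun u => (g (s, u))%:E).
  by move=> sq; rewrite gE//; exact: integrableB.
apply: le_trans (relative_entropy_ge (g := g) measurable_output_map muE
  (s := fun x => mixture_score v a x.1 x.2) _ _ _ _ _).
- rewrite (integral_support_prod ubeta mg gi).
  rewrite (eq_bigr (fun s => ('C(n, q)%:R^-1 * ((ln 2)^-1 * logdet v (G s) - log2 'C(n, q)%:R))%:E)).
    rewrite sumEFin lee_fin -[leRHS]mulr_sumr sumrB sum_support// mulrBr.
    by rewrite (mulrA _ 'C(n, q)%:R) mulVf ?gt_eqF// mul1r.
  move=> s sq; rewrite [RHS]EFinM; congr (_ * _).
  rewrite (congr1 (fun f => \int[_]_u f u) (gE s sq)) integralB//.
  rewrite integral_probability_cst EFinB; congr (_ - _).
  rewrite -(integral_joint_log_score v0 (musE s)).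
  by rewrite (integral_image (mo s) (imE s))//.
- exact: measurable_mixture_score.
- by move=> x; exact: mixture_score_gt0.
- by rewrite integral_mixture_score_product.
- exact: (integrable_support_prod ubeta mg gi).
move=> x; rewrite /g; case: ifP => // xq.
have := mixture_score_ge v0 a (output_map x).1 (output_map x).2 xq.
rewrite mulrC => h; rewrite !log2E -mulrBr ler_wpM2l ?invr_ge0 ?(ltW (ln2_gt0 R))//.
have sc0 := score_gt0 v0 (G x.1) (output_map x).1 (output_map x).2.
have ms0 := mixture_score_gt0 v0 qn a (output_map x).1 (output_map x).2.
by rewrite -ln_div ?posrE// ler_ln ?posrE// divr_gt0.
Qed.

End mixture_divergence.

Lemma measurable_fun_logdet (R : realType) (v : R) p k d (U : measurableType d)
    (G : U -> 'M[R[i]]_(p, k)) : 0 < v ->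
  measurable_fun setT G -> measurable_fun setT (fun x => logdet v (G x)).
Proof. by move=> v0 mG; exact: (measurableT_comp (@measurable_logdet _ _ v0 p k) mG). Qed.

(** * Conditional mutual information with the support known or unknown *)

Section cond_mutual_information.
Local Open Scope ereal_scope.
Context (R : realType) d (T : measurableType d) (P : probability T R).
Context dx dy dz (TX : measurableType dx) (TY : measurableType dy) (TZ : measurableType dz).
Variables (X : T -> TX) (Y : T -> TY) (Z : T -> TZ).
Hypotheses (mZ : measurable_fun setT Z)
  (cX : countably_generated (@measurable _ TX)) (cY : countably_generated (@measurable _ TY)).

(** The value picked by [get] comes from some conditional law, which agrees with [k] off a null set;
    any convenient kernel thus computes the information. *)
Lemma cond_mutual_informationE (k : TZ -> probability (TX * TY)%type R) :
  regular_conditional_law P (fun w => (X w, Y w)) Z k ->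
  cond_mutual_information P X Y Z = \int[P]_w divergence_from_product (k (Z w)).
Proof.
move=> kP; rewrite /cond_mutual_information.
set S := [set v | _].
have : S (get S) by apply: getPex; exists (\int[P]_w divergence_from_product (k (Z w))), k.
move=> [k' [k'P ->]].
have [N [mN N0 kk]] := regular_conditional_law_unique mZ
  (countably_generated_prod cX cY) k'P kP.
apply: (ge0_ae_eq_integral_nonmeasurable mN N0).
- by move=> w; exact: relative_entropy_ge0.
- by move=> w; exact: relative_entropy_ge0.
by move=> w Nw; apply: divergence_from_product_congr => A mA; exact: kk.
Qed.

End cond_mutual_information.

Section converse_bound.
Local Open Scope ereal_scope.
Context (R : realType) (cs : construction) (n p q : nat) (v : R).
Hypotheses (v0 : (0 < v)%R) (qn : (q <= n)%N).
Local Notation k := (signal_dim cs n q).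
Context d (T : measurableType d) (P : probability T R).
Variables (A : T -> 'M[R[i]]_(p, n)) (z : T -> 'cV[R[i]]_p) (b : T -> {set 'I_n})
  (c : T -> 'cV[R[i]]_k).
Hypotheses (mA : measurable_fun setT A) (mz : measurable_fun setT z)
  (mb : measurable_fun setT b) (mc : measurable_fun setT c).
Hypotheses (iA : iid_complex_normal P 1 A) (iz : iid_complex_normal P v z)
  (ub : uniform_support P q b) (ic : iid_complex_normal P 1 c).
Hypothesis ind : mutually_independent P
  (tnth [tuple g_sigma_algebra_preimage A; g_sigma_algebra_preimage z;
               g_sigma_algebra_preimage b; g_sigma_algebra_preimage c]).
Let y w := channel_output cs (A w) (z w) (b w) (c w).

Let beta := image_law P mb.

Let ubeta : uniform_support beta q id.
Proof. by move=> s; rewrite -ub. Qed.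

(** The four independent variables grouped for conditioning on [A] alone, the support being redrawn
    with noise and signal; [law_zc] groups them for conditioning on [A] and [b]. *)
Let law_bzc B : measurable B ->
  P ((fun w => (A w, (b w, (z w, c w)))) @^-1` B) =
  (image_law P mA \x (beta \x (gaussian_matrix v p 1 \x gaussian_matrix 1 k 1))) B.
Proof.
have mX : measurable_fun setT (fun w => (A w, (b w, (z w, c w)))).
  by do 3 apply: measurable_fun_pair => //.
rewrite -(image_lawE P mX); apply: (eq_probability_pi
  (pi_generator_prod (pi_generator_measurable _) (pi_generator_prod (pi_generator_measurable _)
   (pi_generator_prod (pi_generator_measurable _) (pi_generator_measurable _))))).
move=> _ [E1 mE1 [_ [E3 mE3 [_ [E2 mE2 [E4 mE4 <-]] <-]] <-]].
etransitivity; last first.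
  by apply/esym; apply: product_measure1E => //; do 2 apply: measurableX => //.
rewrite image_lawE; transitivity (P (A @^-1` E1) * (P (z @^-1` E2) * (P (b @^-1` E3) * P (c @^-1` E4)))).
  rewrite -(independent4 ind)//; congr (P _); apply/seteqP; split => w /=; tauto.
congr (_ * _); etransitivity; last by apply/esym; apply: product_measure1E => //; exact: measurableX.
rewrite muleCA; congr (_ * _).
etransitivity; last by apply/esym; exact: product_measure1E.
by congr (_ * _); [exact: iid_complex_normal_law mz iz _ mE2|exact: iid_complex_normal_law mc ic _ mE4].
Qed.

Let mAb : measurable_fun setT (fun w => (A w, b w)).
Proof. exact: measurable_fun_pair. Qed.

Let law_zc B : measurable B ->
  P ((fun w => ((A w, b w), (z w, c w))) @^-1` B) =
  (image_law P mAb \x (gaussian_matrix v p 1 \x gaussian_matrix 1 k 1)) B.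
Proof.
have mX : measurable_fun setT (fun w => ((A w, b w), (z w, c w))).
  by apply: measurable_fun_pair; exact: measurable_fun_pair.
rewrite -(image_lawE P mX); apply: (eq_probability_pi
  (pi_generator_prod (pi_generator_prod (pi_generator_measurable _) (pi_generator_measurable _))
   (pi_generator_prod (pi_generator_measurable _) (pi_generator_measurable _)))).
move=> _ [_ [E1 mE1 [E3 mE3 <-]] [_ [E2 mE2 [E4 mE4 <-]] <-]].
etransitivity; last first.
  by apply/esym; apply: product_measure1E; exact: measurableX.
rewrite image_lawE; transitivity (P (A @^-1` E1) * (P (z @^-1` E2) * (P (b @^-1` E3) * P (c @^-1` E4)))).
  rewrite -(independent4 ind)//; congr (P _); apply/seteqP; split => w /=; tauto.
rewrite [X in _ * X]muleCA (muleA (P (A @^-1` E1))); congr (_ * _); last first.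
  apply/esym; etransitivity; first exact: product_measure1E.
  by congr (_ * _); apply/esym;
    [exact: iid_complex_normal_law mz iz _ mE2|exact: iid_complex_normal_law mc ic _ mE4].
have := independent4 ind mE1 measurableT mE3 measurableT.
rewrite !preimage_setT probability_setT mul1e mule1 setTI setIT => <-.
by congr (P _); apply/seteqP; split.
Qed.

Let mPhi : measurable_fun setT
  (fun x : 'M[R[i]]_(p, n) * ({set 'I_n} * ('cV[R[i]]_p * 'cV[R[i]]_k)) =>
     output_map x.1 x.2).
Proof.
have m2 : measurable_fun setT
  (fun x : 'M[R[i]]_(p, n) * ({set 'I_n} * ('cV[R[i]]_p * 'cV[R[i]]_k)) => x.2.2).
  exact: (measurableT_comp measurable_snd).
apply: measurable_fun_pair; first exact: (measurableT_comp measurable_snd m2).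
apply: measurable_channel_output => //.
- exact: (measurableT_comp measurable_fst m2).
- exact: (measurableT_comp measurable_fst).
- exact: (measurableT_comp measurable_snd m2).
Qed.

Let mPsi : measurable_fun setT
  (fun x : ('M[R[i]]_(p, n) * {set 'I_n}) * ('cV[R[i]]_p * 'cV[R[i]]_k) =>
     output_map x.1.1 (x.1.2, x.2)).
Proof.
pose h (x : ('M[R[i]]_(p, n) * {set 'I_n}) * ('cV[R[i]]_p * 'cV[R[i]]_k)) :=
  (x.1.1, (x.1.2, x.2)).
have mh : measurable_fun setT h.
  apply: measurable_fun_pair; first exact: (measurableT_comp measurable_fst).
  by apply: measurable_fun_pair => //; exact: (measurableT_comp measurable_snd).
exact: (measurableT_comp mPhi mh).
Qed.

Let cgen m m' : countably_generated (@measurable _ 'M[R[i]]_(m, m')).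
Proof. exact/countably_generated_matrix/countably_generated_complex. Qed.

Let ml s : measurable_fun setT (fun w => (ln 2)^-1 * logdet v (A w *m sel R cs q s))%R.
Proof.
apply: measurable_funM => //.
have mG : measurable_fun setT (fun w => A w *m sel R cs q s)%R by exact: measurable_mulmx.
exact: measurable_fun_logdet.
Qed.

Let l0 s w : (0 <= (ln 2)^-1 * logdet v (A w *m sel R cs q s))%R.
Proof. by rewrite mulr_ge0 ?logdet_ge0// invr_ge0 ltW ?ln2_gt0. Qed.

Let mean_logdet w : R := (('C(n, q)%:R)^-1 * (\sum_(s : {set 'I_n} | #|s| == q)
     (ln 2)^-1 * logdet v (A w *m sel R cs q s)))%R.

Let mean_logdet_integral : \int[P]_w (mean_logdet w)%:E =
  \sum_(s : {set 'I_n} | #|s| == q) ('C(n, q)%:R^-1)%:E *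
     \int[P]_w ((ln 2)^-1 * logdet v (A w *m sel R cs q s))%:E.
Proof.
have ml' s : measurable_fun setT (fun w => ((ln 2)^-1 * logdet v (A w *m sel R cs q s))%:E).
  exact/measurable_EFinP.
have l0' s w : 0 <= ((ln 2)^-1 * logdet v (A w *m sel R cs q s))%:E by rewrite lee_fin.
under eq_integral do rewrite EFinM -sumEFin.
rewrite ge0_integralZl//; first last.
- by move=> w _; exact: sume_ge0.
- under eq_fun do rewrite sumEFin big_mkcond.
  by apply/measurable_EFinP; apply: measurable_sum => s; case: (#|s| == q).
under eq_integral do rewrite -big_filter.
by rewrite ge0_integral_sum// big_filter -ge0_sume_distrr// => s _; exact: integral_ge0.
Qed.

Let law_Ab B : measurable B ->
  (image_law P mA \x beta) B = P ((fun w => (A w, b w)) @^-1` B).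
Proof.
rewrite -(image_lawE P mAb) => mB; apply/esym; move: B mB; apply: (eq_probability_pi
  (pi_generator_prod (pi_generator_measurable _) (pi_generator_measurable _))).
move=> _ [E1 mE1 [E3 mE3 <-]].
etransitivity; last by apply/esym; exact: product_measure1E.
have := independent4 ind mE1 measurableT mE3 measurableT.
rewrite !preimage_setT probability_setT mul1e mule1 setTI setIT => <-.
by congr (P _); apply/seteqP; split.
Qed.

Section mimo_law.
Context dH (TH : measurableType dH) (PH : probability TH R) (H : TH -> 'M[R[i]]_(p, q)).
Hypotheses (mH : measurable_fun setT H) (iH : iid_complex_normal PH 1 H).

(** Each of the C(n, q) supports contributes the same mean, that of H. *)
Let sum_mimo : \sum_(s : {set 'I_n} | #|s| == q) ('C(n, q)%:R^-1)%:E *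
     \int[P]_w ((ln 2)^-1 * logdet v (A w *m sel R cs q s))%:E =
  \int[PH]_w ((ln 2)^-1 * logdet v (H w))%:E.
Proof.
have mlH : measurable_fun setT (fun w => (logdet v (H w))%:E).
  by apply/measurable_EFinP; exact: measurable_fun_logdet.
have mlA s : measurable_fun setT (fun w => (logdet v (A w *m sel R cs q s))%:E).
  by apply/measurable_EFinP; apply: measurable_fun_logdet => //; exact: measurable_mulmx.
have i0 : (0 <= (ln 2 : R)^-1)%R by rewrite invr_ge0 ltW ?ln2_gt0.
rewrite (eq_bigr (fun=> ('C(n, q)%:R^-1)%:E *
  \int[PH]_w ((ln 2)^-1 * logdet v (H w))%:E)) => [|s /eqP sq].
  rewrite -ge0_sume_distrl; last by move=> s _; rewrite lee_fin invr_ge0.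
  by rewrite sumEFin sum_support mulfV ?mul1e// gt_eqF// ltr0n bin_gt0.
congr (_ * _).
under eq_integral do rewrite EFinM.
rewrite ge0_integralZl//; last by move=> w _; rewrite lee_fin logdet_ge0.
under [RHS]eq_integral do rewrite EFinM.
rewrite ge0_integralZl//; last by move=> w _; rewrite lee_fin logdet_ge0.
by congr (_ * _); exact: integral_logdet_sel.
Qed.

(** With A and b frozen the channel is the Gaussian vector channel of matrix A S, whose divergence
    is explicit; it remains to average over A and b. *)
Lemma cond_mutual_information_known_support :
  cond_mutual_information P c y (fun w => (A w, b w)) =
  \int[PH]_w ((ln 2)^-1 * logdet v (H w))%:E.
Proof.
have K := regular_conditional_law_indep mPsi law_zc.
etransitivity; first exact: (cond_mutual_informationE mAb (@cgen _ _) (@cgen _ _) K).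
pose f (x : 'M[R[i]]_(p, n) * {set 'I_n}) := ((ln 2)^-1 * logdet v (x.1 *m sel R cs q x.2))%:E.
have mf : measurable_fun setT f.
  apply: measurable_fun_finset => s; apply/measurable_EFinP; apply: measurable_funM => //.
  have mG : measurable_fun setT (fun a : 'M[R[i]]_(p, n) => a *m sel R cs q s)%R.
    exact: measurable_mulmx.
  exact: measurable_fun_logdet.
have f0 x : 0 <= f x by rewrite lee_fin mulr_ge0 ?logdet_ge0// invr_ge0 ltW ?ln2_gt0.
transitivity (\int[P]_w f (A w, b w)).
  apply: eq_integral => w _; apply: (divergence_joint v0) => B mB.
  rewrite image_lawE; congr (_ _); apply/seteqP.
  by split => -[u t]; rewrite /= /output_map /= channel_outputE.
rewrite -(ge0_integral_image mAb law_Ab mf f0) fubini_tonelli2//.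
rewrite (ge0_integral_support (@measurable_id _ _ setT) ubeta
  (F := fun s => \int[image_law P mA]_a f (a, s))); last first.
  by move=> s; exact: integral_ge0.
rewrite -sum_mimo; apply: eq_bigr => s sq; congr (_ * _).
have mfs : measurable_fun setT (fun a => f (a, s)) by exact: (measurableT_comp mf).
exact: (ge0_integral_image_law P mA mfs (fun a => f0 (a, s))).
Qed.

Lemma cond_mutual_information_unknown_support :
  \int[PH]_w ((ln 2)^-1 * logdet v (H w))%:E - (log2 'C(n, q)%:R)%:E <=
  cond_mutual_information P c y A.
Proof.
rewrite -sum_mimo -mean_logdet_integral.
have K := regular_conditional_law_indep mPhi law_bzc.
apply: le_trans; last first.
  rewrite le_eqVlt; apply/orP; left; apply/eqP/esym.
  exact: (cond_mutual_informationE mA (@cgen _ _) (@cgen _ _) K).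
have L0 : (0 <= log2 'C(n, q)%:R :> R)%R.
  by rewrite log2E mulr_ge0 ?invr_ge0 ?(ltW (ln2_gt0 R))// ln_ge0// ler1n bin_gt0.
(* The divergence is nonnegative but not known to be measurable in [w]; truncating its lower bound
   at 0 gives a measurable nonnegative minorant, for which monotonicity of the integral is
   available. *)
pose M w := Num.max 0%R (mean_logdet w - log2 'C(n, q)%:R)%R.
have mm : measurable_fun setT mean_logdet.
  apply: measurable_funM => //.
  under eq_fun do rewrite big_mkcond.
  by apply: measurable_sum => s; case: (#|s| == q).
have mM : measurable_fun setT M.
  by apply: measurable_maxr => //; exact: measurable_funB.
have M0 w : (0 <= M w)%R by rewrite le_max lexx.
apply: (@le_trans _ _ (\int[P]_w (M w)%:E)); last first.
  apply: (ge0_ae_le_integral_nonmeasurable measurable0 (measure0 _)).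
  - by move=> w; rewrite lee_fin.
  - by move=> w; exact: relative_entropy_ge0.
  move=> w _; rewrite EFin_max ge_max relative_entropy_ge0/=.
  apply: (divergence_mixture_ge v0 qn ubeta) => B mB.
  by rewrite image_lawE.
rewrite leeBlDr// -(integral_probability_cst P (log2 'C(n, q)%:R)) -ge0_integralD//; first last.
- exact/measurable_EFinP.
- by move=> w _; rewrite lee_fin.
apply: ge0_le_integral => //.
- by move=> w _; rewrite lee_fin mulr_ge0 ?invr_ge0// sumr_ge0.
- exact/measurable_EFinP.
- by apply: emeasurable_funD => //; exact/measurable_EFinP.
by move=> w _; rewrite -EFinD lee_fin -lerBlDr le_max lexx orbT.
Qed.

End mimo_law.

End converse_bound.

(** * Random coding *)

Section iid_integrals.
Local Open Scope ereal_scope.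
Context (R : realType) d (T : measurableType d) (P : probability T R).

Lemma emeasurable_prod_tnth n (f : 'I_n -> T -> \bar R) :
  (forall i, measurable_fun setT (f i)) ->
  measurable_fun setT (fun u : n.-tuple T => \prod_i f i (tnth u i)).
Proof.
move=> mf; elim: (index_enum _) => [|i s ih].
  by under eq_fun do rewrite big_nil; exact: measurable_cst.
under eq_fun do rewrite big_cons; apply: emeasurable_funM => //.
exact: (measurableT_comp (mf i) (@measurable_tnth _ _ _ i)).
Qed.

Lemma integral_iid_prod n (f : 'I_n -> T -> \bar R) :
  (forall i, measurable_fun setT (f i)) -> (forall i x, 0 <= f i x) ->
  \int[iid_law P n]_u \prod_i f i (tnth u i) = \prod_i \int[P]_x f i x.
Proof.
elim: n f => [|n ih] f mf f0.
  rewrite big_ord0; under eq_integral do rewrite big_ord0.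
  exact: integral_probability_cst.
have mF := emeasurable_prod_tnth mf.
rewrite integral_iid_lawS//; last by move=> u; exact: prode_ge0.
rewrite big_ord_recl -ih// -ge0_integralZr//; last first.
  by apply: integral_ge0 => u _; exact: prode_ge0.
apply: eq_integral => x _; rewrite -ge0_integralZl//; first last.
- by move=> u _; exact: prode_ge0.
- exact: (emeasurable_prod_tnth (f := fun i => f (lift ord0 i))).
apply: eq_integral => u _; rewrite big_ord_recl tnth0; congr (_ * _).
by apply: eq_bigr => i _; rewrite tnthS.
Qed.

Lemma iid_law_tnth n (i : 'I_n) E : measurable E ->
  P E = iid_law P n ((fun u => tnth u i) @^-1` E).
Proof.
move=> mE; transitivity (\prod_(j < n) P (if j == i then E else setT)).
  by rewrite (bigD1 i)//= eqxx big1 ?mule1// => j /negbTE ->; rewrite probability_setT.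
rewrite -(iid_law_rectangle P (E := fun j => if j == i then E else setT)); last first.
  by move=> j; case: ifP.
congr (_ _); apply/seteqP; split => [u /(_ i)|u Eu j]; first by rewrite eqxx.
by case: eqP => // ->.
Qed.

Lemma iid_law_tnth2 n (i j : 'I_n) E : i != j -> measurable E ->
  (P \x P) E = iid_law P n ((fun u => (tnth u i, tnth u j)) @^-1` E).
Proof.
move=> ij mE.
have mX : measurable_fun setT (fun u : n.-tuple T => (tnth u i, tnth u j)).
  by apply: measurable_fun_pair; exact: measurable_tnth.
rewrite -(image_lawE (iid_law P n) mX); move: E mE.
apply: (eq_probability_pi
  (pi_generator_prod (pi_generator_measurable _) (pi_generator_measurable _))).
move=> _ [E mE [F mF <-]].
etransitivity; first exact: product_measure1E.
pose G l := if l == i then E else if l == j then F else setT.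
have mG l : measurable (G l) by rewrite /G; case: ifP => // _; case: ifP.
transitivity (\prod_(l < n) P (G l)).
  rewrite (bigD1 i)//= (bigD1 j) 1?eq_sym//= /G eqxx eqxx eq_sym (negbTE ij).
  rewrite big1 ?mule1// => l /andP[/negbTE -> /negbTE ->].
  exact: probability_setT.
rewrite -(iid_law_rectangle P mG) image_lawE; congr (_ _).
apply/seteqP; split => [u Gu|u [Eu Fu] l].
  by split; [have := Gu i|have := Gu j]; rewrite /G ?eqxx// eq_sym (negbTE ij).
rewrite /G; case: eqP => [->//|_]; by case: eqP => [->//|_].
Qed.

Lemma integral_iid_tnth n (i : 'I_n) (F : T -> \bar R) :
  measurable_fun setT F -> (forall x, 0 <= F x) ->
  \int[iid_law P n]_u F (tnth u i) = \int[P]_x F x.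
Proof.
move=> mF F0; apply/esym.
exact: (ge0_integral_image (@measurable_tnth _ T n i) (iid_law_tnth i) mF F0).
Qed.

Lemma integral_iid_tnth2 n (i j : 'I_n) (F : T -> T -> \bar R) : i != j ->
  measurable_fun setT (fun x => F x.1 x.2) -> (forall x y, 0 <= F x y) ->
  \int[iid_law P n]_u F (tnth u i) (tnth u j) = \int[P]_x \int[P]_y F x y.
Proof.
move=> ij mF F0; have mX : measurable_fun setT (fun u : n.-tuple T => (tnth u i, tnth u j)).
  by apply: measurable_fun_pair; exact: measurable_tnth.
rewrite -(ge0_integral_prod _ _ mF (fun x => F0 x.1 x.2)).
apply/esym; exact: (ge0_integral_image mX (fun E => iid_law_tnth2 ij) mF (fun x => F0 _ _)).
Qed.

End iid_integrals.

Section pick.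
Context d (U : measurableType d) (I : finType).

Lemma measurable_finset_of (f : I -> U -> bool) :
  (forall i, measurable_fun setT (f i)) -> forall s : {set I},
  measurable [set u | [set i | f i u]%SET = s].
Proof.
move=> mf s; rewrite [X in measurable X](_ : _ = \big[setI/setT]_i (f i @^-1` [set i \in s])).
  by apply: bigsetI_measurable => i _; rewrite -[X in measurable X]setTI; exact: mf.
rewrite bigsetI_finE; apply/seteqP; split => [u /= <- i|u /= fs]; first by rewrite /= inE.
by apply/setP => i; rewrite inE fs.
Qed.

(** The choice depends on [u] only through the finite set of indices that satisfy the test, and each
    value of this set is taken on a measurable event. *)
Lemma measurable_pick (f : I -> U -> bool) (i0 : I) :
  (forall i, measurable_fun setT (f i)) -> forall i,
  measurable [set u | odflt i0 [pick i | f i u] = i].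
Proof.
move=> mf i; rewrite [X in measurable X](_ : _ =
    \bigcup_(s in [set s : {set I} | odflt i0 [pick i in s] = i])
      [set u | [set i | f i u]%SET = s]).
  by apply: fin_bigcup_measurable => // s _; exact: measurable_finset_of.
have E u : [pick i | f i u] = [pick i in [set i | f i u]%SET].
  by apply: eq_pick => j; rewrite inE.
apply/seteqP; split => [u /= fu|u [s /= si su]].
  by exists [set i | f i u]%SET => //=; rewrite -E.
by rewrite E su.
Qed.

End pick.

Lemma powR_prod (R : realType) I (r : seq I) (F : I -> R) x : (forall i, 0 <= F i) ->
  (\prod_(i <- r) F i) `^ x = \prod_(i <- r) F i `^ x.
Proof.
move=> F0; elim: r => [|i r ih]; first by rewrite !big_nil powR1.
by rewrite !big_cons powRM ?ih// prodr_ge0.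
Qed.

(** * Random codebooks for a memoryless channel with an abstract score of mean 1 *)

Section random_coding.
Local Open Scope ereal_scope.
Context (R : realType) dX dU dY (X : measurableType dX) (U : measurableType dU)
  (Y : measurableType dY).
Variables (mu : probability X R) (kappa : probability U R) (out : X * U -> Y).
Variables (h : X -> Y -> R) (e : X -> R) (rho phi a : R).
Hypotheses (mout : measurable_fun setT out)
  (mh : measurable_fun setT (fun xy => h xy.1 xy.2)) (h0 : forall x y, (0 < h x y)%R)
  (h1 : forall y, \int[mu]_x (h x y)%:E = 1)
  (me : measurable_fun setT e) (e0 : forall x, (0 <= e x)%R)
  (ea : \int[mu]_x (e x)%:E = a%:E) (rho0 : (0 < rho)%R)
  (hphi : \int[kappa]_u \int[mu]_x (h x (out (x, u)) `^ (- rho))%:E <= phi%:E).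
Variables (N M : nat) (theta : R).
Hypothesis (theta0 : (0 < theta)%R).

Definition tuple_score (x : N.-tuple X) (y : N.-tuple Y) : R :=
  (\prod_t h (tnth x t) (tnth y t))%R.

Definition tuple_output (x : N.-tuple X) (u : N.-tuple U) : N.-tuple Y :=
  [tuple out (tnth x t, tnth u t) | t < N].

(** Any message reaching the threshold is accepted, ambiguities being charged to the wrong
    codewords; [m0] is the answer when there is none. *)
Definition threshold_decoder (m0 : 'I_M) (cw : 'I_M -> N.-tuple X) (y : N.-tuple Y) : 'I_M :=
  odflt m0 [pick m | (theta <= tuple_score (cw m) y)%R].

(** A majorant of the indicator of an error, made of terms that are products over time, so that its
    mean over codebooks and states factors. *)
Definition error_bound (cw : 'I_M -> N.-tuple X) (m : 'I_M) (u : N.-tuple U) : R :=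
  (theta `^ rho * \prod_t (h (tnth (cw m) t) (out (tnth (cw m) t, tnth u t)) `^ (- rho))
   + theta^-1 * \sum_(m' < M | m' != m) tuple_score (cw m') (tuple_output (cw m) u))%R.

Lemma tuple_score_gt0 x y : (0 < tuple_score x y)%R.
Proof. by apply: prodr_gt0 => t _; exact: h0. Qed.

Lemma measurable_tuple_score d (V : measurableType d) (x : V -> N.-tuple X)
    (y : V -> N.-tuple Y) : measurable_fun setT x -> measurable_fun setT y ->
  measurable_fun setT (fun w => tuple_score (x w) (y w)).
Proof.
move=> mx my; apply: measurable_prod => t _.
have mxy : measurable_fun setT (fun w => (tnth (x w) t, tnth (y w) t)).
  by apply: measurable_fun_pair; apply: (measurableT_comp (@measurable_tnth _ _ _ t)).
exact: (measurableT_comp mh mxy).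
Qed.

Lemma measurable_tuple_output d (V : measurableType d) (x : V -> N.-tuple X)
    (u : V -> N.-tuple U) : measurable_fun setT x -> measurable_fun setT u ->
  measurable_fun setT (fun w => tuple_output (x w) (u w)).
Proof.
move=> mx mu'; apply/measurable_fun_tnthP => t.
have mxu : measurable_fun setT (fun w => (tnth (x w) t, tnth (u w) t)).
  by apply: measurable_fun_pair; apply: (measurableT_comp (@measurable_tnth _ _ _ t)).
rewrite (_ : _ \o _ = out \o (fun w => (tnth (x w) t, tnth (u w) t))).
  exact: (measurableT_comp mout mxu).
by apply/funext => w; rewrite /= tnth_mktuple.
Qed.

Lemma measurable_threshold_decoder m0 cw m :
  measurable (threshold_decoder m0 cw @^-1` [set m]).
Proof.
apply: (@measurable_pick _ _ _ (fun m y => theta <= tuple_score (cw m) y)%R) => i.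
apply: measurable_fun_ler => //.
exact: (measurable_tuple_score (measurable_cst (cw i)) (@measurable_id _ _ setT)).
Qed.

Lemma error_bound_ge0 cw m u : (0 <= error_bound cw m u)%R.
Proof.
apply: addr_ge0.
  by rewrite mulr_ge0 ?powR_ge0//; apply: prodr_ge0 => t _; exact: powR_ge0.
rewrite mulr_ge0 ?invr_ge0 ?(ltW theta0)//; apply: sumr_ge0 => m' _.
exact/ltW/tuple_score_gt0.
Qed.

(* Markov's bound for a low score of the true codeword (exponent [rho]) and the union
   bound for a high score of another one. *)
Lemma threshold_decoder_error m0 cw m u :
  ((threshold_decoder m0 cw (tuple_output (cw m) u) != m)%:R <= error_bound cw m u)%R.
Proof.
have [_|] := eqVneq; first exact: error_bound_ge0.
rewrite /threshold_decoder => em /=.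
have S0 m' := tuple_score_gt0 (cw m') (tuple_output (cw m) u).
have P0 : (0 <= \prod_t (h (tnth (cw m) t) (out (tnth (cw m) t, tnth u t)) `^ (- rho)))%R.
  by apply: prodr_ge0 => t _; exact: powR_ge0.
have [Sm|Sm] := leP theta (tuple_score (cw m) (tuple_output (cw m) u)); last first.
  rewrite /error_bound -[leLHS]addr0 lerD//; last first.
    rewrite mulr_ge0 ?invr_ge0 ?(ltW theta0)//; apply: sumr_ge0 => m' _; exact/ltW.
  rewrite -powR_prod; last by move=> t; exact/ltW.
  rewrite (_ : (\prod_t _)%R = tuple_score (cw m) (tuple_output (cw m) u)); last first.
    by apply: eq_bigr => t _; rewrite tnth_mktuple.
  rewrite powRN ler_pdivlMr ?powR_gt0// mul1r ge0_ler_powR ?nnegrE ?ltW//.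
move: em; case: pickP => [m' Sm' /= mm|/(_ m)]; last by rewrite Sm.
rewrite /error_bound -[leLHS]add0r lerD// ?mulr_ge0 ?powR_ge0//.
rewrite ler_pdivlMl// mulr1 (bigD1 m')//= -[leLHS]addr0 lerD//.
by apply: sumr_ge0 => l _; exact/ltW.
Qed.

Let mcomp m (t : 'I_N) : measurable_fun setT
  (fun wu : M.-tuple (N.-tuple X) * N.-tuple U => tnth (tnth wu.1 m) t).
Proof.
apply: (measurableT_comp (@measurable_tnth _ _ _ t)).
by apply: (measurableT_comp (@measurable_tnth _ _ _ m)).
Qed.

Lemma measurable_error_bound m : measurable_fun setT
  (fun wu : M.-tuple (N.-tuple X) * N.-tuple U => error_bound (tnth wu.1) m wu.2).
Proof.
have mm m' : measurable_fun setT
    (fun wu : M.-tuple (N.-tuple X) * N.-tuple U => tnth wu.1 m').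
  by apply: (measurableT_comp (@measurable_tnth _ _ _ m')).
apply: measurable_funD; apply: measurable_funM => //.
  apply: measurable_prod => t _; apply: (measurableT_comp (measurable_powR _)).
  have mxu : measurable_fun setT
      (fun wu : M.-tuple (N.-tuple X) * N.-tuple U => (tnth (tnth wu.1 m) t, tnth wu.2 t)).
    apply: measurable_fun_pair; first exact: mcomp.
    by apply: (measurableT_comp (@measurable_tnth _ _ _ t)).
  have mxy := measurable_fun_pair (mcomp m t) (measurableT_comp mout mxu).
  exact: (measurableT_comp mh mxy).
under eq_fun do rewrite big_mkcond.
apply: measurable_sum => m'; case: (m' != m) => //.
apply: measurable_tuple_score => //; exact: measurable_tuple_output.
Qed.

Let G u := \int[mu]_x (h x (out (x, u)) `^ (- rho))%:E.

Let mg : measurable_fun setT (fun xu : X * U => (h xu.1 (out xu) `^ (- rho))%:E).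
Proof.
apply/measurable_EFinP; apply: (measurableT_comp (measurable_powR _)).
have mxy : measurable_fun setT (fun xu : X * U => (xu.1, out xu)) by exact: measurable_fun_pair.
exact: (measurableT_comp mh mxy).
Qed.

Let mgu u : measurable_fun setT (fun x => (h x (out (x, u)) `^ (- rho))%:E).
Proof.
have mxu : measurable_fun setT (fun x : X => (x, u)) by exact: measurable_fun_pair.
exact: (measurableT_comp mg mxu).
Qed.

Let mG : measurable_fun setT G.
Proof.
apply: (@measurable_fun_fubini_tonelli_G _ _ _ _ _ mu (fun xu => (h xu.1 (out xu) `^ (- rho))%:E)) => //.
by move=> xu; rewrite lee_fin powR_ge0.
Qed.

Let integral_true_score m u : \int[iid_law (iid_law mu N) M]_w
   (\prod_t (h (tnth (tnth w m) t) (out (tnth (tnth w m) t, tnth u t)) `^ (- rho)))%:E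
  = \prod_(t < N) G (tnth u t).
Proof.
pose f t x := (h x (out (x, tnth u t)) `^ (- rho))%:E.
have f0 t x : 0 <= f t x by rewrite lee_fin powR_ge0.
rewrite -(integral_iid_prod mu (fun t => mgu (tnth u t)) f0).
rewrite -(integral_iid_tnth (iid_law mu N) m (emeasurable_prod_tnth (fun t => mgu (tnth u t)))); last first.
  by move=> x; apply: prode_ge0 => t _; exact: f0.
by apply: eq_integral => w _; rewrite prodEFin.
Qed.

(** The codeword of [m'] is independent of that of [m], hence of the output; once the output is
    fixed, the mean score is a product of N ones. *)
Let integral_other_score m m' u : m' != m -> \int[iid_law (iid_law mu N) M]_w
   (tuple_score (tnth w m') (tuple_output (tnth w m) u))%:E = 1.
Proof.
move=> mm'.
have ms : measurable_fun setT (fun x : N.-tuple X * N.-tuple X =>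
    (tuple_score x.2 (tuple_output x.1 u))%:E).
  apply/measurable_EFinP; apply: measurable_tuple_score => //.
  exact: measurable_tuple_output.
rewrite (integral_iid_tnth2 (iid_law mu N) (i := m) (j := m')
  (F := fun x x' => (tuple_score x' (tuple_output x u))%:E) _ ms) 1?eq_sym//; last first.
  by move=> x y; rewrite lee_fin; exact/ltW/tuple_score_gt0.
transitivity (\int[iid_law mu N]_x (1 : R)%:E); last exact: integral_probability_cst.
apply: eq_integral => x0 _.
have mhy t : measurable_fun setT (fun x' => (h x' (tnth (tuple_output x0 u) t))%:E).
  apply/measurable_EFinP.
  have mxy : measurable_fun setT (fun x : X => (x, tnth (tuple_output x0 u) t)).
    exact: measurable_fun_pair.
  exact: (measurableT_comp mh mxy).
rewrite /tuple_score; under eq_integral do rewrite -prodEFin.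
rewrite (integral_iid_prod mu mhy); last by move=> t x'; rewrite lee_fin ltW.
by rewrite big1.
Qed.

(** With the states fixed, the codebook is integrated first. The term of the true codeword then
    factors over time into N means, each bounded by [phi]; every wrong codeword contributes 1. *)
Lemma integral_error_bound m : \int[iid_law (iid_law mu N) M]_w \int[iid_law kappa N]_u
    (error_bound (tnth w) m u)%:E <= (theta `^ rho * phi ^+ N + theta^-1 * M%:R)%:E.
Proof.
have mb : measurable_fun setT (fun wu : M.-tuple (N.-tuple X) * N.-tuple U =>
    (error_bound (tnth wu.1) m wu.2)%:E).
  by apply/measurable_EFinP; exact: measurable_error_bound.
rewrite (fubini_tonelli _ mb); last by move=> wu; rewrite lee_fin error_bound_ge0.
have G0 u : 0 <= G u by apply: integral_ge0 => x _; rewrite lee_fin powR_ge0.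
have t0 : (0 <= theta^-1)%R by rewrite invr_ge0 ltW.
apply: (@le_trans _ _ (\int[iid_law kappa N]_u ((theta `^ rho)%:E * \prod_(t < N) G (tnth u t)
   + (theta^-1 * M%:R)%:E))).
  apply: ge0_le_integral => //.
  - by move=> u _; apply: integral_ge0 => w _; rewrite lee_fin error_bound_ge0.
  - apply: (@measurable_fun_fubini_tonelli_G _ _ _ _ _ (iid_law (iid_law mu N) M) _ mb).
    by move=> wu; rewrite lee_fin error_bound_ge0.
  - apply: emeasurable_funD => //; apply: emeasurable_funM => //.
    exact: (emeasurable_prod_tnth (fun=> mG)).
  move=> u _.
  have mcu : measurable_fun setT (fun w : M.-tuple (N.-tuple X) => (w, u)).
    exact: measurable_fun_pair.
  have mt : measurable_fun setT (fun w : M.-tuple (N.-tuple X) =>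
      (\prod_t (h (tnth (tnth w m) t) (out (tnth (tnth w m) t, tnth u t)) `^ (- rho)))%:E).
    have mtm := emeasurable_prod_tnth (fun t => mgu (tnth u t)).
    under eq_fun do rewrite -prodEFin.
    exact: (measurableT_comp mtm (@measurable_tnth _ _ _ m)).
  have ms m' : measurable_fun setT (fun w : M.-tuple (N.-tuple X) =>
      (tuple_score (tnth w m') (tuple_output (tnth w m) u))%:E).
    apply/measurable_EFinP; apply: measurable_tuple_score; first exact: measurable_tnth.
    by apply: measurable_tuple_output => //; exact: measurable_tnth.
  have s0 m' (w : M.-tuple (N.-tuple X)) :
      0 <= (tuple_score (tnth w m') (tuple_output (tnth w m) u))%:E.
    by rewrite lee_fin; exact/ltW/tuple_score_gt0.
  have p0 (w : M.-tuple (N.-tuple X)) :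
      0 <= (\prod_t (h (tnth (tnth w m) t) (out (tnth (tnth w m) t, tnth u t)) `^ (- rho)))%:E.
    by rewrite lee_fin; apply: prodr_ge0 => t _; exact: powR_ge0.
  have mss : measurable_fun setT (fun w : M.-tuple (N.-tuple X) =>
      \sum_(m' <- [seq m' <- index_enum _ | m' != m])
        (tuple_score (tnth w m') (tuple_output (tnth w m) u))%:E).
    exact: emeasurable_sum.
  rewrite (_ : \int[_]_w _ = \int[iid_law (iid_law mu N) M]_w ((theta `^ rho)%:E *
      (\prod_t (h (tnth (tnth w m) t) (out (tnth (tnth w m) t, tnth u t)) `^ (- rho)))%:E
    + (theta^-1)%:E * \sum_(m' <- [seq m' <- index_enum _ | m' != m])
        (tuple_score (tnth w m') (tuple_output (tnth w m) u))%:E)); last first.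
    by apply: eq_integral => w _; rewrite /error_bound EFinD !EFinM -sumEFin big_filter.
  rewrite ge0_integralD//; first last.
  - exact: (emeasurable_funM (measurable_cst _) mss).
  - by move=> w _; rewrite mule_ge0 ?lee_fin// sume_ge0.
  - exact: (emeasurable_funM (measurable_cst _) mt).
  - by move=> w _; apply: mule_ge0; [rewrite lee_fin powR_ge0|exact: p0].
  rewrite ge0_integralZl//; last by rewrite lee_fin powR_ge0.
  rewrite integral_true_score leeD2l// ge0_integralZl//; first last.
  - by move=> w _; exact: sume_ge0.
  rewrite ge0_integral_sum// EFinM lee_wpmul2l ?lee_fin// big_filter.
  under eq_bigr => m' mm' do rewrite integral_other_score//.
  rewrite sumEFin lee_fin sumr_const ler_nat (leq_trans (max_card _))// card_ord//.
have mGp : measurable_fun setT (fun u : N.-tuple U => \prod_t G (tnth u t)).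
  exact: (emeasurable_prod_tnth (fun=> mG)).
rewrite ge0_integralD//; first last.
- by move=> u _; rewrite lee_fin mulr_ge0.
- by apply: emeasurable_funM.
- by move=> u _; rewrite mule_ge0 ?lee_fin ?powR_ge0// prode_ge0.
rewrite integral_probability_cst EFinD leeD2r// EFinM.
rewrite ge0_integralZl//; first last.
- by rewrite lee_fin powR_ge0.
- by move=> u _; exact: prode_ge0.
rewrite lee_wpmul2l ?lee_fin ?powR_ge0//.
rewrite (integral_iid_prod kappa (fun=> mG) (fun=> G0)).
have K0 : 0 <= \int[kappa]_u G u by exact: integral_ge0.
have Kf : \int[kappa]_u G u \is a fin_num by rewrite ge0_fin_numE// (le_lt_trans hphi)// ltry.
have : \int[kappa]_u G u <= phi%:E by [].
rewrite -(fineK Kf) prodEFin prodr_const card_ord !lee_fin => Kphi.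
by rewrite lerXn2r// nnegrE ?(le_trans _ Kphi)// fine_ge0.
Qed.

Let energy_ge0' (w : M.-tuple (N.-tuple X)) : (0 <= \sum_m \sum_t e (tnth (tnth w m) t))%R.
Proof. by apply: sumr_ge0 => m _; apply: sumr_ge0. Qed.

Let measurable_codebook_energy : measurable_fun setT
  (fun w : M.-tuple (N.-tuple X) => \sum_m \sum_t e (tnth (tnth w m) t))%R.
Proof.
apply: measurable_sum => m; apply: measurable_sum => t.
apply: (measurableT_comp me); apply: (measurableT_comp (@measurable_tnth _ _ _ t)).
exact: measurable_tnth.
Qed.

Let integral_codebook_energy : \int[iid_law (iid_law mu N) M]_w
  (\sum_m \sum_t e (tnth (tnth w m) t))%:E = (M%:R * (N%:R * a))%:E.
Proof.
have me' : measurable_fun setT (fun x => (e x)%:E) by exact/measurable_EFinP.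
have met t : measurable_fun setT (fun x : N.-tuple X => (e (tnth x t))%:E).
  exact: (measurableT_comp me' (@measurable_tnth _ _ _ t)).
have mes : measurable_fun setT (fun x : N.-tuple X => \sum_t (e (tnth x t))%:E).
  exact: emeasurable_sum.
under eq_integral => w _.
  rewrite -sumEFin; under eq_bigr do rewrite -sumEFin.
  over.
rewrite ge0_integral_sum//; last 2 first.
- move=> m; apply: emeasurable_sum => t.
  exact: (measurableT_comp (met t) (@measurable_tnth _ _ _ m)).
- by move=> m w _; apply: sume_ge0 => t _; rewrite lee_fin.
have se0 (x : N.-tuple X) : 0 <= \sum_t (e (tnth x t))%:E.
  by apply: sume_ge0 => t _; rewrite lee_fin.
have em m : \int[iid_law (iid_law mu N) M]_w (\sum_t (e (tnth (tnth w m) t))%:E) =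
    (N%:R * a)%:E.
  have -> : (N%:R * a)%:E = \sum_(t < N) a%:E.
    by rewrite sumEFin sumr_const card_ord (mulr_natl a).
  transitivity (\int[iid_law mu N]_x \sum_t (e (tnth x t))%:E).
    exact: (integral_iid_tnth (iid_law mu N) m mes se0).
  rewrite ge0_integral_sum//; last by move=> t x _; rewrite lee_fin.
  apply: eq_bigr => t _; rewrite -ea.
  by apply: (integral_iid_tnth mu t me') => x'; rewrite lee_fin.
under eq_bigr do rewrite em.
rewrite sumEFin; congr (_%:E); rewrite sumr_const card_ord; exact/esym/mulr_natl.
Qed.

(** [D] adds the error in units of M / K to the energy in units of M L. Its mean is below 1, so some
    codebook has D < 1, and both terms, being nonnegative, are at most 1 there. *)
Lemma exists_codebook K L : (0 < M)%N -> (0 < K)%R -> (0 < L)%R ->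
  (K * (theta `^ rho * phi ^+ N + theta^-1 * M%:R) + N%:R * a / L < 1)%R ->
  exists cw : 'I_M -> N.-tuple X,
    \sum_m \int[iid_law kappa N]_u (error_bound cw m u)%:E <= (M%:R / K)%:E /\
    (\sum_m \sum_t e (tnth (cw m) t) <= M%:R * L)%R.
Proof.
move=> M0 K0 L0 small; have MR0 : (0 < M%:R :> R)%R by rewrite ltr0n.
pose I m (w : M.-tuple (N.-tuple X)) := \int[iid_law kappa N]_u (error_bound (tnth w) m u)%:E.
have I0 m w : 0 <= I m w by apply: integral_ge0 => u _; rewrite lee_fin error_bound_ge0.
have mI m : measurable_fun setT (I m).
  apply: (@measurable_fun_fubini_tonelli_F _ _ _ _ _ (iid_law kappa N)
    (fun wu => (error_bound (tnth wu.1) m wu.2)%:E)).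
    by apply/measurable_EFinP; exact: measurable_error_bound.
  by move=> wu; rewrite lee_fin error_bound_ge0.
pose E (w : M.-tuple (N.-tuple X)) := (\sum_m \sum_t e (tnth (tnth w m) t))%R.
pose D w := (K / M%:R)%:E * (\sum_m I m w) + ((M%:R * L)^-1)%:E * (E w)%:E.
have KM0 : (0 <= K / M%:R)%R by rewrite divr_ge0 ?(ltW K0).
have ML0 : (0 <= (M%:R * L)^-1)%R by rewrite invr_ge0 mulr_ge0// ltW.
have mS : measurable_fun setT (fun w => \sum_m I m w) by exact: emeasurable_sum.
have mE : measurable_fun setT (fun w => (E w)%:E) by exact/measurable_EFinP.
have S0 w : 0 <= \sum_m I m w by exact: sume_ge0.
have E0 w : 0 <= (E w)%:E by rewrite lee_fin; exact: energy_ge0'.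
have mD : measurable_fun setT D.
  by apply: emeasurable_funD; exact: (emeasurable_funM (measurable_cst _)).
have D1 : \int[iid_law (iid_law mu N) M]_w D w < 1.
  rewrite ge0_integralD//; first last.
  - exact: (emeasurable_funM (measurable_cst _) mE).
  - by move=> w _; apply: mule_ge0 => //; rewrite lee_fin.
  - exact: (emeasurable_funM (measurable_cst _) mS).
  - by move=> w _; apply: mule_ge0 => //; rewrite lee_fin.
  rewrite ge0_integralZl// ge0_integralZl// integral_codebook_energy ge0_integral_sum//.
  apply: (@le_lt_trans _ _ ((K / M%:R)%:E * (\sum_(m < M) (theta `^ rho * phi ^+ N + theta^-1 * M%:R)%:E)
    + ((M%:R * L)^-1)%:E * (M%:R * (N%:R * a))%:E)).
    rewrite leeD2r// lee_wpmul2l ?lee_fin//; apply: lee_sum => m _.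
    exact: integral_error_bound.
  rewrite sumEFin sumr_const card_ord -mulr_natl -!EFinM -EFinD lte_fin.
  rewrite (le_lt_trans _ small)// le_eqVlt; apply/orP; left; apply/eqP.
  by field; rewrite !gt_eqF.
have [w Dw] : exists w, D w < 1.
  apply: contrapT => /forallNP D1'.
  suff : 1 <= \int[iid_law (iid_law mu N) M]_w D w by rewrite leNgt D1.
  rewrite -(integral_probability_cst (iid_law (iid_law mu N) M) 1).
  apply: ge0_le_integral => //.
  by move=> w _; rewrite leNgt; apply/negP; exact: D1'.
exists (tnth w); split.
  have : (K / M%:R)%:E * (\sum_m I m w) <= 1.
    rewrite (le_trans _ (ltW Dw))// leeDl//; exact: mule_ge0.
  rewrite -lee_pdivlMl ?divr_gt0//.
  by rewrite mule1 invf_div.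
have : ((M%:R * L)^-1)%:E * (E w)%:E <= 1.
  rewrite (le_trans _ (ltW Dw))// leeDr//; exact: mule_ge0.
by rewrite -EFinM lee_fin mulrC ler_pdivrMr ?mulr_gt0// mul1r.
Qed.

End random_coding.

(** * An exponential bound on the probability of a low score *)

Section chernoff.
Context (R : realType).

(* Tangent of [expR] at [t * x], evaluated at [0] and at [x]. *)
Lemma expR_mul_le (t x : R) : 0 <= t <= 1 -> expR (t * x) <= 1 - t + t * expR x.
Proof.
move=> /andP[t0 t1]; have e0 : 0 < expR (t * x) by exact: expR_gt0.
have h1 : expR (t * x) * (1 + (x - t * x)) <= expR x.
  rewrite -[in leRHS](subrK (t * x) x) expRD mulrC ler_wpM2r ?(ltW e0)//.
  exact: expR_ge1Dx.
have h2 : expR (t * x) * (1 - t * x) <= 1.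
  rewrite -[leRHS](expR0 R) -(subrr (t * x)) expRD ler_wpM2l ?(ltW e0)//.
  exact: expR_ge1Dx.
have g1 := ler_wpM2l t0 h1.
have t1' : 0 <= 1 - t by rewrite subr_ge0.
have g2 := ler_wpM2l t1' h2.
move: g1 g2; rewrite mulr1; set m := expR (t * x) => g1 g2.
have -> : m = (1 - t) * (m * (1 - t * x)) + t * (m * (1 + (x - t * x))) by ring.
exact: lerD.
Qed.

(** Minus the difference quotient at 0 of t -> exp (- t x); it tends to x as t tends to 0, without
    ever exceeding x. *)
Let psi (t x : R) := t^-1 * (1 - expR (- (t * x))).

Let psi_le (t x : R) : 0 < t -> psi t x <= x.
Proof.
move=> t0; rewrite /psi ler_pdivrMl//.
by have := expR_ge1Dx (- (t * x)); lra.
Qed.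

Let psi_ge (t x : R) : 0 < t -> x * expR (- (t * x)) <= psi t x.
Proof.
move=> t0; rewrite /psi ler_pdivlMl// mulrA.
have e0 := expR_gt0 (- (t * x)).
have : expR (- (t * x)) * (1 + t * x) <= 1.
  rewrite -[leRHS](expR0 R) -[in leRHS](addNr (t * x)) expRD ler_wpM2l ?(ltW e0)//.
  exact: expR_ge1Dx.
by rewrite mulrDr mulr1 mulrC; lra.
Qed.

(** A majorant free of t. For negative x the lower bound 1 - exp (- x) is the convexity bound
    [expR_mul_le], which is where t <= 1 enters. *)
Let psi_norm (t x : R) : 0 < t <= 1 -> `|psi t x| <= `|x| + expR (- x).
Proof.
move=> /andP[t0 t1]; have e0 := expR_gt0 (- x).
have [x0|x0] := leP 0 x.
  rewrite ger0_norm.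
    by rewrite (le_trans (psi_le x t0))// ger0_norm// lerDl ltW.
  by rewrite (le_trans _ (psi_ge x t0))// mulr_ge0// expR_ge0.
rewrite ler0_norm; last by rewrite (le_trans (psi_le x t0))// ltW.
have : 1 - expR (- x) <= psi t x.
  rewrite /psi ler_pdivlMl//.
  have /expR_mul_le -/(_ (- x)) : 0 <= t <= 1 by rewrite ltW.
  by rewrite mulrN; lra.
by rewrite ltr0_norm//; lra.
Qed.

Let psi_cvg (x : R) : psi (harmonic j) x @[j --> \oo] --> x.
Proof.
have h0 (j : nat) : 0 < harmonic j :> R by rewrite invr_gt0.
apply: (squeeze_cvgr (f := fun j => x * expR (- (harmonic j * x))) (h := fun=> x)).
- by apply: nearW => j; rewrite psi_ge//= psi_le.
- rewrite -[X in _ --> X]mulr1; apply: cvgMr.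
  rewrite -(expR0 R); apply: continuous_cvg; first exact: continuous_expR.
  rewrite -[X in _ --> X]oppr0; apply: cvgN; rewrite -[X in _ --> X](mul0r x).
  by apply: cvgMl; exact: cvg_harmonic.
exact: cvg_cst.
Qed.

Local Open Scope ereal_scope.

(** By dominated convergence the mean of psi_t (f) tends to that of f; the majorant |f| + exp (- f)
    is integrable since exp (- f) has mean 1. Some t then makes the mean of psi_t (f) exceed r, that
    is E exp (- t f) < 1 - t r <= exp (- t r). *)
Lemma chernoff_exponent d (T : measurableType d) (P : probability T R) (f : T -> R) (r : R) :
  P.-integrable setT (EFin \o f) -> \int[P]_x (expR (- f x))%:E = 1 ->
  r%:E < \int[P]_x (f x)%:E ->
  exists2 t : R, (0 < t <= 1)%R & \int[P]_x (expR (- (t * f x)))%:E <= (expR (- (t * r)))%:E.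
Proof.
move=> fi f1 rf; have [mf _] := integrableP _ _ _ fi.
have mf' : measurable_fun setT f by apply/measurable_EFinP.
have me (t : R) : measurable_fun setT (fun x => expR (- (t * f x)))%R.
  apply: measurableT_comp => //; apply: measurableT_comp => //.
  exact: measurable_funM.
have ei : P.-integrable setT (fun x => (expR (- f x))%:E).
  apply/integrableP; split; first by apply/measurable_EFinP; do 2 apply: measurableT_comp => //.
  by under eq_integral do rewrite /= ger0_norm ?expR_ge0//; rewrite f1 ltry.
pose g x := `|f x|%:E + (expR (- f x))%:E.
have gi : P.-integrable setT g.
  by apply: integrableD => //; exact: (integrable_norm fi).
have mpsi (j : nat) : measurable_fun setT (fun x => (psi (harmonic j) (f x))%:E).
  by apply/measurable_EFinP; apply: measurable_funM => //; exact: measurable_funB.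
have cv : \int[P]_x (psi (harmonic j) (f x))%:E @[j --> \oo] --> \int[P]_x (f x)%:E.
  have pc : {ae P, forall x, setT x ->
      (fun j => (psi (harmonic j) (f x))%:E) @ \oo --> (EFin \o f) x}.
    by apply: aeW => x _; apply: cvg_EFin; [exact: nearW|exact: psi_cvg].
  have pg : {ae P, forall x j, setT x -> `|(psi (harmonic j) (f x))%:E| <= g x}.
    apply: aeW => x j _; rewrite /g -EFinD lee_fin psi_norm//.
    by rewrite invr_gt0 ltr0n/= invf_le1// ler1n.
  by have [] := dominated_convergence measurableT mpsi mf pc gi pg.
have [j rj] : exists j, r%:E < \int[P]_x (psi (harmonic j) (f x))%:E.
  apply: contrapT => /forallNP rj; move: rf; rewrite ltNge => /negP; apply.
  move/cvg_lim : (cv) => <-//; apply: lime_le; first by apply/cvg_ex; eexists; exact: cv.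
  by apply: nearW => j; rewrite leNgt; apply/negP; exact: rj.
set t : R := harmonic j; rewrite -/t in rj.
have t0 : (0 < t)%R by rewrite invr_gt0.
have t1 : (t <= 1)%R by rewrite invf_le1// ler1n.
exists t; first by rewrite t0.
have eti : P.-integrable setT (fun x => (expR (- (t * f x)))%:E).
  apply: (le_integrable measurableT _ _ (integrableD measurableT
    (integrable_probability_cst P 1) ei)).
    by apply/measurable_EFinP.
  move=> x _; rewrite /= !ger0_norm ?addr_ge0 ?expR_ge0//.
  have /expR_mul_le -/(_ (- f x)%R) : (0 <= t <= 1)%R by rewrite ltW.
  by rewrite lee_fin mulrN; have := expR_ge0 (- f x)%R; nra.
move: rj; under eq_integral do rewrite EFinM.
rewrite integralZl//; last first.
  by under eq_fun do rewrite EFinB; apply: integrableB => //; exact: integrable_probability_cst.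
under eq_integral do rewrite EFinB.
rewrite integralB//; last exact: integrable_probability_cst.
rewrite integral_probability_cst.
have Ef : \int[P]_x (expR (- (t * f x)))%:E \is a fin_num by exact: integrable_fin_num.
rewrite -(fineK Ef) -EFinB -EFinM lte_fin lee_fin ltr_pdivlMl//.
by have := expR_ge1Dx (- (t * r))%R; lra.
Qed.

End chernoff.

Lemma ge0_integrable (R : realType) d (T : measurableType d) (P : probability T R)
    (f : T -> R) (r : R) : measurable_fun setT f -> (forall x, (0 <= f x)%R) ->
  (\int[P]_x (f x)%:E = r%:E)%E -> P.-integrable setT (EFin \o f).
Proof.
move=> mf f0 fr; apply/integrableP; split; first exact/measurable_EFinP.
by under eq_integral do rewrite /= ger0_norm//; rewrite fr ltry.
Qed.

Lemma measurable_expRN (R : realType) d (T : measurableType d) (f : T -> R) :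
  measurable_fun setT f -> measurable_fun setT (fun x => expR (- f x)).
Proof. by move=> mf; apply: measurableT_comp => //; exact: measurableT_comp. Qed.

Lemma integral_ge0_combination (R : realType) d (T : measurableType d)
    (P : probability T R) (f g h : T -> R) (a b c : R) :
  measurable_fun setT f -> measurable_fun setT g -> measurable_fun setT h ->
  (forall x, (0 <= f x)%R) -> (forall x, (0 <= g x)%R) -> (forall x, (0 <= h x)%R) ->
  (\int[P]_x (f x)%:E = a%:E)%E -> (\int[P]_x (g x)%:E = b%:E)%E ->
  (\int[P]_x (h x)%:E = c%:E)%E ->
  P.-integrable setT (EFin \o (fun x => f x + g x - h x)) /\
  (\int[P]_x (f x + g x - h x)%:E = (a + b - c)%:E)%E.
Proof.
move=> mf mg mh f0 g0 h0 fa gb hc.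
have fi := ge0_integrable mf f0 fa; have gi := ge0_integrable mg g0 gb.
have hi := ge0_integrable mh h0 hc.
have fgi : P.-integrable setT ((EFin \o f) \+ (EFin \o g))%E by exact: integrableD.
have -> : EFin \o (fun x => f x + g x - h x) = (((EFin \o f) \+ (EFin \o g)) \- (EFin \o h))%E.
  by apply/funext => x; rewrite /= EFinB EFinD.
split; first exact: integrableB.
under eq_integral do rewrite EFinB EFinD.
by rewrite (integralB measurableT fgi hi) (integralD measurableT fi gi) fa gb hc.
Qed.

Lemma ge0_integral_le_scale (R : realType) d (T : measurableType d)
    (P : probability T R) (f g : T -> R) (c : R) :
  measurable_fun setT f -> measurable_fun setT g ->
  (forall x, 0 <= f x) -> (forall x, 0 <= g x) -> 0 <= c ->
  (forall x, f x <= c * g x) -> (\int[P]_x (f x)%:E <= c%:E * \int[P]_x (g x)%:E)%E.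
Proof.
move=> mf mg f0 g0 c0 fg; rewrite -ge0_integralZl//; first last.
- by move=> x _; rewrite lee_fin.
- exact/measurable_EFinP.
apply: ge0_le_integral => //.
- by move=> x _; rewrite lee_fin.
- exact/measurable_EFinP.
- by apply: emeasurable_funM => //; exact/measurable_EFinP.
- by move=> x _; rewrite -EFinM lee_fin.
Qed.

(** * The exponent of the mixture score under the true channel *)

Section channel_exponent.
Local Open Scope ereal_scope.
Context (R : realType) (cs : construction) (n p q : nat) (v : R).
Hypotheses (v0 : (0 < v)%R) (qn : (q <= n)%N).
Local Notation k := (signal_dim cs n q).
Local Notation gA := (gaussian_matrix 1 p n).
Local Notation gz := (gaussian_matrix v p 1).
Local Notation gc := (gaussian_matrix 1 k 1).
Local Notation V := ('M[R[i]]_(p, n) * ('cV[R[i]]_p * 'cV[R[i]]_k))%type.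
Implicit Types x : V.

Section fixed_support.
Variables (s : {set 'I_n}) (J : R).
Hypothesis (JE : \int[gA]_a (logdet v (a *m sel R cs q s))%:E = J%:E).
Let G (a : 'M[R[i]]_(p, n)) := (a *m sel R cs q s)%R.
Let y x := (G x.1 *m x.2.2 + x.2.1)%R.

Definition log_score x : R := ln (score v (G x.1) x.2.2 (y x)).

Let mG : measurable_fun setT (fun x => G x.1).
Proof. exact: measurable_mulmx. Qed.

Let mz : measurable_fun setT (fun x => x.2.1).
Proof. exact: (measurableT_comp measurable_fst). Qed.

Let mc : measurable_fun setT (fun x => x.2.2).
Proof. exact: (measurableT_comp measurable_snd). Qed.

Let my : measurable_fun setT y.
Proof. by apply: measurable_addmx => //; exact: measurable_mulmx. Qed.

Lemma measurable_log_score : measurable_fun setT log_score.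
Proof.
apply: (measurableT_comp (@measurable_ln R)).
exact: (measurable_score v0 mG mc my).
Qed.

Let L x : R := logdet v (G x.1).
Let E x : R := energy v (G x.1) (y x).
Let Z x : R := (qform 1%:M x.2.1 / v)%R.

Let log_scoreE x : log_score x = (L x + E x - Z x)%R.
Proof. by rewrite /log_score ln_scoreE// /y (addrAC (G x.1 *m x.2.2)) subrr add0r. Qed.

Let mL : measurable_fun setT L.
Proof. exact: measurable_fun_logdet. Qed.

Let mE : measurable_fun setT E.
Proof. exact: (measurable_energy v0 mG my). Qed.

Let mZ : measurable_fun setT Z.
Proof. by apply: measurable_funM => //; exact: measurable_fun_qform. Qed.

Let L0 x : (0 <= L x)%R. Proof. exact: logdet_ge0. Qed.
Let E0 x : (0 <= E x)%R. Proof. exact: energy_ge0. Qed.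
Let Z0 x : (0 <= Z x)%R. Proof. by rewrite divr_ge0 ?qform1_ge0// ltW. Qed.

Let integral_L : \int[gA \x (gz \x gc)]_x (L x)%:E = J%:E.
Proof.
rewrite ge0_integral_prod ?lee_fin//; last exact/measurable_EFinP.
rewrite -JE; apply: eq_integral => a _.
exact: (integral_probability_cst (gz \x gc) (logdet v (G a))).
Qed.

Let integral_E : \int[gA \x (gz \x gc)]_x (E x)%:E = p%:R%:E.
Proof.
have mE' : measurable_fun setT (fun x => (E x)%:E) by exact/measurable_EFinP.
rewrite ge0_integral_prod ?lee_fin//.
transitivity (\int[gA]_a (p%:R : R)%:E); last exact: integral_probability_cst.
apply: eq_integral => a _; rewrite -(integral_output_energy v0 (G a)).
have mEa : measurable_fun setT (fun zc => (E (a, zc))%:E) by exact: (measurableT_comp mE').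
by rewrite (fubini_tonelli2 _ mEa)// => zc; rewrite lee_fin.
Qed.

Let integral_Z : \int[gA \x (gz \x gc)]_x (Z x)%:E = p%:R%:E.
Proof.
have mZ' : measurable_fun setT (fun x => (Z x)%:E) by exact/measurable_EFinP.
rewrite ge0_integral_prod ?lee_fin//.
transitivity (\int[gA]_a (p%:R : R)%:E); last exact: integral_probability_cst.
apply: eq_integral => a _; rewrite -(integral_noise_energy v0 p).
have mZa : measurable_fun setT (fun zc => (Z (a, zc))%:E) by exact: (measurableT_comp mZ').
rewrite (ge0_integral_prod _ _ mZa); last by move=> zc; rewrite lee_fin.
apply: eq_integral => z _.
exact: (integral_probability_cst gc (qform 1%:M z / v)).
Qed.

Let log_score_combination : (gA \x (gz \x gc)).-integrable setT (EFin \o log_score) /\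
  \int[gA \x (gz \x gc)]_x (log_score x)%:E = J%:E.
Proof.
have [i e] := integral_ge0_combination mL mE mZ L0 E0 Z0 integral_L integral_E integral_Z.
have lE : log_score = (fun x => L x + E x - Z x)%R by apply/funext => x; exact: log_scoreE.
by rewrite lE; split => //; rewrite e addrK.
Qed.

Lemma integrable_log_score : (gA \x (gz \x gc)).-integrable setT (EFin \o log_score).
Proof. by have [] := log_score_combination. Qed.

Lemma integral_log_score : \int[gA \x (gz \x gc)]_x (log_score x)%:E = J%:E.
Proof. by have [] := log_score_combination. Qed.

(** The score is the density of the joint law with respect to the product of its marginals, so the
    mean of its inverse under the joint law is the total mass of that product. *)
Lemma integral_inverse_score :
  \int[gA \x (gz \x gc)]_x (expR (- log_score x))%:E = 1.
Proof.
have ml := measurable_log_score.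
have me : measurable_fun setT (fun x => (expR (- log_score x))%:E).
  by apply/measurable_EFinP; exact: measurable_expRN.
rewrite ge0_integral_prod//.
transitivity (\int[gA]_a (1 : R)%:E); last exact: integral_probability_cst.
apply: eq_integral => a _.
pose mus := image_law (gz \x gc) (measurable_joint_map (G a)).
have musE B : measurable B -> mus B = (gz \x gc) (joint_map (G a) @^-1` B) by [].
pose e (x : 'cV[R[i]]_k * 'cV[R[i]]_p) := (expR (- ln (score v (G a) x.1 x.2)))%:E.
have ms : measurable_fun setT (fun x : 'cV[R[i]]_k * 'cV[R[i]]_p => score v (G a) x.1 x.2).
  exact: measurable_score.
have mes : measurable_fun setT e.
  apply/measurable_EFinP; apply: measurable_expRN.
  exact: (measurableT_comp (@measurable_ln R) ms).
have es0 u : 0 <= e u by rewrite lee_fin expR_ge0.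
have sc0 (u : 'cV[R[i]]_k * 'cV[R[i]]_p) : (0 <= score v (G a) u.1 u.2)%R by rewrite ltW// score_gt0.
rewrite -(ge0_integral_image (measurable_joint_map (G a)) musE mes es0).
rewrite (ge0_integral_density ms sc0 (joint_density v0 musE) mes es0).
transitivity (\int[distribution mus fst \x distribution mus snd]_x (1 : R)%:E).
  apply: eq_integral => x _; rewrite /e -EFinM expRN lnK ?posrE ?score_gt0//.
  by rewrite mulVf// gt_eqF// score_gt0.
exact: integral_probability_cst.
Qed.

End fixed_support.

Variable beta : probability {set 'I_n} R.
Hypothesis ubeta : uniform_support beta q id.
Variables (J r : R).
Local Notation W := ({set 'I_n} * V)%type.
Hypotheses (JE : forall s : {set 'I_n}, #|s| = q ->
    \int[gA]_a (logdet v (a *m sel R cs q s))%:E = J%:E) (rJ : (r < J)%R).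

(** The log score of the true support; on supports of a wrong size, which [beta] does not charge, it
    is set to 0. *)
Let F (sx : {set 'I_n} * V) : R := if #|sx.1| == q then log_score sx.1 sx.2 else 0%R.

Let mF : measurable_fun setT F.
Proof.
apply: measurable_fun_finset_fst => s; rewrite /F /=; case: (#|s| == q) => //.
exact: measurable_log_score.
Qed.

Let C0 : (0 < 'C(n, q)%:R :> R)%R. Proof. by rewrite ltr0n bin_gt0. Qed.

Let sumC (x : R) : \sum_(s : {set 'I_n} | #|s| == q) ('C(n, q)%:R^-1)%:E * x%:E = x%:E.
Proof.
under eq_bigr do rewrite -EFinM.
by rewrite sumEFin sum_support mulrA mulfV ?mul1r// gt_eqF.
Qed.

Let output (u : {set 'I_n} * ('M[R[i]]_(p, n) * 'cV[R[i]]_p)) (c : 'cV[R[i]]_k) :=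
  channel_output cs u.2.1 u.2.2 u.1 c.

Let g (rho : R) (sx : {set 'I_n} * V) : R :=
  (mixture_score v sx.2.1 sx.2.2.2 (channel_output cs sx.2.1 sx.2.2.1 sx.1 sx.2.2.2) `^ (- rho))%R.

(** Chernoff's bound is applied to the score of the true support; passing to the mixture costs the
    factor C(n, q)^rho, which lowers the exponent r by ln C(n, q). *)
Lemma mixture_score_exponent : exists2 rho : R, (0 < rho <= 1)%R &
  \int[beta \x (gA \x gz)]_u \int[gc]_c
    (mixture_score v u.2.1 c (output u c) `^ (- rho))%:E
  <= (expR (- (rho * (r - ln 'C(n, q)%:R))))%:E.
Proof.
have Fi (s : {set 'I_n}) : #|s| == q -> (gA \x (gz \x gc)).-integrable setT (fun x => (F (s, x))%:E).
  move=> sq; rewrite /F /= sq; exact: (integrable_log_score (JE (eqP sq))).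
have me (rho : R) : measurable_fun setT (fun w : W => (expR (- (rho * F w)))%:E).
  by apply/measurable_EFinP; apply: measurable_expRN; exact: measurable_funM.
have e0 (rho : R) (x : W) : 0 <= (expR (- (rho * F x)))%:E by rewrite lee_fin expR_ge0.
have [||rho rho01 Hrho] := chernoff_exponent (f := F) (r := r) (integrable_support_prod ubeta mF Fi).
- have me1 := me 1%R; have e1 := e0 1%R.
  under eq_integral do rewrite -[F _]mul1r.
  rewrite (ge0_integral_support_prod ubeta _ me1 e1) -[RHS](sumC 1).
  apply: eq_bigr => s sq; congr (_ * _).
  rewrite -(integral_inverse_score s); apply: eq_integral => x _.
  by rewrite /F /= sq mul1r.
- rewrite (integral_support_prod ubeta mF Fi).
  rewrite (eq_bigr (fun=> ('C(n, q)%:R^-1)%:E * J%:E)); first by rewrite sumC lte_fin.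
  move=> s sq; congr (_ * _); rewrite -(integral_log_score (JE (eqP sq))).
  by apply: eq_integral => x _; rewrite /F /= sq.
exists rho => //.
have [rho0 rho1] := andP rho01.
have mx : measurable_fun setT (fun w : W => w.2) by [].
have ma : measurable_fun setT (fun w : W => w.2.1) by exact: (measurableT_comp measurable_fst mx).
have mzc : measurable_fun setT (fun w : W => w.2.2) by exact: (measurableT_comp measurable_snd mx).
have mz : measurable_fun setT (fun w : W => w.2.2.1) by exact: (measurableT_comp measurable_fst mzc).
have mc : measurable_fun setT (fun w : W => w.2.2.2) by exact: (measurableT_comp measurable_snd mzc).
have mg : measurable_fun setT (fun w : W => (g rho w)%:E).
  apply/measurable_EFinP; apply: (measurableT_comp (measurable_powR _)).
  apply: (measurable_mixture_score v0 ma mc).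
  by apply: measurable_channel_output.
have g0 (w : W) : 0 <= (g rho w)%:E by rewrite lee_fin powR_ge0.
(* Random coding draws the state (b, (A, z)) and then the signal, whereas the scores were integrated
   with z and c grouped; Tonelli's theorem reconciles the two orders. *)
have -> : \int[beta \x (gA \x gz)]_u \int[gc]_c
    (mixture_score v u.2.1 c (output u c) `^ (- rho))%:E =
    \int[beta \x (gA \x (gz \x gc))]_w (g rho w)%:E.
  pose h (uc : ({set 'I_n} * ('M[R[i]]_(p, n) * 'cV[R[i]]_p)) * 'cV[R[i]]_k) : W :=
    (uc.1.1, (uc.1.2.1, (uc.1.2.2, uc.2))).
  have mh : measurable_fun setT h.
    have m2 : measurable_fun setT (fun uc : ({set 'I_n} * ('M[R[i]]_(p, n) * 'cV[R[i]]_p)) * 'cV[R[i]]_k => uc.1.2).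
      exact: (measurableT_comp measurable_snd).
    apply: measurable_fun_pair; first exact: (measurableT_comp measurable_fst).
    apply: measurable_fun_pair; first exact: (measurableT_comp measurable_fst m2).
    by apply: measurable_fun_pair => //; exact: (measurableT_comp measurable_snd m2).
  have mgh := measurableT_comp mg mh.
  have gh0 uc : 0 <= (g rho (h uc))%:E by [].
  have mH := @measurable_fun_fubini_tonelli_F _ _ _ _ _ gc (fun uc => (g rho (h uc))%:E) mgh gh0.
  have H0 u : 0 <= \int[gc]_c (g rho (h (u, c)))%:E by apply: integral_ge0 => c _.
  etransitivity; first exact: (ge0_integral_prod beta (gA \x gz) mH H0).
  rewrite (ge0_integral_prod _ _ mg g0); apply: eq_integral => s _.
  have mgs : measurable_fun setT (fun x => (g rho (s, x))%:E) by exact: (measurableT_comp mg).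
  have mHs : measurable_fun setT (fun az => \int[gc]_c (g rho (h ((s, az), c)))%:E).
    exact: (measurableT_comp mH).
  etransitivity; first exact: (ge0_integral_prod gA gz mHs (fun az => H0 (s, az))).
  rewrite (ge0_integral_prod _ _ mgs (fun x => g0 (s, x))); apply: eq_integral => a _.
  have mgsa : measurable_fun setT (fun zc => (g rho (s, (a, zc)))%:E).
    exact: (measurableT_comp mgs).
  by rewrite (ge0_integral_prod _ _ mgsa (fun zc => g0 (s, (a, zc)))).
rewrite (ge0_integral_support_prod ubeta _ mg g0).
pose nu : probability V R := (gA \x (gz \x gc))%E.
(* Support by support, the mixture score is at least the true score over C(n, q), and the negative
   power [- rho] reverses the inequality. *)
apply: (@le_trans _ _ (\sum_(s : {set 'I_n} | #|s| == q) ('C(n, q)%:R^-1)%:E *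
   (('C(n, q)%:R `^ rho)%:E * \int[nu]_x (expR (- (rho * F (s, x))))%:E))).
  apply: lee_sum => s sq; rewrite lee_wpmul2l ?lee_fin ?invr_ge0//.
  have mes : measurable_fun setT (fun x => expR (- (rho * F (s, x)))).
    by apply/measurable_EFinP; exact: (measurableT_comp (me rho)).
  have mgs : measurable_fun setT (fun x => g rho (s, x)).
    by apply/measurable_EFinP; exact: (measurableT_comp mg).
  apply: (ge0_integral_le_scale nu mgs mes _ _ (powR_ge0 _ _)).
  - by move=> x; exact: powR_ge0.
  - by move=> x; exact: expR_ge0.
  move=> x; rewrite /g /F /= sq.
  rewrite /powR !gt_eqF ?mixture_score_gt0// -expRD ler_expR.
  rewrite channel_outputE.
  pose y := ((x.1 *m sel R cs q s) *m x.2.2 + x.2.1)%R; rewrite -/y.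
  have h := mixture_score_ge v0 x.1 x.2.2 y sq; rewrite mulrC in h.
  have sc0 := score_gt0 v0 (x.1 *m sel R cs q s)%R x.2.2 y.
  have ms0 := mixture_score_gt0 v0 qn x.1 x.2.2 y.
  have : (log_score s x - ln 'C(n, q)%:R <= ln (mixture_score v x.1 x.2.2 y))%R.
    by rewrite -ln_div ?posrE// ler_ln ?posrE// divr_gt0.
  by rewrite -(ler_pM2l rho0); lra.
rewrite (eq_bigr (fun s : {set 'I_n} => ('C(n, q)%:R `^ rho)%:E * (('C(n, q)%:R^-1)%:E *
   \int[nu]_x (expR (- (rho * F (s, x))))%:E))); last first.
  by move=> s _; rewrite muleCA.
rewrite -ge0_sume_distrr; last first.
  by move=> s _; apply: mule_ge0; [rewrite lee_fin invr_ge0|exact: integral_ge0].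
rewrite -(ge0_integral_support_prod ubeta _ (me rho) (e0 rho)).
apply: (@le_trans _ _ (('C(n, q)%:R `^ rho)%:E * (expR (- (rho * r)))%:E)).
  by rewrite lee_wpmul2l ?lee_fin ?powR_ge0.
rewrite -EFinM lee_fin /powR gt_eqF// -expRD ler_expR; lra.
Qed.

End channel_exponent.

(** * Codes for the sparse channel *)

(** Independence is stated for lists without repetition; the injection [g] turns a finite family of
    events into such a list. *)
Lemma mutually_independent_fin d (T : measurableType d) (R : realType)
    (P : probability T R) (I : eqType) (F : I -> set (set T)) (J : finType) (g : J -> I)
    (E : J -> set T) :
  mutually_independent P F -> injective g -> (forall j, F (g j) (E j)) ->
  P [set w | forall j, E j w] = (\prod_j P (E j))%E.
Proof.
move=> ind gI FE.
pose E' i := if [pick j | g j == i] is Some j then E j else set0.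
have E'g j : E' (g j) = E j.
  by rewrite /E'; case: pickP => [l /eqP/gI ->//|/(_ j)]; rewrite eqxx.
have := ind (map g (index_enum J)) E'; rewrite map_inj_uniq ?index_enum_uniq//.
rewrite !big_map (eq_bigr E) => [|j _]; last exact: E'g.
rewrite (eq_bigr (fun j => P (E j))) => [|j _]; last by rewrite E'g.
rewrite bigsetI_finE => /(_ isT); apply => _ /mapP[j _ ->]; rewrite E'g; exact: FE.
Qed.

(** The law of the support is prescribed on singletons only, and on a finite discrete space these
    generate everything. *)
Lemma pi_generator_finset (I : finType) :
  pi_generator [set B : set {set I} | B = setT \/ exists s, B `<=` [set s]].
Proof.
split => //.
- by left.
- move=> B B' [->|[s Bs]]; first by rewrite setTI.
  by move=> _; right; exists s; apply: subset_trans Bs => x [].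
move=> B _.
rewrite (_ : B = \bigcup_i (if unpickle i is Some s then
   (if s \in B then [set s] else set0) else set0)).
  apply: sigma_algebra_bigcup => i; case: unpickle => [s|]; last exact: sigma_algebra0.
  by case: ifP => _; [apply: sub_sigma_algebra; right; exists s|exact: sigma_algebra0].
apply/seteqP; split => [s Bs|s [i _]].
  by exists (pickle s) => //; rewrite pickleK mem_set.
by case: unpickle => [s'|//]; case: ifPn => // /set_mem Bs /= ->.
Qed.

Lemma product_probability_rectangle (R : realType) d1 d2 (T1 : measurableType d1)
    (T2 : measurableType d2) (P : probability T1 R) (Q : probability T2 R) A B :
  measurable A -> measurable B ->
  ((P \x Q)%E : probability (T1 * T2)%type R) (A `*` B) = (P A * Q B)%E.
Proof. by move=> mA mB; exact: product_measure1E. Qed.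

Section channel_uses.
Local Open Scope ereal_scope.
Context (R : realType) (cs : construction) (n p q : nat) (v : R).
Context d (T : measurableType d) (P : probability T R).
Variables (A : nat -> T -> 'M[R[i]]_(p, n)) (z : nat -> T -> 'cV[R[i]]_p)
  (b : nat -> T -> {set 'I_n}).
Hypotheses (mA : forall t, measurable_fun setT (A t)) (mz : forall t, measurable_fun setT (z t))
  (mb : forall t, measurable_fun setT (b t)).
Hypotheses (iA : forall t, iid_complex_normal P 1 (A t))
  (iz : forall t, iid_complex_normal P v (z t)) (ub : forall t, uniform_support P q (b t)).
Hypothesis ind : mutually_independent P (fun ti : nat * 'I_3 =>
  tnth [tuple g_sigma_algebra_preimage (A ti.1); g_sigma_algebra_preimage (z ti.1);
              g_sigma_algebra_preimage (b ti.1)] ti.2).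

(** All uses share one support law, so that of use 0 stands for each of them. *)
Definition channel_state_law : probability ({set 'I_n} * ('M[R[i]]_(p, n) * 'cV[R[i]]_p))%type R :=
  (image_law P (mb 0%N) \x (gaussian_matrix 1 p n \x gaussian_matrix v p 1))%E.

(* Channel use 0 is left out: the codes spend it on adjusting the power. *)
Definition channel_states N (w : T) : N.-tuple ({set 'I_n} * ('M[R[i]]_(p, n) * 'cV[R[i]]_p)) :=
  [tuple (b t.+1 w, (A t.+1 w, z t.+1 w)) | t < N].

Lemma measurable_channel_states N : measurable_fun setT (channel_states N).
Proof.
apply/measurable_fun_tnthP => t.
rewrite (_ : _ \o _ = fun w => (b t.+1 w, (A t.+1 w, z t.+1 w))).
  by do 2 apply: measurable_fun_pair => //.
by apply/funext => w; rewrite /= tnth_mktuple.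
Qed.

Let law_support t B : P (b t @^-1` B) = image_law P (mb 0%N) B.
Proof.
rewrite -(image_lawE P (mb t)); apply: (eq_probability_pi (pi_generator_finset _)) => //.
move=> {}B [->|[s Bs]]; first by rewrite !probability_setT.
have [->|->] : B = set0 \/ B = [set s].
- have [Bs'|Bs'] := pselect (B s); [right|left].
    by apply/seteqP; split => // _ ->.
  by apply/seteqP; split => // x Bx; apply: Bs'; rewrite -(Bs _ Bx).
- by rewrite !measure0.
exact: (etrans (ub t s) (esym (ub 0%N s))).
Qed.

(** On rectangles, independence of all the A, z and b over time turns the probability into a product
    over uses, each factor being a product of three laws. *)
Lemma channel_states_law N B : measurable B ->
  iid_law channel_state_law N B = P (channel_states N @^-1` B).
Proof.
move: B; suff H : forall B, measurable B -> iid_law channel_state_law N B =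
    image_law P (@measurable_channel_states N) B by exact: H.
have PG := pi_generator_tuple N (pi_generator_prod (@pi_generator_measurable _ {set 'I_n})
  (pi_generator_prod (@pi_generator_measurable _ 'M[R[i]]_(p, n))
    (@pi_generator_measurable _ 'cV[R[i]]_p))).
have := eq_probability_pi (P := iid_law channel_state_law N)
  (Q := image_law P (@measurable_channel_states N)) PG.
apply.
move=> _ [E CE <-].
have /choice[F FP] i : exists F : set {set 'I_n} * (set 'M[R[i]]_(p, n) * set 'cV[R[i]]_p),
    [/\ measurable F.1, measurable F.2.1, measurable F.2.2 & E i = F.1 `*` (F.2.1 `*` F.2.2)].
  by have [B1 m1 [_ [B2 m2 [B3 m3 <-]] <-]] := CE i; exists (B1, (B2, B3)).
have mE i : measurable (E i).
  by have [m1 m2 m3 ->] := FP i; apply: measurableX => //; exact: measurableX.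
rewrite iid_law_rectangle// image_lawE.
(* The shift by one skips use 0; injectivity embeds the 3 N events into the independent family
   indexed by time and kind. *)
pose G (ti : 'I_N * 'I_3) := (ti.1.+1, ti.2).
pose S (ti : 'I_N * 'I_3) := tnth [tuple A ti.1.+1 @^-1` (F ti.1).2.1;
  z ti.1.+1 @^-1` (F ti.1).2.2; b ti.1.+1 @^-1` (F ti.1).1] ti.2.
have GI : injective G by move=> [t j] [t' j'] [/val_inj -> ->].
have := mutually_independent_fin (E := S) ind GI.
have -> : (fun w => channel_states N w) @^-1` [set u | forall i, E i (tnth u i)] =
    [set w | forall ti, S ti w].
  apply/seteqP; split => [w Ew [t j]|w Sw t].
    have := Ew t; have [_ _ _ ->] := FP t; rewrite /= tnth_mktuple => -[/= bF [AF zF]].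
    by rewrite /S/=; case: j => -[|[|[|]]]// ?; rewrite (tnth_nth set0).
  have [_ _ _ ->] := FP t; rewrite tnth_mktuple.
  have s0 := Sw (t, @Ordinal 3 0 isT); have s1 := Sw (t, @Ordinal 3 1 isT).
  have s2 := Sw (t, @Ordinal 3 2 isT); rewrite /S /= !(tnth_nth set0)/= in s0 s1 s2.
  by [].
move=> ->; last first.
  move=> [t j]; have [m1 m2 m3 _] := FP t.
  by rewrite /S /G/=; case: j => -[|[|[|]]]// ?; rewrite !(tnth_nth set0)/=;
    [exists (F t).2.1|exists (F t).2.2|exists (F t).1]; rewrite ?setTI.
rewrite -(pair_bigA _ (fun t j => P (S (t, j))))/=; apply: eq_bigr => t _.
have [m1 m2 m3 ->] := FP t.
rewrite !big_ord_recl big_ord0 mule1 /S !(tnth_nth set0)/=.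
rewrite law_support [RHS]muleA [RHS]muleC.
have m23 : measurable ((F t).2.1 `*` (F t).2.2) by exact: measurableX.
etransitivity; first exact: (product_probability_rectangle _ _ m1 m23).
congr (_ * _); etransitivity; first exact: (product_probability_rectangle _ _ m2 m3).
congr (_ * _); apply/esym.
  exact: (iid_complex_normal_law (mA _) (iA _)).
exact: (iid_complex_normal_law (mz _) (iz _)).
Qed.

End channel_uses.

Section signal_energy.
Local Open Scope ereal_scope.
Context (R : realType) (k : nat).

Definition signal_energy (c : 'cV[R[i]]_k) : R := (\sum_j nsq (c j 0%R))%R.

Lemma signal_energy_ge0 c : (0 <= signal_energy c)%R.
Proof. by apply: sumr_ge0 => j _; exact: nsq_ge0. Qed.

Lemma measurable_signal_energy : measurable_fun setT signal_energy.
Proof.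
apply: measurable_sum => j.
exact: (measurableT_comp (@measurable_nsq R) (measurable_entry j 0%R)).
Qed.

Lemma integral_signal_energy : \int[gaussian_matrix 1 k 1]_c (signal_energy c)%:E = k%:R%:E.
Proof.
rewrite ge0_integral_gaussian_col; first last.
- by move=> c; rewrite lee_fin signal_energy_ge0.
- by apply/measurable_EFinP; exact: measurable_signal_energy.
under eq_integral do rewrite /signal_energy -sumEFin.
have mn : measurable_fun setT (fun x : R[i] => (nsq x)%:E).
  by apply/measurable_EFinP; exact: measurable_nsq.
have mt (j : 'I_k) : measurable_fun setT (fun u : k.-tuple R[i] => (nsq (tnth u j))%:E).
  exact: (measurableT_comp mn (@measurable_tnth _ _ _ j)).
transitivity (\int[iid_law (cnormal (1 : R)) k]_u \sum_j (nsq (tnth u j))%:E).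
  by apply: eq_integral => u _; apply: eq_bigr => j _; rewrite mxE.
rewrite ge0_integral_sum//; last by move=> j u _; rewrite lee_fin nsq_ge0.
rewrite (eq_bigr (fun=> 1)) => [|j _]; last first.
  rewrite (integral_iid_tnth (cnormal (1 : R)) j mn); last by move=> x; rewrite lee_fin nsq_ge0.
  exact: integral_cnormal_nsq.
by rewrite sumEFin sumr_const card_ord.
Qed.

Lemma signal_energy_const (x : R) : (0 <= x)%R ->
  signal_energy (const_mx (Num.sqrt x)%:C) = (k%:R * x)%R.
Proof.
move=> x0; rewrite /signal_energy (eq_bigr (fun=> x)) => [|j _].
  by rewrite sumr_const card_ord mulr_natl.
by rewrite mxE /nsq /= expr0n/= addr0 sqr_sqrtr.
Qed.

End signal_energy.

(** * From a codebook to a block code of mean square exactly 1 *)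

Section codebook_code.
Local Open Scope ereal_scope.
Context (R : realType) (cs : construction) (n p q : nat) (v : R).
Hypotheses (v0 : (0 < v)%R) (qn : (q <= n)%N).
Local Notation k := (signal_dim cs n q).
Local Notation U := ({set 'I_n} * ('M[R[i]]_(p, n) * 'cV[R[i]]_p))%type.
Local Notation Y := ('cV[R[i]]_p * 'M[R[i]]_(p, n))%type.

Definition channel_use (cu : 'cV[R[i]]_k * U) : Y :=
  (channel_output cs cu.2.2.1 cu.2.2.2 cu.2.1 cu.1, cu.2.2.1).

(** The output includes the sensing matrix, so this score is a function of what the decoder sees. *)
Definition channel_score (c : 'cV[R[i]]_k) (y : Y) : R := mixture_score v y.2 c y.1.

Lemma measurable_channel_use : measurable_fun setT channel_use.
Proof.
have m22 : measurable_fun setT (fun cu : 'cV[R[i]]_k * U => cu.2.2).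
  exact: (measurableT_comp measurable_snd).
have mA : measurable_fun setT (fun cu : 'cV[R[i]]_k * U => cu.2.2.1).
  exact: (measurableT_comp measurable_fst m22).
apply: measurable_fun_pair => //; apply: measurable_channel_output => //.
  exact: (measurableT_comp measurable_snd m22).
exact: (measurableT_comp measurable_fst).
Qed.

Lemma measurable_channel_score :
  measurable_fun setT (fun cy : 'cV[R[i]]_k * Y => channel_score cy.1 cy.2).
Proof.
apply: measurable_mixture_score => //; first exact: (measurableT_comp measurable_snd).
exact: (measurableT_comp measurable_fst).
Qed.

Lemma channel_score_gt0 c y : (0 < channel_score c y)%R.
Proof. exact: mixture_score_gt0. Qed.

Context d (T : measurableType d) (P : probability T R).
Variables (A : nat -> T -> 'M[R[i]]_(p, n)) (z : nat -> T -> 'cV[R[i]]_p)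
  (b : nat -> T -> {set 'I_n}).
Hypotheses (mA : forall t, measurable_fun setT (A t)) (mz : forall t, measurable_fun setT (z t))
  (mb : forall t, measurable_fun setT (b t)).
Variables (N M : nat) (theta rho eps : R) (cw : 'I_M -> N.-tuple 'cV[R[i]]_k).
Hypotheses (M0 : (0 < M)%N) (theta0 : (0 < theta)%R) (rho0 : (0 < rho)%R) (k0 : (0 < k)%N).
Variable kappa : probability U R.
Hypothesis states_law : forall B, measurable B ->
  iid_law kappa N B = P (channel_states A z b N @^-1` B).
Hypothesis cw_error : \sum_m \int[iid_law kappa N]_u
  (error_bound channel_use channel_score rho theta cw m u)%:E <= (M%:R * eps)%:E.
Hypothesis cw_energy :
  (\sum_m \sum_t signal_energy (tnth (cw m) t) <= M%:R * (k * N.+1)%N%:R)%R.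

Let S : R := (\sum_m \sum_t signal_energy (tnth (cw m) t))%R.

(* Power left for the filler symbol sent in channel use 0. *)
Let x : R := ((M%:R * (k * N.+1)%N%:R - S) / (M * k)%N%:R)%R.

Let x0 : (0 <= x)%R. Proof. by rewrite divr_ge0 ?subr_ge0. Qed.

Definition codebook_encoder (m : 'I_M) (t : 'I_N.+1) : 'cV[R[i]]_k :=
  tnth [tuple of const_mx (Num.sqrt x)%:C :: cw m] t.

(** Discards use 0, whose symbol is the same for all messages. *)
Let data (y : N.+1.-tuple Y) : N.-tuple Y := [tuple tnth y (lift ord0 t) | t < N].

Definition codebook_decoder (y : N.+1.-tuple Y) : 'I_M :=
  threshold_decoder channel_score theta (Ordinal M0) cw (data y).

Let measurable_data : measurable_fun setT data.
Proof.
apply/measurable_fun_tnthP => t.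
rewrite (_ : _ \o _ = fun y => tnth y (lift ord0 t)); first exact: measurable_tnth.
by apply/funext => y; rewrite /= tnth_mktuple.
Qed.

Lemma measurable_codebook_decoder m : measurable (codebook_decoder @^-1` [set m]).
Proof.
have mD := measurable_threshold_decoder measurable_channel_score theta (Ordinal M0) cw m.
by rewrite -[X in measurable X]setTI; exact: (measurable_data measurableT mD).
Qed.

Definition codebook_code : block_code R k p n N.+1 :=
  BlockCode M0 codebook_encoder measurable_codebook_decoder.

Lemma mean_square_codebook_code : mean_square codebook_code = 1%R.
Proof.
have Mk : (0 < M%:R * k%:R :> R)%R by rewrite mulr_gt0// ltr0n.
have MN : (0 < (M * N.+1 * k)%N%:R :> R)%R by rewrite ltr0n !muln_gt0 M0 k0.
rewrite /mean_square /= (eq_bigr (fun m => k%:R * x + \sum_t signal_energy (tnth (cw m) t))%R).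
  have Mn : M%:R != 0%R :> R by rewrite pnatr_eq0 -lt0n.
  have kn : k%:R != 0%R :> R by rewrite pnatr_eq0 -lt0n.
  have Nn : N.+1%:R != 0%R :> R by rewrite pnatr_eq0.
  rewrite big_split/= sumr_const card_ord -/S -(mulr_natl _ M) /x !natrM.
  set m' := (M%:R : R) in Mn *; set k' := (k%:R : R) in kn *; set n' := (N.+1%:R : R) in Nn *.
  by clearbody m' k' n'; field; rewrite Mn kn Nn.
move=> m _; rewrite big_ord_recl; congr (_ + _)%R.
  rewrite -signal_energy_const//; apply: eq_bigr => j _.
by apply: eq_bigr => t _; rewrite /codebook_encoder tnthS.
Qed.

(** The indicator of an error is at most [error_bound] evaluated at the channel states, and these
    states have the i.i.d. law under which the codebook was selected. *)
Lemma error_probability_codebook_code : error_probability P A z b codebook_code <= eps%:E.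
Proof.
have MR0 : (0 < M%:R :> R)%R by rewrite ltr0n.
rewrite /error_probability /= lee_pdivrMl// -EFinM; apply: le_trans cw_error.
apply: lee_sum => m _.
pose f u := error_bound channel_use channel_score rho theta cw m u.
have mf : measurable_fun setT (fun u => (f u)%:E).
  apply/measurable_EFinP.
  have mb' := measurable_error_bound (N := N) rho measurable_channel_use measurable_channel_score theta m.
  have mp : measurable_fun setT (fun u : N.-tuple U => ([tuple cw m | m < M], u)).
    exact: measurable_fun_pair.
  have cwE : tnth [tuple cw m' | m' < M] = cw by apply/funext => m'; rewrite tnth_mktuple.
  have fE : f = (fun u => error_bound channel_use channel_score rho theta
      (tnth [tuple cw m' | m' < M]) m u) by rewrite cwE.
  by rewrite fE; exact: (measurableT_comp mb' mp).
have f0 u : 0 <= (f u)%:E by rewrite lee_fin; by apply: error_bound_ge0 => //; exact: channel_score_gt0.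
have ms : measurable_fun setT (channel_states A z b N) by exact: measurable_channel_states.
rewrite (ge0_integral_image ms states_law mf f0).
pose dec u := threshold_decoder channel_score theta (Ordinal M0) cw (tuple_output channel_use (cw m) u).
(* The received word has N + 1 entries and the states start at use 1; dropping the head aligns the
   two. *)
have decE w : codebook_decoder (received A z b (C := codebook_code) m w) =
    dec (channel_states A z b N w).
  rewrite /codebook_decoder /dec; congr threshold_decoder.
  apply: eq_from_tnth => t; rewrite !tnth_mktuple.
  by rewrite -(tnthS (const_mx (Num.sqrt x)%:C) (cw m) t).
have mdec : measurable (dec @^-1` [set m]).
  have mD := measurable_threshold_decoder measurable_channel_score theta (Ordinal M0) cw m.
  have mo : measurable_fun setT (fun u : N.-tuple U => tuple_output channel_use (cw m) u).
    exact: (measurable_tuple_output measurable_channel_use (measurable_cst _) (@measurable_id _ _ setT)).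
  by rewrite -[X in measurable X]setTI; exact: (mo measurableT _ mD).
have mE : measurable (~` ((fun w => dec (channel_states A z b N w)) @^-1` [set m])).
  by apply: measurableC; rewrite -[X in measurable X]setTI; exact: (ms measurableT _ mdec).
rewrite (_ : [set w | _] = ~` ((fun w => dec (channel_states A z b N w)) @^-1` [set m])); last first.
  by apply/seteqP; split => w /=; rewrite decE.
rewrite -[X in P X]setIT -(integral_indic P measurableT mE).
apply: ge0_le_integral => //.
- by apply/measurable_EFinP; exact: measurable_indic.
- exact: (measurableT_comp mf ms).
move=> w _; rewrite lee_fin indicE.
have := threshold_decoder_error channel_use channel_score_gt0 rho0 theta0 (Ordinal M0) cw m
  (channel_states A z b N w).
apply: le_trans; rewrite ler_nat; case: (boolP (w \in _)) => //.
by rewrite inE /= => /eqP; rewrite /dec => ->.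
Qed.

End codebook_code.

(** * From codes for each tolerance to one sequence of codes *)

Section achievability.
Context (R : realType) d (T : measurableType d) (P : probability T R).
Context (cs : construction) (n p q : nat).
Local Notation k := (signal_dim cs n q).
Variables (A : nat -> T -> 'M[R[i]]_(p, n)) (z : nat -> T -> 'cV[R[i]]_p)
  (b : nat -> T -> {set 'I_n}).
Hypothesis k0 : (0 < k)%N.

(** The power constraint is imposed at every length, so a code is also required at lengths too short
    for a good one; it settles the rate 0 as well. *)
Lemma exists_unit_power_code N : exists C : block_code R k p n N.+1,
  mean_square C = 1 /\ messages C = 1%N.
Proof.
pose dec (y : N.+1.-tuple ('cV[R[i]]_p * 'M[R[i]]_(p, n))) : 'I_1 := ord0.
have mdec m : measurable (dec @^-1` [set m]).
  rewrite (_ : _ @^-1` _ = setT)//; apply/seteqP; split => // y _.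
  by apply/val_inj; rewrite /= (ord1 m).
exists (BlockCode (ltnSn 0) (fun=> fun=> const_mx 1) mdec); split => //.
rewrite /mean_square /= big_ord1 (eq_bigr (fun=> k%:R)) => [|t _].
  rewrite sumr_const card_ord mul1n -mulrnA mulnC mulfV// pnatr_eq0 muln_eq0 negb_or/=.
  by rewrite -lt0n.
rewrite (eq_bigr (fun=> 1)) => [|j _]; first by rewrite sumr_const card_ord.
by rewrite mxE /= expr1n expr0n addr0.
Qed.

Lemma error_probability_ge0 N (C : block_code R k p n N) :
  (0 <= error_probability P A z b C)%E.
Proof.
by apply: mule_ge0; [rewrite lee_fin invr_ge0|apply: sume_ge0].
Qed.

Definition good_code (rate : R) N (eps : R) (C : block_code R k p n N.+1) : Prop :=
  (error_probability P A z b C <= eps%:E)%E /\ `|code_rate C - rate| <= eps.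

(** A diagonal choice: the code of each length is as good as that length allows, so that every fixed
    tolerance is eventually met. *)
Lemma achieved_of_good_codes (rate : R) :
  (forall eps, 0 < eps -> exists N0, forall N, (N0 <= N)%N ->
     exists2 C : block_code R k p n N.+1, mean_square C = 1 & good_code rate eps C) ->
  achieved P cs q A z b rate.
Proof.
move=> good; pose tol j : R := j.+1%:R^-1.
have tol0 j : 0 < tol j by rewrite invr_gt0.
pose G N j := exists2 C : block_code R k p n N.+1, mean_square C = 1 & good_code rate (tol j) C.
(* The best tolerance [1 / (j + 1)] with [j <= N] that length [N + 1] allows. *)
have best N : exists C : block_code R k p n N.+1, mean_square C = 1 /\
    forall j, (j <= N)%N -> G N j -> good_code rate (tol j) C.
  have [ex|nex] := pselect (exists j, (j <= N)%N && `[< G N j >]); last first.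
    have [C [C1 _]] := exists_unit_power_code N.
    exists C; split => // j jN Gj; exfalso; apply: nex; exists j.
    by rewrite jN; exact/asboolP.
  have ub j : (j <= N)%N && `[< G N j >] -> (j <= N)%N by case/andP.
  case: (ex_maxnP ex ub) => j /andP[_ /asboolP[C C1 [Ce Cr]]] jmax.
  exists C; split => // j' j'N Gj'.
  have jj' : tol j <= tol j'.
    rewrite lef_pV2 ?posrE// ler_nat ltnS; apply: jmax; rewrite j'N; exact/asboolP.
  by split; [rewrite (le_trans Ce)// lee_fin|exact: le_trans Cr jj'].
pose C N := sval (cid (best N)).
have CP N : mean_square (C N) = 1 /\ forall j, (j <= N)%N -> G N j -> good_code rate (tol j) (C N).
  exact: (svalP (cid (best N))).
clearbody C.
have Cgood eps : 0 < eps -> \forall N \near \oo, good_code rate eps (C N).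
  move=> eps0; have [j jeps] : exists j, tol j <= eps.
    exists (Num.trunc eps^-1); rewrite /tol invf_ple ?posrE//; apply/ltW.
    exact: truncnS_gt.
  have [N0 N0P] := good _ (tol0 j).
  near=> N; have [_ /(_ j)] := CP N.
  have jN : (j <= N)%N by near: N; exact: nbhs_infty_ge.
  have N0N : (N0 <= N)%N by near: N; exact: nbhs_infty_ge.
  move=> /(_ jN (N0P N N0N))[e r].
  by split; [rewrite (le_trans e)// lee_fin|exact: le_trans r jeps].
exists C; split.
- by move=> N; have [] := CP N.
- apply/fine_cvgP; split.
    have := Cgood 1 ltr01; apply: filterS => N [e _].
    by rewrite ge0_fin_numE ?error_probability_ge0// (le_lt_trans e)// ltry.
  apply/cvgrPdist_le => eps eps0; have := Cgood eps eps0; apply: filterS => N [e _].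
  rewrite sub0r normrN ger0_norm ?fine_ge0 ?error_probability_ge0//=.
  rewrite -lee_fin fineK//.
  by rewrite ge0_fin_numE ?error_probability_ge0// (le_lt_trans e)// ltry.
apply/cvgrPdist_le => eps eps0; have := Cgood eps eps0; apply: filterS => N [_ r].
by rewrite distrC.
Unshelve. all: by end_near. Qed.

End achievability.

Section good_codes.
Context (R : realType) (cs : construction) (n p q : nat) (v : R).
Hypotheses (v0 : (0 < v)%R) (qn : (q <= n)%N).
Local Notation k := (signal_dim cs n q).
Context d (T : measurableType d) (P : probability T R).
Variables (A : nat -> T -> 'M[R[i]]_(p, n)) (z : nat -> T -> 'cV[R[i]]_p)
  (b : nat -> T -> {set 'I_n}).
Hypotheses (mA : forall t, measurable_fun setT (A t)) (mz : forall t, measurable_fun setT (z t))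
  (mb : forall t, measurable_fun setT (b t)).
Hypotheses (iA : forall t, iid_complex_normal P 1 (A t))
  (iz : forall t, iid_complex_normal P v (z t)) (ub : forall t, uniform_support P q (b t)).
Hypothesis ind : mutually_independent P (fun ti : nat * 'I_3 =>
  tnth [tuple g_sigma_algebra_preimage (A ti.1); g_sigma_algebra_preimage (z ti.1);
              g_sigma_algebra_preimage (b ti.1)] ti.2).
Hypothesis k0 : (0 < k)%N.
Variables (J rate : R).
Hypotheses (JE : forall s : {set 'I_n}, #|s| = q ->
    (\int[gaussian_matrix 1 p n]_a (logdet v (a *m sel R cs q s))%:E = J%:E)%E)
  (rateE : ln 2 * rate = J - ln 'C(n, q)%:R) (rate0 : 0 < rate).

(* With [x := N * eta], [expR x >= x ^ 2 / 2]. *)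
Let eventually_small (K eta : R) N : 0 < K -> 0 < eta -> 8 * K / eta ^+ 2 < N%:R ->
  K * (2 * expR (- (N%:R * eta))) + N%:R / N.+1%:R < 1.
Proof.
move=> K0 eta0; rewrite ltr_pdivrMr ?exprn_gt0// => h.
have N0 : 0 < N%:R :> R.
  rewrite -(pmulr_lgt0 _ (exprn_gt0 2 eta0)); apply: lt_trans h; rewrite mulr_gt0//.
have N1 : 1 <= N%:R :> R by rewrite ler1n -(ltr0n R).
have x0 : 0 <= N%:R * eta by rewrite mulr_ge0 ?ltW.
have e2 : (N%:R * eta) ^+ 2 / 2 <= expR (N%:R * eta).
  by apply: le_trans (expR_ge1Dxn 1 x0); rewrite lerDr.
rewrite expRN -[N.+1%:R]natr1.
have := expR_gt0 (N%:R * eta); move: e2 h N0 N1.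
move: (expR (N%:R * eta)) => e; move: (N%:R : R) => x e2 h x1 x1' e0.
(* The 8 in the hypothesis is the 2 in front of the exponential, the 2 dividing the square, and the
   2 from x + 1 <= 2 x, with x the block length. *)
have h2 : K * 2 * (x + 1) < e.
  apply: (lt_le_trans _ e2); rewrite exprMn ltr_pdivlMr//.
  apply: (@le_lt_trans _ _ (x * (8 * K))); first by nra.
  by rewrite expr2 -mulrA ltr_pM2l.
have -> : K * (2 / e) + x / (x + 1) = 1 - (e - K * 2 * (x + 1)) / (e * (x + 1)).
  by field; rewrite !gt_eqF// addr_gt0.
by rewrite ltrBlDr ltrDl divr_gt0 ?subr_gt0// mulr_gt0// addr_gt0.
Qed.

Lemma exists_good_code eps : 0 < eps -> exists N0, forall N, (N0 <= N)%N ->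
  exists2 C : block_code R k p n N.+1, mean_square C = 1 & good_code P A z b rate eps C.
Proof.
(* Capping the tolerance at the rate keeps the target rate [sigma] positive. *)
move=> eps0; pose de := Num.min eps rate.
have de0 : 0 < de by rewrite lt_min eps0.
have [de_eps de_rate] : de <= eps /\ de <= rate by rewrite !ge_min !lexx orbT.
have l2 := ln2_gt0 R.
pose sigma := rate - de / 2; have sigma0 : 0 < sigma by rewrite /sigma; lra.
pose g := ln 2 * (de / 6); have g0 : 0 < g by rewrite mulr_gt0 ?divr_gt0.
(* Exponents in nats per use: [s] for the number of codewords, [t] for the threshold, [r'] for the
   true score, spaced by [g]. Wrong codewords then contribute exp (- N g) and the true one exp (- N
   rho g). As 2 g is ln 2 times de / 3, below the ln 2 times de / 2 given up in [sigma], [r'] stays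
   under J - ln C(n, q). *)
pose s := ln 2 * sigma; pose t := s + g; pose r' := t + g.
have rJ : r' + ln 'C(n, q)%:R < J.
  have : J = ln 2 * rate + ln 'C(n, q)%:R by rewrite rateE subrK.
  by rewrite /r' /t /s /g /sigma; nra.
have ubeta : uniform_support (image_law P (mb 0%N)) q id by move=> S; rewrite -(ub 0%N).
have [rho /andP[rho0 rho1] hphi] := mixture_score_exponent v0 qn ubeta JE rJ.
rewrite addrK in hphi; set phi := expR (- (rho * r')) in hphi.
pose eta := rho * g; have eta0 : 0 < eta by rewrite mulr_gt0.
pose K := eps^-1; have K0 : 0 < K by rewrite invr_gt0.
(* The first term makes the error small by [eventually_small]; the second absorbs the rate lost to
   the filler symbol and to rounding M down, (sigma + 1) / (N + 1) at most. *)
pose N0 := (Num.trunc (8 * K / eta ^+ 2) + Num.trunc (2 * (sigma + 1) / de)).+1%N.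
exists N0 => N N0N.
have N1 : 8 * K / eta ^+ 2 < N%:R.
  apply: lt_le_trans (truncnS_gt _) _; rewrite ler_nat; apply: leq_trans N0N.
  by rewrite ltnS leq_addr.
have N2 : 2 * (sigma + 1) / de < N%:R.
  apply: lt_le_trans (truncnS_gt _) _; rewrite ler_nat; apply: leq_trans N0N.
  by rewrite ltnS leq_addl.
pose M := Num.trunc (expR (N%:R * s)).
have eN1 : 1 <= expR (N%:R * s).
  by rewrite -(expR0 R) ler_expR mulr_ge0// mulr_ge0// ltW.
have M0 : (0 < M)%N by rewrite truncn_gt0.
have Mle : M%:R <= expR (N%:R * s) by rewrite truncn_le// expR_ge0.
have Mgt : expR (N%:R * s) < M.+1%:R := truncnS_gt _.
pose theta := expR (N%:R * t); have theta0 : 0 < theta := expR_gt0 _.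
have kR0 : 0 < k%:R :> R by rewrite ltr0n.
have small : K * (theta `^ rho * phi ^+ N + theta^-1 * M%:R)
    + N%:R * k%:R / (k * N.+1)%N%:R < 1.
  apply: le_lt_trans (eventually_small K0 eta0 N1); apply: lerD; last first.
    by rewrite natrM (mulrC k%:R N.+1%:R) -mulf_div divff ?mulr1// gt_eqF.
  rewrite ler_pM2l// mulr_natl mulr2n; apply: lerD.
    rewrite /powR gt_eqF// /theta expRK /phi -expRM_natl -expRD ler_expR /eta /r'.
    by rewrite le_eqVlt; apply/orP; left; apply/eqP; ring.
  apply: (@le_trans _ _ (theta^-1 * expR (N%:R * s))).
    by rewrite ler_wpM2l// invr_ge0 ltW.
  rewrite /theta -expRN -expRD ler_expR /eta /t.
  have -> : - (N%:R * (s + g)) + N%:R * s = - (N%:R * g) by ring.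
  rewrite lerN2 ler_wpM2l// ler_piMl// ltW//.
have L0 : 0 < (k * N.+1)%N%:R :> R by rewrite ltr0n muln_gt0 k0.
pose kappa := channel_state_law p v P mb.
have [cw [cw1 cw2]] := exists_codebook (kappa := kappa) (@measurable_channel_use R cs n p q)
  (measurable_channel_score v0) (channel_score_gt0 v0 qn)
  (fun y => integral_mixture_score cs v0 qn y.2 y.1) (@measurable_signal_energy R k)
  (@signal_energy_ge0 R k) (integral_signal_energy R k) hphi theta0 M0 K0 L0 small.
rewrite invrK in cw1.
have states := channel_states_law mA mz mb iA iz ub ind (N := N).
eexists; first exact: (mean_square_codebook_code p v0 theta M0 k0 cw2).
split.
  exact: (error_probability_codebook_code v0 qn mA mz mb M0 theta0 rho0 states cw1).
(* Rounding down to a positive integer loses at most a factor 2, since M + 1 <= 2 M; that is one bit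
   in all. *)
have lnM : N%:R * s - ln 2 <= ln M%:R <= N%:R * s.
  apply/andP; split; last by rewrite -[leRHS]expRK ler_ln ?posrE ?expR_gt0// ltr0n.
  rewrite lerBlDr -[leLHS]expRK -lnM ?posrE// ?ltr0n//.
  rewrite ler_ln ?posrE ?expR_gt0// ?mulr_gt0 ?ltr0n//.
  by rewrite (le_trans (ltW Mgt))// -natrM ler_nat muln2 -addnn -addn1 leq_add2l.
rewrite /code_rate log2E /=.
have [lo up] := andP lnM.
have n0 : 0 < N.+1%:R :> R by rewrite ltr0n.
set u := (ln 2)^-1 * ln M%:R.
have lu : ln M%:R = ln 2 * u by rewrite mulrA mulfV ?mul1r// gt_eqF.
have u1 : u <= N%:R * sigma by rewrite -(ler_pM2l l2) -lu (le_trans up)// /s mulrCA.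
have u2 : N%:R * sigma - 1 <= u.
  by rewrite -(ler_pM2l l2) -lu (le_trans _ lo)// /s mulrBr mulr1 mulrCA.
rewrite ltr_pdivrMr// in N2.
have Nx : N.+1%:R = N%:R + 1 :> R by rewrite -natr1.
have N0' : 0 <= N%:R :> R by [].
rewrite ler_distl; apply/andP; split.
  apply: (@le_trans _ _ (rate - de)); first by rewrite lerD2l lerN2.
  rewrite ler_pdivlMr// Nx; apply: le_trans u2; rewrite /sigma in N2 *; nra.
apply: (@le_trans _ _ sigma); last by rewrite /sigma; lra.
by rewrite ler_pdivrMr// Nx (le_trans u1)//; nra.
Qed.

End good_codes.

Lemma error_probability_one_message (R : realType) d (T : measurableType d)
    (P : probability T R) (cs : construction) (n p q N : nat)
    (A : nat -> T -> 'M[R[i]]_(p, n)) (z : nat -> T -> 'cV[R[i]]_p)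
    (b : nat -> T -> {set 'I_n}) (C : block_code R (signal_dim cs n q) p n N) :
  messages C = 1%N -> error_probability P A z b C = 0%E.
Proof.
move=> C1; rewrite /error_probability big1 ?mule0// => m _.
rewrite (_ : [set w | _] = set0) ?measure0//; apply/seteqP; split => // w /=; apply.
have x0 (x : 'I_(messages C)) : x = 0%N :> nat.
  by move: (ltn_ord x); rewrite [X in (_ < X)%N]C1 ltnS leqn0 => /eqP.
by apply: val_inj; rewrite /= !x0.
Qed.

Local Close Scope complex_scope.

Theorem mainTheorem2 (R : realType) (n p q : nat) (snr : R) (cs : construction)
    (n_gt0 : (0 < n)%N) (p_gt0 : (0 < p)%N) (q_gt0 : (0 < q)%N) (q_le_n : (q <= n)%N)
    (snr_gt0 : 0 < snr)
    (dH : measure_display) (TH : measurableType dH) (PH : probability TH R)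
    (H : {RV PH >-> 'M[R[i]]_(p, q)}) (H_law : iid_complex_normal PH 1 H) :
  (forall (d : measure_display) (T : measurableType d) (P : probability T R)
      (A : {RV P >-> 'M[R[i]]_(p, n)}) (z : {RV P >-> 'cV[R[i]]_p})
      (b : {RV P >-> {set 'I_n}}) (c : {RV P >-> 'cV[R[i]]_(signal_dim cs n q)}),
    channel_law P q snr A z b ->
    iid_complex_normal P 1 c ->
    mutually_independent P
      (tnth [tuple g_sigma_algebra_preimage A; g_sigma_algebra_preimage z;
                   g_sigma_algebra_preimage b; g_sigma_algebra_preimage c]) ->
    let y := fun w => channel_output cs (A w) (z w) (b w) (c w) in
    ((cond_mutual_information P c y (fun w => (A w, b w)) - (entropy P b)%:E
        <= cond_mutual_information P c y A) /\
     (cond_mutual_information P c y (fun w => (A w, b w)) - (entropy P b)%:E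
        = mimo_information PH snr H - (log2 'C(n, q)%:R)%:E))%E) /\
  (forall (d : measure_display) (T : measurableType d) (P : probability T R)
      (A : nat -> {RV P >-> 'M[R[i]]_(p, n)}) (z : nat -> {RV P >-> 'cV[R[i]]_p})
      (b : nat -> {RV P >-> {set 'I_n}}),
    (forall t, channel_law P q snr (A t) (z t) (b t)) ->
    mutually_independent P (fun ti : nat * 'I_3 =>
      tnth [tuple g_sigma_algebra_preimage (A ti.1);
                  g_sigma_algebra_preimage (z ti.1);
                  g_sigma_algebra_preimage (b ti.1)] ti.2) ->
    forall Rc : R,
      Rc%:E = (mimo_information PH snr H - (entropy P (b 0%N))%:E)%E ->
      0 <= Rc ->
      achieved P cs q A z b Rc).
Proof.
have v0 : 0 < q%:R / snr by rewrite divr_gt0// ltr0n.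
have k0 : (0 < signal_dim cs n q)%N by case: cs.
have mH : measurable_fun setT H by exact: measurable_funPT.
split.
  move=> d T P A z b c [iA iz ub] ic ind y.
  have mA : measurable_fun setT A by exact: measurable_funPT.
  have mz : measurable_fun setT z by exact: measurable_funPT.
  have mb : measurable_fun setT b by exact: measurable_funPT.
  have mc : measurable_fun setT c by exact: measurable_funPT.
  have known := cond_mutual_information_known_support v0 q_le_n mA mz mb mc iA iz ub ic ind mH H_law.
  have unknown := cond_mutual_information_unknown_support v0 q_le_n mA mz mb mc iA iz ub ic ind mH H_law.
  rewrite mimo_informationE (entropy_uniform_support ub q_le_n).
  split; last by congr (_ - _)%E; exact: known.
  apply: le_trans unknown; rewrite le_eqVlt; apply/orP; left; apply/eqP.
  by congr (_ - _)%E; exact: known.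
move=> d T P A z b law ind Rc RcE Rc0.
have mA t : measurable_fun setT (A t) by exact: measurable_funPT.
have mz t : measurable_fun setT (z t) by exact: measurable_funPT.
have mb t : measurable_fun setT (b t) by exact: measurable_funPT.
have iA t : iid_complex_normal P 1 (A t) by case: (law t).
have iz t : iid_complex_normal P (q%:R / snr) (z t) by case: (law t).
have ub t : uniform_support P q (b t) by case: (law t).
have l2 := ln2_gt0 R.
have logdet_H0 w : (0 <= (logdet (q%:R / snr) (H w))%:E)%E by rewrite lee_fin logdet_ge0.
have mlH : measurable_fun setT (fun w => (logdet (q%:R / snr) (H w))%:E).
  by apply/measurable_EFinP; exact: measurable_fun_logdet.
move: RcE; rewrite mimo_informationE (entropy_uniform_support (ub 0%N) q_le_n).
under eq_integral do rewrite EFinM.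
rewrite ge0_integralZl//; last by rewrite lee_fin invr_ge0 ltW.
(* An infinite mean is incompatible with the equation for [Rc], whose left side is real. *)
case IE : (\int[PH]_w _)%E => [J| |]; last 2 first.
- by rewrite gt0_muley// lte_fin invr_gt0.
- by rewrite gt0_muleNy// lte_fin invr_gt0.
rewrite -EFinM -EFinB => -[RcE].
(* The random coding argument takes a positive rate; at rate 0 one message suffices and is never
   decoded wrongly. *)
have [Rc00|Rc_neq0] := eqVneq Rc 0.
  apply: achieved_of_good_codes => // eps eps0; exists 0%N => N _.
  have [C [C1 CM]] := exists_unit_power_code R p k0 N.
  exists C => //; split; first by rewrite error_probability_one_message// lee_fin ltW.
  by rewrite /code_rate CM /log2 ln1 !mul0r Rc00 subrr normr0 ltW.
have Rc_gt0 : 0 < Rc by rewrite lt_neqAle eq_sym Rc_neq0.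
apply: achieved_of_good_codes => //.
apply: (exists_good_code v0 q_le_n mA mz mb iA iz ub ind k0 (J := J)) => //.
  move=> s sq.
  have ml : measurable_fun setT (fun a : 'M[R[i]]_(p, n) =>
      (logdet (q%:R / snr) (a *m sel R cs q s))%:E).
    apply/measurable_EFinP; apply: measurable_fun_logdet => //; exact: measurable_mulmx.
  rewrite -(ge0_integral_iid_complex_normal (mA 0%N) (iA 0%N) ml); last first.
    by move=> a; rewrite lee_fin logdet_ge0.
  by rewrite (integral_logdet_sel cs v0 (mA 0%N) (iA 0%N) mH H_law sq).
(* Conversion from bits, used by the statement, to the nats of the exponents. *)
by rewrite RcE /log2 mulrBr mulrA mulfV ?mul1r ?gt_eqF// mulrC mulfVK// gt_eqF.
Qed.
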